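(* There is an algorithm in the Real RAM model of computation that, given a set $P$ of $n$ points in the plane representing a unit disk graph $G$, outputs in $O(n\log n)$ time (regardless of the number of edges of $G$) a dominating set $D$ of $G$ with $|D| \le \frac{44}{9}\,|D^*|$, where $D^*$ is a minimum dominating set of $G$.
   Context: The unit disk graph represented by a finite point set $P\subset\mathbb{R}^2$ has vertex set $P$, with two points adjacent if and only if their Euclidean distance is at most $1$. A dominating set of a graph $G=(V,E)$ is a set $D\subseteq V$ such that every vertex not in $D$ is adjacent to some vertex of $D$; a minimum dominating set is one of smallest cardinality. *)

(* Defs.v *)
From mathcomp Require Import all_boot all_order all_algebra finmap.
From mathcomp Require Import all_classical all_reals all_analysis.

Set Implicit Arguments.
Unset Strict Implicit.
Unset Printing Implicit Defensive.

Import Order.TTheory GRing.Theory Num.Theory.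

Local Open Scope ring_scope.

Record sgraph (T : choiceType) := SGraph {
  vertices : {fset T};
  adj : rel T;
  adj_vertices : forall x y, adj x y -> (x \in vertices) && (y \in vertices);
  adj_sym : symmetric adj;
  adj_irrefl : irreflexive adj }.

Definition dominating (T : choiceType) (G : sgraph T) (D : {fset T}) : Prop :=
  {subset D <= vertices G} /\
  forall v, v \in vertices G -> v \notin D -> exists2 u, u \in D & adj G v u.

Definition minimum_dominating (T : choiceType) (G : sgraph T) (D : {fset T}) :
    Prop :=
  dominating G D /\ forall D', dominating G D' -> (#|` D| <= #|` D'|)%N.

Section UnitDiskGraph.
Variable R : realType.

(* The library norm on pairs and row vectors is the sup norm, hence this
   explicit definition. *)
Definition edist (p q : R * R) : R :=
  Num.sqrt ((p.1 - q.1) ^+ 2 + (p.2 - q.2) ^+ 2).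

Variable P : {fset R * R}.

Definition udg_adj : rel (R * R)%type :=
  fun p q => [&& p \in P, q \in P, p != q & edist p q <= 1].

Fact udg_adj_vertices p q : udg_adj p q -> (p \in P) && (q \in P).
Proof. by case/and4P=> -> ->. Qed.

Fact udg_adj_sym : symmetric udg_adj.
Proof.
move=> p q; rewrite /udg_adj andbCA eq_sym /edist.
by rewrite -(opprB q.1) -(opprB q.2) !sqrrN.
Qed.

Fact udg_adj_irrefl : irreflexive udg_adj.
Proof. by move=> p; rewrite /udg_adj eqxx /= !andbF. Qed.

Definition udg : sgraph (R * R)%type :=
  SGraph udg_adj_vertices udg_adj_sym udg_adj_irrefl.

End UnitDiskGraph.

(* The real RAM: every register and every memory cell holds one real number and
   each instruction costs one time unit.  Registers are addressed directly by
   the program, memory cells only through the content of a register.  There is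
   no rounding instruction; constants in the program are rational. *)
Inductive instr : Type :=
| Const of nat & rat            (* r_i := q *)
| Copy of nat & nat             (* r_i := r_j *)
| Plus of nat & nat & nat       (* r_i := r_j + r_k *)
| Minus of nat & nat & nat      (* r_i := r_j - r_k *)
| Times of nat & nat & nat      (* r_i := r_j * r_k *)
| Divide of nat & nat & nat     (* r_i := r_j / r_k *)
| Fetch of nat & nat            (* r_i := M[r_j] *)
| Store of nat & nat            (* M[r_i] := r_j *)
| Jump of nat                   (* goto l *)
| JumpLt of nat & nat & nat     (* if r_i < r_j goto l *)
| JumpEq of nat & nat & nat     (* if r_i = r_j goto l *)
| Halt.

Definition program := seq instr.

Section RealRAM.
Variable R : realType.

Record config := Config { pc : nat; reg : nat -> R; cell : nat -> R }.

Definition upd (f : nat -> R) (i : nat) (x : R) : nat -> R :=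
  [eta f with i |-> x].

Definition set_reg (c : config) (i : nat) (x : R) : config :=
  Config (pc c).+1 (upd (reg c) i x) (cell c).

Definition jump_if (b : bool) (l : nat) (c : config) : config :=
  Config (if b then l else (pc c).+1) (reg c) (cell c).

(* [None] when the machine is stuck or has nothing left to do: halted, program
   counter out of range, division by zero, or memory access at an address that
   is not a natural number. *)
Definition step (p : program) (c : config) : option config :=
  let r := reg c in
  let m := cell c in
  match onth p (pc c) with
  | Some (Const i q) => Some (set_reg c i (ratr q))
  | Some (Copy i j) => Some (set_reg c i (r j))
  | Some (Plus i j k) => Some (set_reg c i (r j + r k))
  | Some (Minus i j k) => Some (set_reg c i (r j - r k))
  | Some (Times i j k) => Some (set_reg c i (r j * r k))
  | Some (Divide i j k) =>
      if r k == 0 then None else Some (set_reg c i (r j / r k))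
  | Some (Fetch i j) =>
      if r j \is a Num.nat then Some (set_reg c i (m (Num.truncn (r j))))
      else None
  | Some (Store i j) =>
      if r i \is a Num.nat then
        Some (Config (pc c).+1 r (upd m (Num.truncn (r i)) (r j)))
      else None
  | Some (Jump l) => Some (jump_if true l c)
  | Some (JumpLt i j l) => Some (jump_if (r i < r j) l c)
  | Some (JumpEq i j l) => Some (jump_if (r i == r j) l c)
  | Some Halt | None => None
  end.

Definition steps (p : program) (t : nat) (c : config) : option config :=
  iter t (obind (step p)) (Some c).

Definition halts_in (p : program) (c : config) (t : nat) (c' : config) : Prop :=
  steps p t c = Some c' /\ onth p (pc c') = Some Halt.

Definition coords (s : seq (R * R)) : seq R :=
  flatten [seq [:: x.1; x.2] | x <- s].

(* A list of n points is passed as r_0 = n and M[0 .. 2n-1] = its coordinates,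
   everything else being 0 initially; results are returned in the same format,
   with no constraint on the other registers and cells. *)
Definition input (s : seq (R * R)) : config :=
  Config 0 (upd (fun=> 0) 0 (size s)%:R) (nth 0 (coords s)).

Definition output (c : config) (s : seq (R * R)) : Prop :=
  reg c 0%N = (size s)%:R /\
  forall i, (i < (size s).*2)%N -> cell c i = nth 0 (coords s) i.

End RealRAM.

Definition enumerates (T : choiceType) (s : seq T) (A : {fset T}) : Prop :=
  uniq s /\ s =i A.

(* Main.v *)
(* The plane is cut into large square blocks, the point set of each block is
   solved approximately in linear time, and the union of these solutions is
   taken; the best result over a constant number of shifts of the blocks is kept.
   Blocks are computed without rounding by sorting along one axis, walking through
   the list and restarting the subdivision after each gap of more than 2, and then
   doing the same in each slab along the other axis.

   In a block, a fine net is built greedily, and the four points extreme in the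
   axis directions in each ball of the net are the representatives.  For every
   subset of these boundedly many representatives, extend the subset greedily by
   points at distance more than 1 from all the points already taken, and keep the
   smallest dominating set obtained.

   Let v be a point of an optimal solution whose neighbourhood lies in one block.
   Two representatives r, r' very close to v satisfy (r - v).(r' - v) <= 0.  A disk
   of radius 1 around v contains no three points pairwise at distance more than 1
   that are also at distance more than 1 from r and r'.  For the subset of all such
   pairs {r, r'}, the greedy extension therefore adds at most 2 points near v,
   which makes 4 points for v.  A point v whose neighbourhood is cut by the blocks
   is charged at most 100 points by packing; averaging over the shifts, at most
   4/500 of the optimal points are cut for some shift, and
   4 + 100 * 4/500 = 4.8 < 44/9. *)

Require Import Defs.
From mathcomp Require Import all_boot all_order all_algebra finmap.
From mathcomp Require Import all_classical all_reals all_analysis.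
From mathcomp Require Import zify ring lra.
Import Order.TTheory GRing.Theory Num.Theory.
Set Implicit Arguments.
Unset Strict Implicit.
Unset Printing Implicit Defensive.
Local Open Scope ring_scope.

(** * A structured language and its compilation to the real RAM *)

(** The analysis compares with an optimal solution that the algorithm does not know. This is why all
    subsets are tried: the subset used in the analysis is one of them. The bounded diameter of a
    block bounds its net by packing, hence the number of trials, so only sorting takes more than
    linear time. The obstacle to the shifting argument is that the subdivision, restarted after
    gaps, is not one grid moved by the shift. But the places of the restarts do not depend on the
    shift: each point has a fixed distance to the last restart before it, and only two residues of
    the shift put a boundary between it and a point at distance at most 1. Two axes give 4/500. The
    slabs of the second axis depend on the first shift but not on the second, so averaging over the
    second shift works for each first shift. The constant 100 is four classes of blocks, by the
    parities of their numbers, times 25 cells of side 1/2; within one class, nearby points share a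
    block. Programs are written in a structured language with a step count and compiled once and for
    all, so that time is never bounded on machine code. *)

Inductive cond :=
| VLt of nat & nat | VEq of nat & nat | NLt of nat & nat | NEq of nat & nat.

Inductive binop := Add | Sub | Mul.

(* A structured language over natural-number variables, real variables and real
   arrays indexed by natural-number variables.  [For i n c] runs [c] with
   [i = 0, ..., n - 1]; [RawLd] and [RawSt] access the cells shared with the
   outside, where the input is read and the output is written. *)
Inductive cmd :=
| Skip
| NSet of nat & nat
| NCopy of nat & nat
| NAdd of nat & nat & nat
| NInc of nat
| VSet of nat & rat
| VCopy of nat & nat
| VNat of nat & nat
| VOp of binop & nat & nat & nat
| Ld of nat & nat & nat
| St of nat & nat & nat
| RawLd of nat & nat
| RawSt of nat & nat
| Seq of cmd & cmd
| If of cond & cmd & cmd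
| For of nat & nat & cmd.

Declare Scope cmd_scope.
Delimit Scope cmd_scope with cmd.
Bind Scope cmd_scope with cmd.
Notation "c1 ;; c2" := (Seq c1 c2)
  (at level 60, right associativity, format "c1 ;;  c2") : cmd_scope.

(* Natural-number variable [i] lives in register [3 i] and real variable [x] in
   register [3 x + 1]; registers 5 and 8 are scratch.  Register 2 holds the
   number [B] of input cells, and entry [i] of array [a] is the memory cell
   [B + stride * i + a]. *)
Definition stride := 20%N.
Definition nr (i : nat) := (3 * i)%N.
Definition vr (i : nat) := (3 * i + 1)%N.

Definition addr (a i : nat) : program :=
  [:: Const 5 stride%:R; Times 5 5 (nr i); Plus 5 5 2; Const 8 a%:R;
      Plus 5 5 8].

Definition jump_on (b : cond) (l : nat) : instr :=
  match b with
  | VLt x y => JumpLt (vr x) (vr y) l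
  | VEq x y => JumpEq (vr x) (vr y) l
  | NLt x y => JumpLt (nr x) (nr y) l
  | NEq x y => JumpEq (nr x) (nr y) l
  end.

(** Jump targets are absolute, hence the position [off] of the code. The second branch of [If] comes
    first, where a failed test falls through. Raw accesses are guarded by a comparison with register
    2, so that they never touch the cells of the arrays. *)
Fixpoint compile (off : nat) (c : cmd) : program :=
  match c with
  | Skip => [::]
  | NSet i k => [:: Const (nr i) k%:R]
  | NCopy i j => [:: Copy (nr i) (nr j)]
  | NAdd i j k => [:: Plus (nr i) (nr j) (nr k)]
  | NInc i => [:: Const 5 1; Plus (nr i) (nr i) 5]
  | VSet x q => [:: Const (vr x) q]
  | VCopy x y => [:: Copy (vr x) (vr y)]
  | VNat x i => [:: Copy (vr x) (nr i)]
  | VOp Add x y z => [:: Plus (vr x) (vr y) (vr z)]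
  | VOp Sub x y z => [:: Minus (vr x) (vr y) (vr z)]
  | VOp Mul x y z => [:: Times (vr x) (vr y) (vr z)]
  | Ld x a i => addr a i ++ [:: Fetch (vr x) 5]
  | St a i x => addr a i ++ [:: Store 5 (vr x)]
  | RawLd x i => [:: JumpLt (nr i) 2 (off + 2); Jump (off + 3);
                     Fetch (vr x) (nr i)]
  | RawSt i x => [:: JumpLt (nr i) 2 (off + 2); Jump (off + 3);
                     Store (nr i) (vr x)]
  | Seq c1 c2 =>
      let p1 := compile off c1 in p1 ++ compile (off + size p1) c2
  | If b c1 c2 =>
      let p2 := compile off.+1 c2 in
      let l1 := (off + size p2 + 2)%N in
      let p1 := compile l1 c1 in
      jump_on b l1 :: p2 ++ Jump (l1 + size p1) :: p1
  | For i n c =>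
      let p := compile (off + 3) c in
      [:: Const (nr i) 0; JumpLt (nr i) (nr n) (off + 3);
          Jump (off + 3 + size p + 3)] ++
      p ++ [:: Const 5 1; Plus (nr i) (nr i) 5; Jump (off + 1)]
  end.

Fixpoint modN (c : cmd) : seq nat :=
  match c with
  | NSet i _ | NCopy i _ | NAdd i _ _ | NInc i => [:: i]
  | Seq c1 c2 | If _ c1 c2 => modN c1 ++ modN c2
  | For i _ c => i :: modN c
  | _ => [::]
  end.

Fixpoint modV (c : cmd) : seq nat :=
  match c with
  | VSet x _ | VCopy x _ | VNat x _ | VOp _ x _ _ | Ld x _ _ | RawLd x _ => [:: x]
  | Seq c1 c2 | If _ c1 c2 => modV c1 ++ modV c2
  | For _ _ c => modV c
  | _ => [::]
  end.

Fixpoint modA (c : cmd) : seq nat :=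
  match c with
  | St a _ _ => [:: a]
  | Seq c1 c2 | If _ c1 c2 => modA c1 ++ modA c2
  | For _ _ c => modA c
  | _ => [::]
  end.

Fixpoint modI (c : cmd) : bool :=
  match c with
  | RawSt _ _ => true
  | Seq c1 c2 | If _ c1 c2 => modI c1 || modI c2
  | For _ _ c => modI c
  | _ => false
  end.

(** The body of a loop assigns neither its counter nor its bound, so that [den] may fix the number
    of rounds on entry; array numbers below [stride] make distinct entries distinct cells. *)
Fixpoint wf (c : cmd) : bool :=
  match c with
  | Ld _ a _ | St a _ _ => (a < stride)%N
  | Seq c1 c2 | If _ c1 c2 => wf c1 && wf c2
  | For i n c => [&& i != n, i \notin modN c, n \notin modN c & wf c]
  | _ => true
  end.

(** * Semantics, step count and correctness of compilation *)

Section Machine.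
Variable R : realType.
Variable B : nat.

Record st := State {
  N : nat -> nat; V : nat -> R; A : nat -> nat -> R; I : nat -> R }.

Definition setN i k s :=
  State (fun j => if j == i then k else N s j) (V s) (A s) (I s).
Definition setV i x s :=
  State (N s) (fun j => if j == i then x else V s j) (A s) (I s).
Definition setA a i x s :=
  State (N s) (V s)
    (fun b => if b == a then (fun j => if j == i then x else A s a j) else A s b)
    (I s).
Definition setI i x s :=
  State (N s) (V s) (A s) (fun j => if j == i then x else I s j).

Definition holds (b : cond) (s : st) : bool :=
  match b with
  | VLt x y => V s x < V s y
  | VEq x y => V s x == V s y
  | NLt i j => (N s i < N s j)%N
  | NEq i j => N s i == N s j
  end.

Definition eval (o : binop) (x y : R) : R :=
  match o with Add => x + y | Sub => x - y | Mul => x * y end.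

Fixpoint den (c : cmd) (s : st) : st :=
  match c with
  | Skip => s
  | NSet i k => setN i k s
  | NCopy i j => setN i (N s j) s
  | NAdd i j k => setN i (N s j + N s k)%N s
  | NInc i => setN i (N s i).+1 s
  | VSet x q => setV x (ratr q) s
  | VCopy x y => setV x (V s y) s
  | VNat x i => setV x (N s i)%:R s
  | VOp o x y z => setV x (eval o (V s y) (V s z)) s
  | Ld x a i => setV x (A s a (N s i)) s
  | St a i x => setA a (N s i) (V s x) s
  | RawLd x i => if (N s i < B)%N then setV x (I s (N s i)) s else s
  | RawSt i x => if (N s i < B)%N then setI (N s i) (V s x) s else s
  | Seq c1 c2 => den c2 (den c1 s)
  | If b c1 c2 => if holds b s then den c1 s else den c2 s
  | For i n c =>
      setN i (N s n) (iteri (N s n) (fun k s' => den c (setN i k s')) s)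
  end.

(** Upper bound on the steps of the compiled code. Only [If] is overcounted, when its first branch
    runs, which has no closing jump. A loop pays 4 per round for the test, the increment and the
    jump back. *)
Fixpoint cost (c : cmd) (s : st) : nat :=
  match c with
  | Skip => 0
  | NInc _ | RawLd _ _ | RawSt _ _ => 2
  | Ld _ _ _ | St _ _ _ => 6
  | Seq c1 c2 => cost c1 s + cost c2 (den c1 s)
  | If b c1 c2 => (if holds b s then cost c1 s else cost c2 s) + 2
  | For i n c =>
      \sum_(k < N s n)
        (cost c (setN i k (iteri k (fun k s' => den c (setN i k s')) s)) + 4)
      + 3
  | _ => 1
  end.

Lemma den_N c s j : j \notin modN c -> N (den c s) j = N s j.
Proof.
elim: c s => //=.
- by move=> i k s; rewrite inE => /negPf ->.
- by move=> i k s; rewrite inE => /negPf ->.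
- by move=> i k l s; rewrite inE => /negPf ->.
- by move=> i s; rewrite inE => /negPf ->.
- by move=> x i s; case: ifP.
- by move=> x i s; case: ifP.
- by move=> c1 IH1 c2 IH2 s; rewrite mem_cat => /norP[/IH1 h1 /IH2 ->].
- by move=> b c1 IH1 c2 IH2 s; rewrite mem_cat => /norP[/IH1 h1 /IH2 h2]; case: ifP.
- move=> i n c IH s; rewrite inE => /norP[ji jc].
  rewrite (negPf ji); elim: (N s n) => //= k <-.
  by rewrite IH //= (negPf ji).
Qed.

Lemma den_V c s j : j \notin modV c -> V (den c s) j = V s j.
Proof.
elim: c s => //=.
- by move=> i k s; rewrite inE => /negPf ->.
- by move=> i k s; rewrite inE => /negPf ->.
- by move=> i k s; rewrite inE => /negPf ->.
- by move=> o i k l s; rewrite inE => /negPf ->.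
- by move=> i a l s; rewrite inE => /negPf ->.
- by move=> x i s; rewrite inE => /negPf h; case: ifP => //=; rewrite h.
- by move=> x i s; case: ifP.
- by move=> c1 IH1 c2 IH2 s; rewrite mem_cat => /norP[/IH1 h1 /IH2 ->].
- by move=> b c1 IH1 c2 IH2 s; rewrite mem_cat => /norP[/IH1 h1 /IH2 h2]; case: ifP.
- by move=> i n c IH s jc; elim: (N s n) => //= k <-; rewrite IH.
Qed.

Lemma den_A c s a : a \notin modA c -> A (den c s) a = A s a.
Proof.
elim: c s => //=.
- by move=> b i x s; rewrite inE => /negPf ->.
- by move=> x i s; case: ifP.
- by move=> x i s; case: ifP.
- by move=> c1 IH1 c2 IH2 s; rewrite mem_cat => /norP[/IH1 h1 /IH2 ->].
- by move=> b c1 IH1 c2 IH2 s; rewrite mem_cat => /norP[/IH1 h1 /IH2 h2]; case: ifP.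
- by move=> i n c IH s jc; elim: (N s n) => //= k <-; rewrite IH.
Qed.

Lemma den_I c s : ~~ modI c -> I (den c s) = I s.
Proof.
elim: c s => //=.
- by move=> x i s; case: ifP.
- by move=> c1 IH1 c2 IH2 s /norP[/IH1 h1 /IH2 ->].
- by move=> b c1 IH1 c2 IH2 s /norP[/IH1 h1 /IH2 h2]; case: ifP.
- by move=> i n c IH s jc; elim: (N s n) => //= k <-; rewrite IH.
Qed.

Record repr (s : st) (f : config R) : Prop := Repr {
  repr_N : forall i, reg f (nr i) = (N s i)%:R;
  repr_V : forall x, reg f (vr x) = V s x;
  repr_B : reg f 2 = B%:R;
  repr_I : forall i, (i < B)%N -> cell f i = I s i;
  repr_A : forall a i, (a < stride)%N -> cell f (B + (stride * i + a)) = A s a i }.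

Definition reach (p : program) (f : config R) (t : nat) (g : config R) :=
  exists2 t', (t' <= t)%N & steps p t' f = Some g.

Definition code_at (p : program) (off : nat) (q : program) :=
  forall i x, onth q i = Some x -> onth p (off + i) = Some x.

Lemma code_at_cat p off q1 q2 : code_at p off (q1 ++ q2) ->
  code_at p off q1 /\ code_at p (off + size q1) q2.
Proof.
move=> h; split=> i x hx; last first.
  by rewrite -addnA; apply: h; rewrite onth_cat ltnNge leq_addr addKn.
apply: h; rewrite onth_cat; case: ltnP => // hi.
by move: hx; rewrite onth_default.
Qed.

Lemma code_at_cons p off x q : code_at p off (x :: q) ->
  onth p off = Some x /\ code_at p off.+1 q.
Proof.
move=> h; split; first by rewrite -[off]addn0; apply: h.
by move=> i y hy; rewrite addSnnS; apply: h.
Qed.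

Lemma reach_refl p f t : reach p f t f.
Proof. by exists 0%N. Qed.

Lemma reach_trans p f g h t1 t2 :
  reach p f t1 g -> reach p g t2 h -> reach p f (t1 + t2) h.
Proof.
move=> [u1 l1 e1] [u2 l2 e2]; exists (u2 + u1)%N; first by rewrite addnC leq_add.
by rewrite /steps iterD -[iter u1 _ _]/(steps p u1 f) e1.
Qed.

Lemma reach_step p f g t h :
  step p f = Some g -> reach p g t h -> reach p f t.+1 h.
Proof.
move=> e r; rewrite -[t.+1]add1n; apply: reach_trans r.
by exists 1%N => //=; rewrite /steps /= e.
Qed.

Lemma reach_le p f g t t' : (t <= t')%N -> reach p f t g -> reach p f t' g.
Proof. by move=> h [u hu e]; exists u => //; apply: leq_trans h. Qed.

Local Arguments onth : simpl never.

Lemma natM_in (x : R) n : x = n%:R -> (x \is a Num.nat) * (Num.truncn x = n).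
Proof. by move=> ->; split; [rewrite natr_nat | rewrite natrK]. Qed.

Lemma nr_vr i x : (nr i == vr x) = false. Proof. by rewrite /nr /vr; lia. Qed.
Lemma vr_nr i x : (vr x == nr i) = false. Proof. by rewrite /nr /vr; lia. Qed.
Lemma nr_nr i j : (nr i == nr j) = (i == j). Proof. by rewrite /nr; lia. Qed.
Lemma vr_vr i j : (vr i == vr j) = (i == j). Proof. by rewrite /vr; lia. Qed.
Lemma nr2 i : (nr i == 2)%N = false. Proof. by rewrite /nr; lia. Qed.
Lemma vr2 i : (vr i == 2)%N = false. Proof. by rewrite /vr; lia. Qed.
Lemma nr5 i : (nr i == 5)%N = false. Proof. by rewrite /nr; lia. Qed.
Lemma vr5 i : (vr i == 5)%N = false. Proof. by rewrite /vr; lia. Qed.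
Lemma nr8 i : (nr i == 8)%N = false. Proof. by rewrite /nr; lia. Qed.
Lemma vr8 i : (vr i == 8)%N = false. Proof. by rewrite /vr; lia. Qed.
Lemma r2n i : (2 == nr i)%N = false. Proof. by rewrite /nr; lia. Qed.
Lemma r2v i : (2 == vr i)%N = false. Proof. by rewrite /vr; lia. Qed.
Definition regE := (nr_vr, vr_nr, nr_nr, vr_vr, nr2, vr2, nr5, vr5, nr8, vr8, r2n, r2v).

Lemma repr_setN s f g i k : repr s f -> cell g = cell f ->
  reg g (nr i) = k%:R ->
  (forall j, j != nr i -> j != 5%N -> j != 8%N -> reg g j = reg f j) ->
  repr (setN i k s) g.
Proof.
move=> [hN hV hB hI hA] ec ei eo; split=> //=.
- move=> j; case: eqP => [-> //|ji].
  by rewrite eo ?regE //; apply/eqP.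
- by move=> x; rewrite eo ?regE.
- by rewrite eo ?regE.
- by rewrite ec.
- by rewrite ec.
Qed.

Lemma repr_setV s f g i x : repr s f -> cell g = cell f ->
  reg g (vr i) = x ->
  (forall j, j != vr i -> j != 5%N -> j != 8%N -> reg g j = reg f j) ->
  repr (setV i x s) g.
Proof.
move=> [hN hV hB hI hA] ec ei eo; split=> //=.
- by move=> j; rewrite eo ?regE.
- move=> j; case: eqP => [-> //|ji].
  by rewrite eo ?regE //; apply/eqP.
- by rewrite eo ?regE.
- by rewrite ec.
- by rewrite ec.
Qed.

Lemma repr_same s f g : repr s f -> cell g = cell f ->
  (forall j, j != 5%N -> j != 8%N -> reg g j = reg f j) ->
  repr s g.
Proof.
move=> [hN hV hB hI hA] ec eo; split=> //=.
- by move=> j; rewrite eo ?regE.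
- by move=> j; rewrite eo ?regE.
- by rewrite eo.
- by rewrite ec.
- by rewrite ec.
Qed.

Lemma addr_run p a i s f : code_at p (pc f) (addr a i) -> repr s f ->
  exists g, [/\ reach p f 5 g, repr s g, pc g = (pc f + 5)%N &
     reg g 5 = (B + (stride * N s i + a))%:R].
Proof.
move=> /code_at_cons[h0 /code_at_cons[h1 /code_at_cons[h2 /code_at_cons[h3]]]].
move=> /code_at_cons[h4 _] rep.
eexists; split.
- apply: reach_step; first by rewrite /step h0.
  apply: reach_step; first by rewrite /step /= h1.
  apply: reach_step; first by rewrite /step /= h2.
  apply: reach_step; first by rewrite /step /= h3.
  apply: reach_step; first by rewrite /step /= h4.
  exact: reach_refl.
- apply: (repr_same rep) => //= j j5 j8.
  by rewrite /upd /= (negPf j5) (negPf j8).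
- by rewrite /=; lia.
- rewrite /upd /= !regE /= (repr_N rep) (repr_B rep) !ratr_nat.
  by rewrite (natrD R B) (natrD R (stride * _)) natrM addrA [B%:R + _]addrC.
Qed.

Lemma holds_jump p f s b l : repr s f -> onth p (pc f) = Some (jump_on b l) ->
  step p f = Some (jump_if (holds b s) l f).
Proof.
by move=> rep; case: b => x y h; rewrite /step h /= ?(repr_N rep) ?(repr_V rep)
  ?ltr_nat ?eqr_nat.
Qed.

Lemma repr_jump s f b l : repr s f -> repr s (jump_if b l f).
Proof. by move=> rep; apply: repr_same rep _ _. Qed.

Lemma repr_pc s f n : repr s f -> repr s (Config n (reg f) (cell f)).
Proof. by move=> rep; apply: repr_same rep _ _. Qed.

Definition it i c (s : st) k := iteri k (fun k s' => den c (setN i k s')) s.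

Lemma compile_correct p c s f : wf c -> code_at p (pc f) (compile (pc f) c) ->
  repr s f ->
  exists g, [/\ reach p f (cost c s) g, repr (den c s) g &
    pc g = (pc f + size (compile (pc f) c))%N].
Proof.
elim: c s f => [|||||||||||||||].
- by move=> s f _ _ rep; exists f; split=> //=; [apply: reach_refl | rewrite addn0].
- move=> i k s f _ /code_at_cons[h0 _] rep.
  eexists; split; first by apply: reach_step; [rewrite /step h0 | exact: reach_refl].
    by apply: (repr_setN rep) => //= [|j /negPf hj]; rewrite /upd /= ?eqxx ?hj ?ratr_nat.
  by rewrite /=; lia.
- move=> i k s f _ /code_at_cons[h0 _] rep.
  eexists; split; first by apply: reach_step; [rewrite /step h0 | exact: reach_refl].
    by apply: (repr_setN rep) => //= [|j /negPf hj]; rewrite /upd /= ?eqxx ?hj ?(repr_N rep).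
  by rewrite /=; lia.
- move=> i k l s f _ /code_at_cons[h0 _] rep.
  eexists; split; first by apply: reach_step; [rewrite /step h0 | exact: reach_refl].
    by apply: (repr_setN rep) => //= [|j /negPf hj]; rewrite /upd /= ?eqxx ?hj ?(repr_N rep) ?natrD.
  by rewrite /=; lia.
- move=> i s f _ /code_at_cons[h0 /code_at_cons[h1 _]] rep.
  eexists; split.
    apply: reach_step; first by rewrite /step h0.
    by apply: reach_step; [rewrite /step /= h1 | exact: reach_refl].
    apply: (repr_setN rep) => //= [|j /negPf hj /negPf h5 _]; rewrite /upd /= ?hj ?h5 //.
    by rewrite ?eqxx !regE /= (repr_N rep) -natr1 (ratr_nat R 1).
  by rewrite /=; lia.
- move=> i q s f _ /code_at_cons[h0 _] rep.
  eexists; split; first by apply: reach_step; [rewrite /step h0 | exact: reach_refl].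
    by apply: (repr_setV rep) => //= [|j /negPf hj]; rewrite /upd /= ?eqxx ?hj.
  by rewrite /=; lia.
- move=> i k s f _ /code_at_cons[h0 _] rep.
  eexists; split; first by apply: reach_step; [rewrite /step h0 | exact: reach_refl].
    by apply: (repr_setV rep) => //= [|j /negPf hj]; rewrite /upd /= ?eqxx ?hj ?(repr_V rep).
  by rewrite /=; lia.
- move=> i k s f _ /code_at_cons[h0 _] rep.
  eexists; split; first by apply: reach_step; [rewrite /step h0 | exact: reach_refl].
    by apply: (repr_setV rep) => //= [|j /negPf hj]; rewrite /upd /= ?eqxx ?hj ?(repr_N rep).
  by rewrite /=; lia.
- move=> o i k l s f _ h rep.
  have [g [e1 e2 e3 e4]] : exists g, [/\ step p f = Some g, cell g = cell f,
      reg g = upd (reg f) (vr i) (eval o (reg f (vr k)) (reg f (vr l))) &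
      pc g = (pc f).+1].
    by case: o h => /code_at_cons[h0 _]; eexists; split;
      rewrite /step ?h0.
  exists g; split; first by apply: reach_step; [exact: e1 | exact: reach_refl].
    by apply: (repr_setV rep) => //= [|j /negPf hj _ _]; rewrite e3 /upd /= ?eqxx
      ?(repr_V rep) ?hj.
  by rewrite e4; case: o {h e3}; rewrite addn1.
- move=> x a i s f ha.
  rewrite -[compile _ _]/(addr a i ++ [:: Fetch (vr x) 5]) => /code_at_cat[h] /code_at_cons[h0 _].
  move=> /(addr_run h)[g [r1 rep e1 e2]].
  have [e3 e4] := natM_in e2.
  eexists; split.
  + apply: (@reach_trans _ _ g _ 5 1) => //.
    by apply: reach_step; [rewrite /step e1 h0 e3 | exact: reach_refl].
  + apply: (repr_setV rep) => //= [|j /negPf hj]; rewrite /upd /= ?hj //.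
    by rewrite ?eqxx e4 (repr_A rep).
  + by rewrite /= e1; lia.
- move=> a i x s f ha.
  rewrite -[compile _ _]/(addr a i ++ [:: Store 5 (vr x)]) => /code_at_cat[h] /code_at_cons[h0 _].
  move=> /(addr_run h)[g [r1 rep e1 e2]].
  have [e3 e4] := natM_in e2.
  eexists; split.
  + apply: (@reach_trans _ _ g _ 5 1) => //.
    by apply: reach_step; [rewrite /step e1 h0 e3 | exact: reach_refl].
  + case: (rep) => [hN hV hB hI hA]; split=> //=.
      by move=> j jB; rewrite e4 /upd /= ltn_eqF ?hI //; lia.
    move=> b j hb; rewrite e4 hV /upd /=.
    have -> : ((B + (stride * j + b))%N == (B + (stride * N s i + a))%N) =
       ((b == a) && (j == N s i)) by move: ha hb; rewrite /= /stride; lia.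
    by have [->/=|] := eqVneq b a; rewrite hA.
  + by rewrite /=; lia.
- move=> x i s f _ /code_at_cons[h0 /code_at_cons[h1 /code_at_cons[h2 _]]] rep.
  have e0 : step p f = Some (jump_if (N s i < B)%N (pc f + 2) f).
    by rewrite /step h0 (repr_N rep) (repr_B rep) ltr_nat.
  have [e3 e4] := natM_in (repr_N rep i).
  rewrite /=; case: ifP e0 => iB e0; eexists; split.
  + apply: reach_step; first exact: e0.
    by apply: reach_step; [rewrite /step /= addn2 h2 e3 | exact: reach_refl].
  + apply: (repr_setV rep) => //= [|j /negPf hj]; rewrite /upd /= ?hj //.
    by rewrite eqxx e4 (repr_I rep).
  + by rewrite /=; lia.
  + apply: reach_step; first exact: e0.
    by apply: reach_step; [rewrite /step /= h1 | exact: reach_refl].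
  + exact: (repr_same rep).
  + by rewrite /=; lia.
- move=> i x s f _ /code_at_cons[h0 /code_at_cons[h1 /code_at_cons[h2 _]]] rep.
  have e0 : step p f = Some (jump_if (N s i < B)%N (pc f + 2) f).
    by rewrite /step h0 (repr_N rep) (repr_B rep) ltr_nat.
  have [e3 e4] := natM_in (repr_N rep i).
  rewrite /=; case: ifP e0 => iB e0; eexists; split.
  + apply: reach_step; first exact: e0.
    by apply: reach_step; [rewrite /step /= addn2 h2 e3 | exact: reach_refl].
  + case: (rep) => [hN hV hB hI hA]; split=> //=.
      by move=> j jB; rewrite e4 hV /upd /=; case: ifP => // _; exact: hI.
    move=> b j hb; rewrite e4 hV /upd /=.
    by rewrite gtn_eqF ?hA //; lia.
  + by rewrite /=; lia.
  + apply: reach_step; first exact: e0.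
    by apply: reach_step; [rewrite /step /= h1 | exact: reach_refl].
  + exact: (repr_same rep).
  + by rewrite /=; lia.
- move=> c1 IH1 c2 IH2 s f /= /andP[w1 w2] /code_at_cat[h1 h2] rep.
  have [g [r1 rep1 e1]] := IH1 _ _ w1 h1 rep.
  rewrite -e1 in h2; have [g' [r2 rep2 e2]] := IH2 _ _ w2 h2 rep1.
  exists g'; split=> //; first exact: reach_trans r1 r2.
  by rewrite e2 e1 size_cat addnA.
- move=> b c1 IH1 c2 IH2 s f /= /andP[w1 w2] /code_at_cons[h0].
  move=> /code_at_cat[h2] /code_at_cons[h3 h1] rep.
  have e0 := holds_jump rep h0.
  case: ifP e0 => bs e0.
    set l1 := (pc f + _ + 2)%N in h0 e0 h1 h3 *.
    have hl : ((pc f).+1 + size (compile (pc f).+1 c2)).+1 = l1 by rewrite /l1; lia.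
    rewrite hl in h1.
    have [g [r1 rep1 e1]] := IH1 s (jump_if true l1 f) w1 h1 (repr_jump true l1 rep).
    exists g; split=> //.
      by apply: reach_le (reach_step e0 r1); lia.
    by rewrite e1 /= size_cat /=; lia.
  have [g [r1 rep1 e1]] := IH2 s (jump_if false (pc f + size (compile (pc f).+1 c2) + 2) f)
    w2 h2 (repr_jump _ _ rep).
  rewrite /= in e1.
  exists (Config (pc f + size (compile (pc f).+1 c2) + 2 +
     size (compile (pc f + size (compile (pc f).+1 c2) + 2) c1)) (reg g) (cell g)).
  split=> //.
  + apply: reach_le (reach_step e0 (reach_trans r1 (t2 := 1) _)); first lia.
    by apply: reach_step; [rewrite /step e1 h3 | exact: reach_refl].
  + exact: repr_pc.
  + by rewrite /= size_cat /=; lia.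
- move=> i n c IH s f /= /and4P[ni ic nc w] h rep.
  have {h} [h0 [h1 [h2 [h4 [h5 [h6 h7]]]]]] :
    onth p (pc f) = Some (Const (nr i) 0) /\
    onth p (pc f + 1) = Some (JumpLt (nr i) (nr n) (pc f + 3)) /\
    onth p (pc f + 2) = Some (Jump (pc f + 3 + size (compile (pc f + 3) c) + 3)) /\
    code_at p (pc f + 3) (compile (pc f + 3) c) /\
    let e := (pc f + 3 + size (compile (pc f + 3) c))%N in
    onth p e = Some (Const 5 1) /\
    onth p e.+1 = Some (Plus (nr i) (nr i) 5) /\
    onth p e.+2 = Some (Jump (pc f + 1)).
    have [h0 /code_at_cons[h1 /code_at_cons[h2]]] := code_at_cons h.
    rewrite -[(pc f).+3]addn3 => /code_at_cat[h3 /code_at_cons[h4]].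
    move=> /code_at_cons[h5 /code_at_cons[h6 _]].
    rewrite -[(pc f).+1]addn1 in h1; rewrite -[(pc f).+2]addn2 in h2.
    by repeat split.
  set e := (pc f + 3 + _)%N in h2 h5 h6 h7 *.
  rewrite -/(it i c s _).
  have [g [r0 rep0 e0]] : exists g, [/\ reach p f 1 g, repr (setN i 0 s) g & pc g = (pc f + 1)%N].
    eexists; split; first by apply: reach_step; [rewrite /step h0 | exact: reach_refl].
      by apply: (repr_setN rep) => //= [|j /negPf hj]; rewrite /upd /= ?eqxx ?hj // (ratr_nat R 0).
    by rewrite /= addn1.
  have Nn k : N (it i c s k) n = N s n.
    elim: k => //= k IHk; rewrite /it /= den_N //= eq_sym (negPf ni) //.
  (* Invariant at the loop test, where the counter already holds [k]; after the last round it yields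
     the final value [N s n] that [den] gives to the counter. *)
  suff loop k : (k <= N s n)%N -> exists g', [/\
      reach p f (\sum_(k < k) (cost c (setN i k (it i c s k)) + 4) + 1) g',
      repr (setN i k (it i c s k)) g' & pc g' = (pc f + 1)%N].
    have [g' [r1 rep1 e1]] := loop _ (leqnn _).
    exists (Config (e + 3) (reg g') (cell g')); split=> //.
    + rewrite -[X in (_ + X)%N]/(1 + 2)%N addnA; apply: reach_trans r1 _.
      apply: reach_step.
        by rewrite /step e1 h1 !(repr_N rep1) /= eqxx eq_sym (negPf ni) Nn ltxx.
      apply: reach_step; last exact: reach_refl.
      by rewrite /step /= e1 -addnS h2.
    + exact: repr_pc rep1.
    + by rewrite /e /= size_cat /=; lia.
  elim: k => [_|k IHk kn].
    by exists g; split=> //; rewrite big_ord0.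
  have [g1 [r1 rep1 e1]] := IHk (ltnW kn).
  have s1 : step p g1 = Some (jump_if true (pc f + 3) g1).
    by rewrite /step e1 h1 !(repr_N rep1) /= eqxx eq_sym (negPf ni) Nn ltr_nat kn.
  have [g2 [r2 rep2 e2]] := IH (setN i k (it i c s k)) (jump_if true (pc f + 3) g1) w h4 (repr_jump _ _ rep1).
  rewrite /= -/e in e2.
  eexists; split.
  + rewrite big_ord_recr /= addnAC; apply: (reach_trans r1).
    rewrite addn4; apply: (reach_step s1).
    rewrite -(addn3 (cost _ _)); apply: (reach_trans r2).
    apply: reach_step; first by rewrite /step e2 h5.
    apply: reach_step; first by rewrite /step /= e2 h6.
    apply: reach_step; first by rewrite /step /= e2 h7.
    exact: reach_refl.
  + apply: (repr_setN rep2) => //= [|j /negPf hj /negPf h55 _]; rewrite /upd /= ?hj ?h55 //.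
    by rewrite eqxx regE /= (repr_N rep2) (ratr_nat R 1) den_N //= eqxx natr1.
  + by [].
Qed.

End Machine.

(** * Rules for running programs *)

Fact den_key (R : realType) B : {f | f = @den R B}.
Proof. by exists (@den R B). Qed.
Fact cost_key (R : realType) B : {f | f = @cost R B}.
Proof. by exists (@cost R B). Qed.

(* Sealed copies: [simpl] would unfold the loops of [den] under projections. *)
Definition exec (R : realType) B := sval (@den_key R B).
Definition time (R : realType) B := sval (@cost_key R B).
Lemma execE (R : realType) B : @exec R B = @den R B.
Proof. exact: (svalP (@den_key R B)). Qed.
Lemma timeE (R : realType) B : @time R B = @cost R B.
Proof. exact: (svalP (@cost_key R B)). Qed.

Section Rules.
Variable R : realType.
Variable B : nat.
Notation st := (st R).
Notation ex := (@exec R B).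
Notation tm := (@time R B).
Implicit Types (s t : st) (c : cmd).

(** Frame condition read off the syntax. It lets later specifications carry untouched lists and
    variables across a subprogram without describing its effect. *)
Definition agree c s t :=
  [/\ forall j, j \notin modN c -> N t j = N s j,
      forall j, j \notin modV c -> V t j = V s j,
      forall a, a \notin modA c -> A t a = A s a &
      ~~ modI c -> I t = I s].

Lemma den_agree c s : agree c s (ex c s).
Proof.
by rewrite execE; split=> *; [apply: den_N|apply: den_V|apply: den_A|apply: den_I].
Qed.

(** The time spent is an argument of the invariant, so that amortized bounds can be proved: a round
    may be expensive if earlier rounds have saved for it. *)
Lemma for_rule (P : nat -> nat -> st -> Prop) i n c s :
  P 0%N 0%N s ->
  (forall k acc t, (k < N s n)%N -> agree (For i n c) s t -> P k acc t ->
     P k.+1 (acc + (tm c (setN i k t) + 4))%N (ex c (setN i k t))) ->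
  exists t acc, [/\ P (N s n) acc t, agree (For i n c) s t,
    ex (For i n c) s = setN i (N s n) t & tm (For i n c) s = (acc + 3)%N].
Proof.
rewrite execE timeE => P0 PS.
exists (iteri (N s n) (fun k s' => @den R B c (setN i k s')) s).
exists (\sum_(k < N s n)
  (@cost R B c (setN i k (iteri k (fun k s' => @den R B c (setN i k s')) s)) + 4))%N.
have ag k : agree (For i n c) s (iteri k (fun k s' => @den R B c (setN i k s')) s).
  elim: k => [|k [h1 h2 h3 h4]]; first by split.
  split=> /=.
  - move=> j hj; have /norP[ji jc] : ~~ ((j == i) || (j \in modN c)) by rewrite -in_cons.
    by rewrite den_N //= (negPf ji) h1.
  - by move=> j hj; rewrite -h2 // den_V.
  - by move=> a ha; rewrite -h3 // den_A.
  - by move=> hi; rewrite -h4 // den_I.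
split=> //.
move: (N s n) PS (leqnn (N s n)) => m PS; move: {-2}m => k.
elim: k => [|k IH] km; first by rewrite big_ord0.
rewrite big_ord_recr /=; apply: PS => //; exact: IH (ltnW km).
Qed.

Lemma for_const (P : nat -> st -> Prop) K i n c s :
  P 0%N s ->
  (forall k t, (k < N s n)%N -> agree (For i n c) s t -> P k t ->
     P k.+1 (ex c (setN i k t)) /\ (tm c (setN i k t) <= K)%N) ->
  exists t, [/\ P (N s n) t, agree (For i n c) s t,
    ex (For i n c) s = setN i (N s n) t &
    (tm (For i n c) s <= N s n * (K + 4) + 3)%N].
Proof.
move=> P0 PS.
have [||t [acc [[h1 h2] ag e1 e2]]] := @for_rule
  (fun k acc t => P k t /\ (acc <= k * (K + 4))%N) i n c s.
- by split.
- move=> k acc t kn ag [hP ha]; have [h1 h2] := PS k t kn ag hP; split=> //.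
  by rewrite mulSn addnC leq_add // leq_add2r.
- by exists t; split=> //; rewrite e2 leq_add2r.
Qed.

(* List [j] of points has length [N s j] and its coordinates are in the arrays
   [2 j] and [2 j + 1].  List 0 is the input, 1 the best solution so far, 2 the
   solution under construction for the current shift, 3 the current block, 4 the
   current trial for this block, 5 the best trial, 6 the representatives. *)
Definition pts s (j : nat) : seq (R * R) :=
  mkseq (fun i => (A s j.*2 i, A s j.*2.+1 i)) (N s j).

Lemma size_pts s j : size (pts s j) = N s j.
Proof. by rewrite size_mkseq. Qed.

Lemma nth_pts s j i z : (i < N s j)%N ->
  nth z (pts s j) i = (A s j.*2 i, A s j.*2.+1 i).
Proof. exact: nth_mkseq. Qed.

Lemma eq_pts s t j : N t j = N s j -> A t j.*2 = A s j.*2 ->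
  A t j.*2.+1 = A s j.*2.+1 -> pts t j = pts s j.
Proof. by rewrite /pts => -> -> ->. Qed.

Lemma pts_agree c s t j : agree c s t ->
  [&& j \notin modN c, j.*2 \notin modA c & j.*2.+1 \notin modA c] ->
  pts t j = pts s j.
Proof.
by move=> [h1 _ h3 _] /and3P[a1 a2 a3]; apply: eq_pts; rewrite ?h1 ?h3.
Qed.

Lemma agree_N c s t j : agree c s t -> j \notin modN c -> N t j = N s j.
Proof. by case=> h *; apply: h. Qed.
Lemma agree_V c s t j : agree c s t -> j \notin modV c -> V t j = V s j.
Proof. by case=> _ h *; apply: h. Qed.
Lemma agree_A c s t j : agree c s t -> j \notin modA c -> A t j = A s j.
Proof. by case=> _ _ h *; apply: h. Qed.

Lemma pts_push s t j x y : N t j = (N s j).+1 ->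
  A t j.*2 =1 (fun i => if i == N s j then x else A s j.*2 i) ->
  A t j.*2.+1 =1 (fun i => if i == N s j then y else A s j.*2.+1 i) ->
  pts t j = rcons (pts s j) (x, y).
Proof.
move=> e1 e2 e3; rewrite /pts e1 mkseqS e2 e3 eqxx; congr rcons; apply/eq_in_map => i.
by rewrite mem_iota add0n => /andP[_ hi]; rewrite e2 e3 ltn_eqF.
Qed.

Lemma exec_Skip s : ex Skip s = s. Proof. by rewrite execE. Qed.
Lemma exec_NSet i k s : ex (NSet i k) s = setN i k s. Proof. by rewrite execE. Qed.
Lemma exec_NCopy i j s : ex (NCopy i j) s = setN i (N s j) s. Proof. by rewrite execE. Qed.
Lemma exec_NAdd i j k s : ex (NAdd i j k) s = setN i (N s j + N s k)%N s.
Proof. by rewrite execE. Qed.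
Lemma exec_NInc i s : ex (NInc i) s = setN i (N s i).+1 s. Proof. by rewrite execE. Qed.
Lemma exec_VSet x q s : ex (VSet x q) s = setV x (ratr q) s. Proof. by rewrite execE. Qed.
Lemma exec_VCopy x y s : ex (VCopy x y) s = setV x (V s y) s. Proof. by rewrite execE. Qed.
Lemma exec_VNat x i s : ex (VNat x i) s = setV x (N s i)%:R s. Proof. by rewrite execE. Qed.
Lemma exec_VOp o x y z s : ex (VOp o x y z) s = setV x (eval o (V s y) (V s z)) s.
Proof. by rewrite execE. Qed.
Lemma exec_Ld x a i s : ex (Ld x a i) s = setV x (A s a (N s i)) s. Proof. by rewrite execE. Qed.
Lemma exec_St a i x s : ex (St a i x) s = setA a (N s i) (V s x) s. Proof. by rewrite execE. Qed.
Lemma exec_Seq c1 c2 s : ex (c1 ;; c2)%cmd s = ex c2 (ex c1 s). Proof. by rewrite execE. Qed.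
Lemma exec_If b c1 c2 s :
  ex (If b c1 c2) s = if holds b s then ex c1 s else ex c2 s.
Proof. by rewrite execE. Qed.

Lemma time_Skip s : tm Skip s = 0%N. Proof. by rewrite timeE ?execE. Qed.
Lemma time_NSet i k s : tm (NSet i k) s = 1%N. Proof. by rewrite timeE ?execE. Qed.
Lemma time_NCopy i j s : tm (NCopy i j) s = 1%N. Proof. by rewrite timeE ?execE. Qed.
Lemma time_NAdd i j k s : tm (NAdd i j k) s = 1%N. Proof. by rewrite timeE ?execE. Qed.
Lemma time_NInc i s : tm (NInc i) s = 2%N. Proof. by rewrite timeE ?execE. Qed.
Lemma time_VSet x q s : tm (VSet x q) s = 1%N. Proof. by rewrite timeE ?execE. Qed.
Lemma time_VCopy x y s : tm (VCopy x y) s = 1%N. Proof. by rewrite timeE ?execE. Qed.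
Lemma time_VNat x i s : tm (VNat x i) s = 1%N. Proof. by rewrite timeE ?execE. Qed.
Lemma time_VOp o x y z s : tm (VOp o x y z) s = 1%N. Proof. by rewrite timeE ?execE. Qed.
Lemma time_Ld x a i s : tm (Ld x a i) s = 6%N. Proof. by rewrite timeE ?execE. Qed.
Lemma time_St a i x s : tm (St a i x) s = 6%N. Proof. by rewrite timeE ?execE. Qed.
Lemma time_RawLd x i s : tm (RawLd x i) s = 2%N. Proof. by rewrite timeE ?execE. Qed.
Lemma time_RawSt x i s : tm (RawSt x i) s = 2%N. Proof. by rewrite timeE ?execE. Qed.
Lemma time_Seq c1 c2 s :
  tm (c1 ;; c2)%cmd s = (tm c1 s + tm c2 (ex c1 s))%N.
Proof. by rewrite timeE ?execE. Qed.
Lemma time_If b c1 c2 s :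
  tm (If b c1 c2) s = ((if holds b s then tm c1 s else tm c2 s) + 2)%N.
Proof. by rewrite timeE ?execE. Qed.

End Rules.

(* Syntactic matching, since [rewrite] would look through the names of
   subprograms; innermost first with simplification in between, since each
   assignment duplicates the state. *)
Ltac settled s := lazymatch s with
  | context [exec _ (Seq _ _) _] => fail
  | context [exec _ Skip _] => fail
  | context [exec _ (NSet _ _) _] => fail
  | context [exec _ (NCopy _ _) _] => fail
  | context [exec _ (NAdd _ _ _) _] => fail
  | context [exec _ (NInc _) _] => fail
  | context [exec _ (VSet _ _) _] => fail
  | context [exec _ (VCopy _ _) _] => fail
  | context [exec _ (VNat _ _) _] => fail
  | context [exec _ (VOp _ _ _ _) _] => fail
  | context [exec _ (Ld _ _ _) _] => fail
  | context [exec _ (St _ _ _) _] => fail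
  | context [exec _ (If _ _ _) _] => fail
  | _ => idtac
  end.

Ltac run := repeat (match goal with
  | |- context [exec ?B (Seq ?a ?b) ?s] => settled s; rewrite (exec_Seq B a b s)
  | |- context [exec ?B Skip ?s] => settled s; rewrite (exec_Skip B  s)
  | |- context [exec ?B (NSet ?a ?b) ?s] => settled s; rewrite (exec_NSet B a b s)
  | |- context [exec ?B (NCopy ?a ?b) ?s] => settled s; rewrite (exec_NCopy B a b s)
  | |- context [exec ?B (NAdd ?a ?b ?c) ?s] => settled s; rewrite (exec_NAdd B a b c s)
  | |- context [exec ?B (NInc ?a) ?s] => settled s; rewrite (exec_NInc B a s)
  | |- context [exec ?B (VSet ?a ?b) ?s] => settled s; rewrite (exec_VSet B a b s)
  | |- context [exec ?B (VCopy ?a ?b) ?s] => settled s; rewrite (exec_VCopy B a b s)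
  | |- context [exec ?B (VNat ?a ?b) ?s] => settled s; rewrite (exec_VNat B a b s)
  | |- context [exec ?B (VOp ?a ?b ?c ?d) ?s] => settled s; rewrite (exec_VOp B a b c d s)
  | |- context [exec ?B (Ld ?a ?b ?c) ?s] => settled s; rewrite (exec_Ld B a b c s)
  | |- context [exec ?B (St ?a ?b ?c) ?s] => settled s; rewrite (exec_St B a b c s)
  | |- context [exec ?B (If ?a ?b ?c) ?s] => settled s; rewrite (exec_If B a b c s)
  | |- context [time ?B (Seq ?a ?b) ?s] => rewrite (time_Seq B a b s)
  | |- context [time ?B Skip ?s] => rewrite (time_Skip B  s)
  | |- context [time ?B (NSet ?a ?b) ?s] => rewrite (time_NSet B a b s)
  | |- context [time ?B (NCopy ?a ?b) ?s] => rewrite (time_NCopy B a b s)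
  | |- context [time ?B (NAdd ?a ?b ?c) ?s] => rewrite (time_NAdd B a b c s)
  | |- context [time ?B (NInc ?a) ?s] => rewrite (time_NInc B a s)
  | |- context [time ?B (VSet ?a ?b) ?s] => rewrite (time_VSet B a b s)
  | |- context [time ?B (VCopy ?a ?b) ?s] => rewrite (time_VCopy B a b s)
  | |- context [time ?B (VNat ?a ?b) ?s] => rewrite (time_VNat B a b s)
  | |- context [time ?B (VOp ?a ?b ?c ?d) ?s] => rewrite (time_VOp B a b c d s)
  | |- context [time ?B (Ld ?a ?b ?c) ?s] => rewrite (time_Ld B a b c s)
  | |- context [time ?B (St ?a ?b ?c) ?s] => rewrite (time_St B a b c s)
  | |- context [time ?B (If ?a ?b ?c) ?s] => rewrite (time_If B a b c s)
  | |- context [time ?B (RawLd ?a ?b) ?s] => rewrite (time_RawLd B a b s)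
  | |- context [time ?B (RawSt ?a ?b) ?s] => rewrite (time_RawSt B a b s)
  end; simpl).

(** * Insertion of a point unless it is close to a listed point *)

Definition tryadd_body : cmd := (
  Ld 3 8 9;; Ld 4 9 9;;
  VOp Sub 3 3 0;; VOp Mul 3 3 3;; VOp Sub 4 4 1;; VOp Mul 4 4 4;;
  VOp Add 3 3 4;;
  If (VLt 2 3) Skip (NSet 10 1))%cmd.

Definition tryadd : cmd := (
  NSet 10 0;; For 9 4 tryadd_body;; NSet 41 1;;
  If (NLt 10 41) (St 8 4 0;; St 9 4 1;; NInc 4) Skip)%cmd.

Section Greedy.
Variable R : realType.
Variable B : nat.
Notation st := (st R).
Notation ex := (@exec R B).
Notation tm := (@time R B).
Implicit Types (s t : st) (c : cmd).

Definition d2 (p q : R * R) : R :=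
  (p.1 - q.1) * (p.1 - q.1) + (p.2 - q.2) * (p.2 - q.2).

(** Three thresholds are used: [eta2] builds the net, 1 extends to a dominating set, 0 discards
    repetitions. Distances are squared throughout, as the machine has no square root. *)
Definition add (th : R) (l : seq (R * R)) (p : R * R) :=
  if has (fun q => d2 q p <= th) l then l else rcons l p.

Lemma tryadd_spec s :
  pts (ex tryadd s) 4 = add (V s 2) (pts s 4) (V s 0, V s 1) /\
  (tm tryadd s <= 40 * (size (pts s 4)).+1)%N.
Proof.
rewrite /tryadd; run.
set s0 := setN 10 0 s.
have [||t [h1 ag -> cc]] := @for_const R B (fun k t =>
  N t 10 = has (fun q => d2 q (V s 0, V s 1) <= V s 2) (take k (pts s 4))) 22 9 4
  tryadd_body s0.
- by rewrite take0.
- move=> k t kn ag IH.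
  rewrite /tryadd_body; run; rewrite /=.
  rewrite (agree_V ag) // (agree_V ag) // (agree_V ag) //.
  rewrite (agree_A ag) // (agree_A ag) //=.
  rewrite (take_nth (0,0)) ?size_pts // has_rcons nth_pts //=.
  by rewrite /d2 /= leNgt; case: ltP => _ /=; rewrite ?IH.
have nt j : j != 9%N -> j != 10%N -> N t j = N s j.
  by move=> j9 j10; rewrite (agree_N ag) /= ?(negPf j10) // inE (negPf j9) inE.
rewrite take_oversize ?size_pts // in h1; rewrite size_pts /add.
case: has h1 => /= h1; rewrite h1; run; rewrite /=.
  split; last by move: cc => /=; lia.
  by apply: eq_pts => /=; rewrite ?nt ?(agree_A ag).
rewrite !nt // !(agree_V ag) //.
split; last by move: cc => /=; lia.
by apply: pts_push => /= [|i|i]; rewrite ?nt ?(agree_A ag).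
Qed.

End Greedy.

(** * Greedy extension and extreme points *)

Definition greedy_body : cmd := (Ld 0 6 11;; Ld 1 7 11;; tryadd)%cmd.
Definition greedy : cmd := For 11 3 greedy_body.

Definition append_body (i j : nat) : cmd := (
  Ld 0 i.*2 8;; Ld 1 i.*2.+1 8;; St j.*2 j 0;; St j.*2.+1 j 1;; NInc j)%cmd.
Definition append (i j : nat) : cmd := For 8 i (append_body i j).
Definition copy (i j : nat) : cmd := (NSet j 0;; append i j)%cmd.

Definition ext_body : cmd := (
  Ld 0 6 13;; Ld 1 7 13;;
  VOp Sub 3 0 5;; VOp Mul 3 3 3;; VOp Sub 4 1 6;; VOp Mul 4 4 4;; VOp Add 3 3 4;;
  If (VLt 12 3) Skip (
    VOp Mul 14 9 0;; VOp Mul 15 10 1;; VOp Add 14 14 15;;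
    If (VLt 11 14) (VCopy 7 0;; VCopy 8 1;; VCopy 11 14) Skip))%cmd.
Definition ext_cmd (cx cy : rat) : cmd := (
  VSet 9 cx;; VSet 10 cy;; VCopy 7 5;; VCopy 8 6;;
  VOp Mul 11 9 5;; VOp Mul 15 10 6;; VOp Add 11 11 15;;
  For 13 3 ext_body;;
  St 12 6 7;; St 13 6 8;; NInc 6)%cmd.

Section Specs.
Variable R : realType.
Variable B : nat.
Notation st := (st R).
Notation ex := (@exec R B).
Notation tm := (@time R B).
Implicit Types (s t : st) (c : cmd).

Lemma size_add th (l : seq (R * R)) p : (size l <= size (add th l p) <= (size l).+1)%N.
Proof. by rewrite /add; case: ifP; rewrite ?size_rcons leqnn ?leqnSn. Qed.

Lemma size_foldl_add th (l q : seq (R * R)) :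
  (size l <= size (foldl (add th) l q) <= size l + size q)%N.
Proof.
elim: q l => [|p q IH] l /=; first by rewrite addn0 leqnn.
by have := size_add th l p; have := IH (add th l p); lia.
Qed.

(** The list only grows, so every insertion is charged at the final length; the cost is linear as
    soon as that length is bounded. *)
Lemma greedy_spec s :
  let L := foldl (add (V s 2)) (pts s 4) (pts s 3) in
  pts (ex greedy s) 4 = L /\
  (tm greedy s <= size (pts s 3) * (40 * (size L).+1 + 20) + 3)%N.
Proof.
move=> L; have [||t [h1 ag -> cc]] := @for_const R B (fun k t =>
  foldl (add (V s 2)) (pts t 4) (drop k (pts s 3)) = L) (40 * (size L).+1 + 12) 11 3
  greedy_body s.
- by rewrite drop0.
- move=> k t kn ag IH.
  rewrite /greedy_body; run.
  set t' := (X in ex tryadd X).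
  have [h c] := tryadd_spec B t'.
  have et : (V t' 0, V t' 1) = nth (0,0) (pts s 3) k.
    by rewrite nth_pts //= !(agree_A ag).
  have e2 : V t' 2 = V s 2 by rewrite /= (agree_V ag).
  have e4 : pts t' 4 = pts t 4 by apply: eq_pts.
  rewrite h et e2 e4; move: IH; rewrite (drop_nth (0,0)) ?size_pts //= => IH.
  split=> //; rewrite e4 in c.
  have := size_foldl_add (V s 2) (pts t 4) (drop k (pts s 3)).
  rewrite (drop_nth (0,0)) ?size_pts //= IH; rewrite size_pts in c.
  move=> hs; suff : (6 + (6 + tm tryadd t') <= 40 * (size L).+1 + 12)%N by [].
  by lia.
split; last first.
  by rewrite size_pts; apply: leq_trans cc _; rewrite leq_add2r leq_mul //; lia.
by rewrite -h1 drop_oversize ?size_pts //; apply: eq_pts.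
Qed.

Lemma append_spec i j s : i != j -> i != 8%N -> j != 8%N ->
  pts (ex (append i j) s) j = pts s j ++ pts s i /\
  (tm (append i j) s <= size (pts s i) * 30 + 3)%N.
Proof.
move=> ij i8 j8.
have ji : j == i = false by rewrite eq_sym (negPf ij).
have [||t [h1 ag -> cc]] := @for_const R B (fun k t =>
  pts t j = pts s j ++ take k (pts s i)) 26 8 i (append_body i j) s.
- by rewrite take0 cats0.
- move=> k t kn ag IH; rewrite /append_body; run; split=> //=.
  rewrite (take_nth (0,0)) ?size_pts // -rcons_cat -IH nth_pts //.
  have a2 a : a.*2 == a.*2.+1 = false by lia.
  have b2 a b : a.*2.+1 == b.*2.+1 = (a == b) by lia.
  have c2 a b : a.*2 == b.*2 = (a == b) by lia.
  have d2 a b : a.*2 == b.*2.+1 = false by lia.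
  have e2 a b : a.*2.+1 == b.*2 = false by lia.
  rewrite (negPf j8) -!(agree_A (t := t) ag) /= ?inE ?b2 ?c2 ?d2 ?e2 ?(negPf ij) //.
  apply: pts_push => /= [|l|l]; rewrite ?eqxx ?a2 ?e2 ?(negPf j8) //.
split; last by rewrite size_pts; apply: leq_trans cc _; lia.
rewrite -(take_oversize (n := N s i) (s := pts s i)) ?size_pts // -h1.
by apply: eq_pts => //=; rewrite (negPf j8).
Qed.

Lemma copy_spec i j s : i != j -> i != 8%N -> j != 8%N ->
  pts (ex (copy i j) s) j = pts s i /\
  (tm (copy i j) s <= size (pts s i) * 30 + 4)%N.
Proof.
move=> ij i8 j8; rewrite /copy; run.
have [] := append_spec (setN j 0 s) ij i8 j8.
have -> : pts (setN j 0 s) i = pts s i by apply: eq_pts => //=; rewrite (negPf ij).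
move=> -> c; split; first by rewrite /pts /= eqxx.
by move: c; lia.
Qed.

Definition dot (c p : R * R) := c.1 * p.1 + c.2 * p.2.
Definition ext_step (th : R) (c z e p : R * R) :=
  if th < d2 p z then e else if dot c e < dot c p then p else e.
Definition ext (th : R) (c : R * R) (z : R * R) (Q : seq (R * R)) :=
  foldl (ext_step th c z) z Q.

Lemma ext_spec cx cy s :
  pts (ex (ext_cmd cx cy) s) 6 =
    rcons (pts s 6) (ext (V s 12) (ratr cx, ratr cy) (V s 5, V s 6) (pts s 3)) /\
  (tm (ext_cmd cx cy) s <= size (pts s 3) * 40 + 40)%N.
Proof.
rewrite /ext_cmd; run.
set s0 := setV 11 _ _; pose F := ext_step (V s 12) (ratr cx, ratr cy) (V s 5, V s 6).
have [||t [h1 ag -> cc]] := @for_const R B (fun k t =>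
  foldl F (V t 7, V t 8) (drop k (pts s 3)) = foldl F (V s 5, V s 6) (pts s 3) /\
  V t 11 = dot (ratr cx, ratr cy) (V t 7, V t 8)) 33 13 3 ext_body s0.
- by rewrite drop0.
- move=> k t kn ag [IH hv].
  rewrite /ext_body; run; rewrite /= !(agree_A (t := t) ag) //.
  rewrite (agree_V (j := 5) ag) // (agree_V (j := 6) ag) //.
  rewrite (agree_V (j := 12) ag) // (agree_V (j := 9) ag) // (agree_V (j := 10) ag) //.
  move: IH; rewrite (drop_nth (0,0)) ?size_pts //= nth_pts //= {2}/F /ext_step /d2 /=.
  rewrite -hv {2}/dot /=.
  by case: ifP => //= _; case: ifP => //= _ <-.
rewrite drop_oversize ?size_pts //= in h1; case: h1 => h1 _.
split; last by rewrite size_pts; move: cc => /=; lia.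
rewrite /ext -/F -h1.
by apply: pts_push => /= [|i|i]; rewrite ?(agree_N (j := 6) ag) // ?(agree_A ag).
Qed.

End Specs.

(** * Trials over the sets of representatives *)

(* The square of the radius 1/40 of the net. *)
Definition etasq : rat := locked (1 / 1600%:R).

Definition reps_body : cmd := (
  Ld 5 8 12;; Ld 6 9 12;;
  ext_cmd 1 0;; ext_cmd (-1) 0;; ext_cmd 0 1;; ext_cmd 0 (-1))%cmd.
Definition reps_cmd : cmd := (NSet 6 0;; VSet 12 etasq;; For 12 4 reps_body)%cmd.

Definition sub_body : cmd := (
  VOp Mul 17 17 18;;
  If (VLt 16 17) Skip (VOp Sub 16 16 17;; Ld 0 12 17;; Ld 1 13 17;; tryadd))%cmd.
Definition trial : cmd := (
  NSet 4 0;; VNat 16 16;; VNat 17 14;; VSet 18 (1 / 2%:R);;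
  VSet 2 0;; For 17 6 sub_body;; VSet 2 1;; greedy)%cmd.
Definition trial_body : cmd := (trial;; If (NLt 4 5) (copy 4 5) Skip)%cmd.
Definition double_body : cmd := NAdd 14 14 14.
Definition solve_block : cmd := (
  NSet 4 0;; VSet 2 etasq;; greedy;; reps_cmd;;
  NSet 14 1;; For 15 6 double_body;; copy 3 5;;
  For 16 14 trial_body;; append 5 2)%cmd.

Section Block.
Variable R : realType.
Variable B : nat.
Notation st := (st R).
Notation ex := (@exec R B).
Notation tm := (@time R B).
Notation pt := (R * R)%type.
Implicit Types (s t : st) (c : cmd) (Q Z X : seq pt).

Definition eta2 : R := ratr etasq.

Lemma eta2E : eta2 = 1 / 1600%:R.
Proof. by rewrite /eta2 /etasq -lock rmorphM fmorphV rmorph_nat rmorph1. Qed.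

Definition ext4 Q (z : pt) : seq pt :=
  [seq ext eta2 u z Q | u <- [:: (1, 0); (-1, 0); (0, 1); (0, -1)]].
Definition net Q := foldl (add eta2) [::] Q.
Definition reps Q := flatten [seq ext4 Q z | z <- net Q].

Lemma reps_cmd_spec s : pts s 4 = net (pts s 3) ->
  pts (ex reps_cmd s) 6 = reps (pts s 3) /\
  (tm reps_cmd s <= size (net (pts s 3)) * (size (pts s 3) * 160 + 180) + 5)%N.
Proof.
move=> hZ; rewrite /reps_cmd; run.
set s0 := setV 12 _ _.
have [||t [h1 ag -> cc]] := @for_const R B (fun k t =>
  pts t 6 = flatten [seq ext4 (pts s 3) z | z <- take k (net (pts s 3))])
    (size (pts s 3) * 160 + 176) 12 4 reps_body s0.
- by rewrite take0.
- move=> k t kn ag IH; rewrite /reps_body; run.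
  set t0 := setV 6 _ _.
  have [p1 c1] := ext_spec B 1 0 t0; have a1 := den_agree B (ext_cmd 1 0) t0.
  set t1 := ex _ t0 in p1 a1 *.
  have [p2 c2] := ext_spec B (-1) 0 t1; have a2 := den_agree B (ext_cmd (-1) 0) t1.
  set t2 := ex _ t1 in p2 a2 *.
  have [p3 c3] := ext_spec B 0 1 t2; have a3 := den_agree B (ext_cmd 0 1) t2.
  set t3 := ex _ t2 in p3 a3 *.
  have [p4 c4] := ext_spec B 0 (-1) t3.
  have q0 : pts t0 3 = pts s 3.
    by apply: (eq_trans (y := pts t 3)); [apply: eq_pts | apply: (pts_agree ag)].
  have q1 : pts t1 3 = pts s 3 by rewrite (pts_agree a1).
  have q2 : pts t2 3 = pts s 3 by rewrite (pts_agree a2).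
  have q3 : pts t3 3 = pts s 3 by rewrite (pts_agree a3).
  have z0 : (V t0 5, V t0 6) = nth (0,0) (net (pts s 3)) k.
    by rewrite -hZ nth_pts //= !(agree_A ag).
  have z1 : (V t1 5, V t1 6) = (V t0 5, V t0 6) by rewrite !(agree_V a1).
  have z2 : (V t2 5, V t2 6) = (V t0 5, V t0 6) by rewrite !(agree_V a2).
  have z3 : (V t3 5, V t3 6) = (V t0 5, V t0 6) by rewrite !(agree_V a3).
  have e0 : V t0 12 = eta2 by rewrite /= (agree_V ag).
  have e1 : V t1 12 = eta2 by rewrite (agree_V a1).
  have e2 : V t2 12 = eta2 by rewrite (agree_V a2).
  have e3 : V t3 12 = eta2 by rewrite (agree_V a3).
  have i0 : pts t0 6 = pts t 6 by apply: eq_pts.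
  rewrite p4 p3 p2 p1 e0 e1 e2 e3 z1 z2 z3 z0 q0 q1 q2 q3 i0 IH.
  rewrite !rmorphN !rmorph1 !rmorph0 (take_nth (0,0)); last first.
    by rewrite -hZ size_pts.
  rewrite map_rcons flatten_rcons; split.
    by rewrite -!cats1 -!catA.
  by move: c1 c2 c3 c4; rewrite q0 q1 q2 q3; lia.
split.
  rewrite /reps -(take_oversize (n := N s0 4) (s := net (pts s 3))).
    by rewrite -h1; apply: eq_pts.
  by rewrite -hZ size_pts.
by move: cc; rewrite -hZ !size_pts /=; lia.
Qed.

(* Without rounding, the binary digits of [x < u = 2 ^ n] are extracted by
   comparison with the successive halves of [u]. *)
Fixpoint dec (x u : R) (n : nat) : bitseq :=
  if n is n'.+1 then
    let u' := u * (1 / 2%:R) in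
    if x < u' then false :: dec x u' n' else true :: dec (x - u') u' n'
  else [::].

(** The counter of the trials runs below [2 ^ r], so this is what makes the trials exhaust all
    subsets of the representatives. *)
Lemma dec_surj (b : bitseq) :
  exists2 m, (m < 2 ^ size b)%N & dec m%:R (2 ^ size b)%:R (size b) = b.
Proof.
have half n : (2 ^ n.+1)%:R * (1 / 2%:R) = (2 ^ n)%:R :> R.
  by rewrite expnS natrM mulrC mulrA div1r mulVf ?mul1r // pnatr_eq0.
elim: b => [|x b [m mb e]]; first by exists 0%N.
case: x => /=.
  exists (2 ^ size b + m)%N; first by rewrite expnS mul2n -addnn ltn_add2l.
  by rewrite half ltr_nat ltnNge leq_addr /= natrD addrC addKr e.
exists m; first by rewrite expnS mul2n -addnn ltn_addr.
by rewrite half ltr_nat mb e.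
Qed.

Definition grow Q X := foldl (add 1) X Q.
(** A point can be extreme in several net balls or directions and occur repeatedly in [reps Q];
    inserting with threshold 0 keeps it once. *)
Definition pick Q (b : bitseq) := foldl (add 0) [::] (mask b (reps Q)).

Lemma trial_spec s G :
  pts s 6 = reps (pts s 3) ->
  let r := size (reps (pts s 3)) in
  let L := grow (pts s 3) (pick (pts s 3) (dec (N s 16)%:R (N s 14)%:R r)) in
  (size L <= G)%N ->
  pts (ex trial s) 4 = L /\
  (tm trial s <= r * (40 * r.+1 + 30) + size (pts s 3) * (40 * G.+1 + 20) + 20)%N.
Proof.
move=> hR r L LG; rewrite /trial; run.
set s0 := setV 2 (ratr 0) _.
(* Invariant: [V t 16] holds the number still to be decoded and [V t 17] the current power of two;
   the digits to come select among the representatives to come. *)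
have [||t [h1 ag -> cc]] := @for_const R B (fun k t =>
  foldl (add 0) (pts t 4) (mask (dec (V t 16) (V t 17) (r - k)) (drop k (reps (pts s 3))))
    = pick (pts s 3) (dec (N s 16)%:R (N s 14)%:R r) /\ (N t 4 <= k)%N)
    (40 * r.+1 + 16) 17 6 sub_body s0.
- by rewrite drop0 subn0.
- move=> k t kn ag [IH N4]; rewrite /sub_body; run.
  have kr : (k < r)%N by rewrite /r -hR size_pts.
  have V18 : V t 18 = 1 / 2%:R by rewrite (agree_V ag) //= rmorphM fmorphV ratr_nat rmorph1.
  move: IH; rewrite -(subnSK kr) (drop_nth (0,0)) //= V18.
  case: ifP => /= lt; first by move=> <-; split; [split=> //; rewrite ltnW | lia].
  set t' := (X in ex tryadd X).
  have [h c] := tryadd_spec B t'.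
  have et : (V t' 0, V t' 1) = nth (0,0) (reps (pts s 3)) k.
    by rewrite -hR nth_pts //= !(agree_A (t := t) ag).
  have e2 : V t' 2 = 0 by rewrite /= (agree_V ag) //= rmorph0.
  have e4 : pts t' 4 = pts t 4 by apply: eq_pts.
  have a' := den_agree B tryadd t'.
  rewrite (agree_V (j := 16) a') // (agree_V (j := 17) a') // h et e2 e4.
  move=> ->; rewrite e4 size_pts in c; split; first split=> //.
    have := size_add 0 (pts t 4) (nth (0,0) (reps (pts s 3)) k).
    by rewrite -(size_pts (ex tryadd t')) h e4 et e2 size_pts; lia.
  by suff : (1 + (1 + (6 + (6 + tm tryadd t')) + 2) <= 40 * r.+1 + 16)%N by []; lia.
have Nr : N s0 6 = r by rewrite /r -hR size_pts.
rewrite Nr in h1 cc *; rewrite subnn /= in h1.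
have {}h1 : pts t 4 = pick (pts s 3) (dec (N s 16)%:R (N s 14)%:R r).
  by case: h1.
set t' := setV 2 _ _.
have e3 : pts t' 3 = pts s 3.
  by apply: (eq_trans (y := pts t 3)); [apply: eq_pts | apply: (pts_agree ag)].
have e4 : pts t' 4 = pts t 4 by apply: eq_pts.
have eV : V t' 2 = 1 by rewrite /= rmorph1.
have [h c] := greedy_spec B t'.
rewrite h eV e3 e4 h1; split=> //.
rewrite eV e3 e4 h1 -/(grow _ _) -/L in c.
have : (size (pts s 3) * (40 * (size L).+1 + 20) <=
  size (pts s 3) * (40 * G.+1 + 20))%N by rewrite leq_mul //; lia.
by move: c cc => /=; lia.
Qed.

End Block.

Section BlockSpec.
Variable R : realType.
Variable B : nat.
Notation st := (st R).
Notation ex := (@exec R B).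
Notation tm := (@time R B).
Notation pt := (R * R)%type.
Implicit Types (s t : st) (Q Z X l : seq pt) (p q : pt).

Lemma d2xx p : d2 p p = 0.
Proof. by rewrite /d2 !subrr !mulr0 addr0. Qed.

Lemma d2C p q : d2 p q = d2 q p.
Proof. by rewrite /d2; ring. Qed.

Lemma d2_eq0 p q : (d2 p q <= 0) = (p == q).
Proof.
apply/idP/eqP => [|->]; last by rewrite d2xx.
case: p q => [a b] [c d]; rewrite /d2 /= => h.
have h1 := sqr_ge0 (a - c); have h2 := sqr_ge0 (b - d).
rewrite !expr2 in h1 h2.
have /eqP : (a - c) ^+ 2 = 0 by rewrite expr2; lra.
have /eqP : (b - d) ^+ 2 = 0 by rewrite expr2; lra.
by rewrite !sqrf_eq0 !subr_eq0 => /eqP -> /eqP ->.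
Qed.

Definition valid Q l :=
  [/\ uniq l, {subset l <= Q} & forall q, q \in Q -> has (fun p => d2 p q <= 1) l].

Lemma add_uniq (th : R) l p : 0 <= th -> uniq l -> uniq (add th l p).
Proof.
move=> th0 ul; rewrite /add; case: ifPn => // /hasPn h.
rewrite rcons_uniq ul andbT; apply/negP => /h.
by rewrite d2xx th0.
Qed.

Lemma add_mem (th : R) l p q : q \in add th l p -> q \in l \/ q = p.
Proof.
rewrite /add; case: ifP => _; first by left.
by rewrite mem_rcons inE => /orP[/eqP|]; [right|left].
Qed.

Lemma sub_add (th : R) l p : {subset l <= add th l p}.
Proof.
by move=> q ql; rewrite /add; case: ifP => // _; rewrite mem_rcons inE ql orbT.
Qed.

Lemma foldl_add_uniq (th : R) l Q : 0 <= th -> uniq l -> uniq (foldl (add th) l Q).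
Proof. by move=> th0; elim: Q l => //= p Q IH l ul; apply/IH/add_uniq. Qed.

Lemma foldl_add_mem (th : R) l Q q :
  q \in foldl (add th) l Q -> (q \in l) || (q \in Q).
Proof.
elim: Q l => [|p Q IH] l /=; first by move->.
by move=> /IH /orP[/add_mem[->//|->]|]; rewrite inE ?eqxx ?orbT // => ->; rewrite !orbT.
Qed.

Lemma sub_foldl_add (th : R) l Q : {subset l <= foldl (add th) l Q}.
Proof. by elim: Q l => [|p Q IH] l q ql //=; apply/IH/sub_add. Qed.

Lemma foldl_add_has (th : R) l Q q : 0 <= th -> q \in Q ->
  has (fun p => d2 p q <= th) (foldl (add th) l Q).
Proof.
move=> th0; elim: Q l => //= p Q IH l; rewrite inE => /orP[/eqP ->|/IH//].
have : has (fun r => d2 r p <= th) (add th l p).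
  by rewrite /add; case: ifP => // _; rewrite has_rcons d2xx th0.
by move=> /hasP[r rl h]; apply/hasP; exists r => //; apply: sub_foldl_add.
Qed.

Lemma ext_mem (th : R) u (z : pt) Q : ext th u z Q \in z :: Q.
Proof.
rewrite /ext; move: {2 3}z => e.
elim: Q e => [|p Q IH] e /=; first by rewrite inE.
have := IH (ext_step th u z e p); rewrite /ext_step.
by case: ifP => _; [|case: ifP => _]; rewrite !inE; case/orP => ->; rewrite ?orbT.
Qed.

Lemma eta2_ge0 : 0 <= eta2 R.
Proof. rewrite eta2E; apply: divr_ge0; [exact: ler01 | exact: ler0n]. Qed.

Lemma net_sub Q : {subset net Q <= Q}.
Proof. by move=> q /foldl_add_mem; rewrite in_nil. Qed.

Lemma reps_sub Q : {subset reps Q <= Q}.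
Proof.
move=> q /flattenP[l /mapP[z /net_sub zQ ->]] /mapP[u _ ->].
by have := ext_mem (eta2 R) u z Q; rewrite inE => /orP[/eqP -> |].
Qed.

Lemma pick_uniq Q b : uniq (pick Q b).
Proof. by apply: foldl_add_uniq. Qed.

Lemma pick_sub Q b : {subset pick Q b <= mask b (reps Q)}.
Proof. by move=> q /foldl_add_mem; rewrite in_nil. Qed.

Lemma grow_valid Q b : valid Q (grow Q (pick Q b)).
Proof.
split.
- by apply: foldl_add_uniq => //; apply: pick_uniq.
- move=> q /foldl_add_mem /orP[/pick_sub /mem_mask /reps_sub|] //.
- by move=> q qQ; apply: foldl_add_has.
Qed.

Lemma valid_self Q : uniq Q -> valid Q Q.
Proof.
move=> uQ; split=> // q qQ; apply/hasP; exists q => //.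
by rewrite d2xx.
Qed.

(** Optimality is claimed against the trials only. All sequences [b] are covered because the
    analysis picks one from an unknown dominating set. *)
Definition best Q l := valid Q l /\
  forall b, size b = size (reps Q) -> (size l <= size (grow Q (pick Q b)))%N.

Lemma trials_spec s G :
  let Q := pts s 3 in
  let r := size (reps Q) in
  pts s 6 = reps Q -> N s 14 = (2 ^ r)%N -> valid Q (pts s 5) ->
  (size (pts s 5) <= size Q)%N ->
  (forall b, (size (grow Q (pick Q b)) <= G)%N) ->
  best Q (pts (ex (For 16 14 trial_body) s) 5) /\
  (size (pts (ex (For 16 14 trial_body) s) 5) <= size Q)%N /\
  (tm (For 16 14 trial_body) s <=
    2 ^ r * (r * (40 * r.+1 + 30) + size Q * (40 * G.+1 + 50) + 40) + 3)%N.
Proof.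
move=> Q r e6 e14 v5 s5 hG.
have [||t H] := @for_const R B (fun (k : nat) (t : st) =>
  [/\ valid Q (pts t 5), (size (pts t 5) <= size Q)%N & forall m, (m < k)%N ->
     (size (pts t 5) <=
      size (grow Q (pick Q (@dec R m%:R (2 ^ r)%:R r))))%N])
   (r * (40 * r.+1 + 30) + size Q * (40 * G.+1 + 50) + 36) 16 14 trial_body s.
- by split.
- move=> k t kn ag [i1 i2 i3]; rewrite /trial_body.
  set t0 := setN 16 k t.
  have q3 : pts t0 3 = Q.
    by apply: (eq_trans (y := pts t 3)); [apply: eq_pts | apply: (pts_agree ag)].
  have q6 : pts t0 6 = reps Q.
    rewrite -e6; apply: (eq_trans (y := pts t 6)); first exact: eq_pts.
    exact: (pts_agree ag).
  have q5 : pts t0 5 = pts t 5 by apply: eq_pts.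
  have n14 : N t0 14 = (2 ^ r)%N by rewrite /= (agree_N ag).
  have [] := @trial_spec R B t0 G; rewrite q3 //.
  rewrite n14 (_ : N t0 16 = k) // -/r; set L := grow _ _ => p4 c4.
  have a4 := den_agree B trial t0.
  run; set t1 := ex trial t0 in p4 a4 *.
  have p5 : pts t1 5 = pts t 5 by rewrite (pts_agree a4).
  have vL : valid Q L by apply: grow_valid.
  rewrite -!size_pts p4 p5; case: ifP => lt.
    have [pc cc] := @copy_spec R B 4%N 5%N t1 isT isT isT.
    rewrite pc p4; rewrite p4 in cc; split; last by move: c4 cc; lia.
    split=> //; first by lia.
    move=> m; rewrite ltnS leq_eqVlt => /orP[/eqP -> //|/i3 h].
    by apply: leq_trans h; apply: ltnW.
  rewrite p5; split; last by move: c4; lia.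
  split=> // m; rewrite ltnS leq_eqVlt => /orP[/eqP -> //|/i3 //].
  by rewrite leqNgt lt.
case: H => h ag e cc; rewrite e.
have e5 : pts (setN 16 (N s 14) t) 5 = pts t 5 by apply: eq_pts.
case: h => h1 h2 h3; rewrite e5; rewrite e14 in h3; split; last split=> //.
  split=> // b sb; have [m mb db] := dec_surj R b.
  by rewrite sb in mb db; rewrite -db; apply: h3.
by move: cc; rewrite e14; lia.
Qed.

Lemma solve_block_spec s G :
  let Q := pts s 3 in
  let r := size (reps Q) in
  uniq Q -> (size (net Q) <= G)%N ->
  (forall b, (size (grow Q (pick Q b)) <= size (pick Q b) + G)%N) ->
  (exists2 sol, best Q sol & pts (ex solve_block s) 2 = pts s 2 ++ sol) /\
  (tm solve_block s <= (2 ^ (4 * G) * (4 * G * (40 * (4 * G).+1 + 30) +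
      (40 * (5 * G).+1 + 50) + 40) + 400 * G.+1 + 500) * (size Q).+1)%N.
Proof.
move=> Q r uQ hZ hG; rewrite /solve_block.
have rG : (r <= 4 * G)%N.
  rewrite /r /reps size_flatten /shape -map_comp sumnE big_map.
  rewrite (eq_bigr (fun=> 4%N)) // big_const_seq count_predT iter_addn_0.
  by rewrite leq_mul2l.
run; set s0 := setV 2 _ _.
have [p1 c1] := greedy_spec B s0; have a1 := den_agree B greedy s0.
set s1 := ex greedy s0 in p1 a1 *.
have q0 : pts s0 3 = Q by apply: eq_pts.
have n0 : pts s0 4 = [::] by [].
have q1 : pts s1 3 = Q by rewrite (pts_agree a1).
rewrite (_ : V s0 2 = eta2 R) // q0 n0 -/(net Q) in p1 c1.
have [] := @reps_cmd_spec R B s1; rewrite q1 // => p2 c2.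
have a2 := den_agree B reps_cmd s1.
set s2 := ex reps_cmd s1 in p2 a2 *.
have q2 : pts s2 3 = Q by rewrite (pts_agree a2).
set s3 := setN 14 1 s2.
have q3 : pts s3 3 = Q by rewrite -q2; apply: eq_pts.
have p3 : pts s3 6 = reps Q by rewrite -p2; apply: eq_pts.
have [||t [h4 a4 e4 c4]] := @for_const R B (fun k t => N t 14 = (2 ^ k)%N) 1
   15 6 double_body s3.
- by [].
- by move=> k t kn ag IH; rewrite /double_body; run; rewrite IH expnS mul2n addnn.
have Nr : N s3 6 = r by rewrite -size_pts p3.
rewrite Nr in h4 c4 e4; rewrite e4; set s4 := setN 15 r t.
have q4 : pts s4 3 = Q.
  by rewrite -q3; apply: (eq_trans (y := pts t 3)); [apply: eq_pts | apply: (pts_agree a4)].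
have p4 : pts s4 6 = reps Q.
  by rewrite -p3; apply: (eq_trans (y := pts t 6)); [apply: eq_pts | apply: (pts_agree a4)].
have b4 : pts s4 2 = pts s 2.
  have -> : pts s4 2 = pts t 2 by apply: eq_pts.
  rewrite (pts_agree a4) //.
  have -> : pts s3 2 = pts s2 2 by apply: eq_pts.
  by rewrite (pts_agree a2) // (pts_agree a1) //; apply: eq_pts.
have [p5 c5] := @copy_spec R B 3%N 5%N s4 isT isT isT.
have a5 := den_agree B (copy 3 5) s4.
set s5 := ex (copy 3 5) s4 in p5 a5 *.
have q5 : pts s5 3 = Q by rewrite (pts_agree a5).
rewrite q4 in p5 c5.
(* At most [4 * G] representatives are picked and at most [G] points added. *)
have [] := @trials_spec s5 (5 * G)%N; rewrite q5 ?p5 //.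
- by rewrite (pts_agree a5).
- by rewrite (agree_N a5).
(* The whole block is the best solution before the first trial. *)
- exact: valid_self.
- move=> b; apply: leq_trans (hG b) _.
  have : (size (pick Q b) <= r)%N; last by lia.
  apply: leq_trans (_ : size (mask b (reps Q)) <= _)%N.
    by have := size_foldl_add 0 [::] (mask b (reps Q)); rewrite add0n => /andP[].
  exact: (size_subseq (mask_subseq b (reps Q))).
move=> p6 [l6 c6]; have a6 := den_agree B (For 16 14 trial_body) s5.
set s6 := ex _ s5 in p6 l6 a6 *.
have [p7 c7] := @append_spec R B 5%N 2%N s6 isT isT isT.
split; first by exists (pts s6 5); rewrite // p7 (pts_agree a6) // (pts_agree a5) // b4.
have h1 : (size Q * (40 * (size (net Q)).+1 + 20) <= size Q * (40 * G.+1 + 20))%N.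
  by rewrite leq_mul //; lia.
have h2 : (size (net Q) * (size Q * 160 + 180) <= G * (size Q * 160 + 180))%N.
  by rewrite leq_mul.
have h3 : (r * (40 * r.+1 + 30) <= 4 * G * (40 * (4 * G).+1 + 30))%N.
  by rewrite leq_mul //; lia.
have h6 : (2 ^ r <= 2 ^ (4 * G))%N by rewrite leq_pexp2l.
rewrite -/r in c6.
move: c6; set W := (4 * G * _)%N in h3 *; set Y := (40 * (5 * G).+1 + 50)%N.
set P := (2 ^ (4 * G))%N in h6 *.
set x := (r * (40 * r.+1 + 30))%N in h3 * => c6.
have {}c6 := leq_trans c6 (_ : _ <= P * ((W + Y + 40) * (size Q).+1) + 3)%N.
have {}c6 : (tm (For 16 14 trial_body) s5 <= P * ((W + Y + 40) * (size Q).+1) + 3)%N.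
  by apply: c6; rewrite leq_add2r leq_mul //; nia.
have -> : ((P * (W + Y + 40) + 400 * G.+1 + 500) * (size Q).+1 =
  P * ((W + Y + 40) * (size Q).+1) + (400 * G.+1 + 500) * (size Q).+1)%N.
  by rewrite mulnA -mulnDl addnA.
move: c1 c2 c4 c5 c6 c7 h1 h2 l6 rG.
set a := (P * ((W + Y + 40) * (size Q).+1))%N; clearbody a.
have gz : (size (net Q) * size Q <= G * size Q)%N by rewrite leq_mul.
clearbody P W Y r Q s6 s5 s4 s3 s1 s0.
lia.
Qed.

End BlockSpec.

(** * Merge sort *)

(** The sort is bottom-up, as the language has no recursion: a pass merges neighbouring chunks whose
    width is in variable 23. The next pair of chunks is opened when the output position 22 reaches
    the end 27 of the current pair, and its ends are capped at the length. *)
Definition new_pair : cmd := If (NEq 22 27) (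
  NCopy 24 22;; NAdd 25 22 23;; If (NLt 0 25) (NCopy 25 0) Skip;;
  NCopy 26 25;; NAdd 27 25 23;; If (NLt 0 27) (NCopy 27 0) Skip)%cmd Skip.
Definition take_left : cmd := (NCopy 33 24;; NInc 24)%cmd.
Definition take_right : cmd := (NCopy 33 26;; NInc 26)%cmd.
Definition choose_head : cmd :=
  If (NLt 24 25) (
    If (NLt 26 27) (
      Ld 0 14 24;; Ld 1 14 26;; Ld 2 15 24;; Ld 3 15 26;;
      If (VLt 0 1) take_left (If (VLt 1 0) take_right
        (If (VLt 3 2) take_right take_left)))%cmd
      take_left)
    take_right.
Definition move_rec : cmd := (
  Ld 0 14 33;; St 17 22 0;; Ld 0 15 33;; St 18 22 0;; Ld 0 16 33;; St 19 22 0)%cmd.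
Definition pass_body : cmd := (new_pair;; choose_head;; move_rec)%cmd.
Definition back_body : cmd := (
  Ld 0 17 22;; St 14 22 0;; Ld 0 18 22;; St 15 22 0;; Ld 0 19 22;; St 16 22 0)%cmd.
Definition pass_cmd : cmd := (
  NSet 24 0;; NSet 25 0;; NSet 26 0;; NSet 27 0;;
  For 22 0 pass_body;; For 22 0 back_body)%cmd.
Definition sort_body : cmd := (pass_cmd;; NAdd 23 23 23)%cmd.
Definition sort_cmd : cmd := (NSet 23 1;; For 21 28 sort_body)%cmd.

Section Sort.
Variable R : realType.
Variable B : nat.
Notation st := (st R).
Notation ex := (@exec R B).
Notation tm := (@time R B).
Notation rc := (R * (R * R))%type.
Implicit Types (s t : st) (l : seq rc).

Definition leT (r q : rc) := (r.1 < q.1) || (r.1 == q.1) && (r.2.1 <= q.2.1).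

Lemma leT_total : total leT.
Proof.
move=> [a [b c]] [d [e f]]; rewrite /leT /=.
by case: (ltgtP a d) => //= _; exact: le_total.
Qed.

Lemma leT_trans : transitive leT.
Proof.
move=> [a [b c]] [d [e f]] [g [h i]]; rewrite /leT /=.
case: (ltgtP d a) => //= [da|->].
  by move=> _; case: (ltgtP a g) => [ag|//|<-]; rewrite ?(lt_trans da ag) ?da.
by case: (ltgtP a g) => //= _; exact: le_trans.
Qed.

(* Records [(key, (a, b))] are kept in three consecutive arrays; [leT] sorts them
   by [(key, a)]. *)
Definition recs s (b n : nat) : seq rc :=
  mkseq (fun i => (A s b i, (A s b.+1 i, A s b.+2 i))) n.

(** [f] is fuel for a recursion that is not structural; by [passf_fuel] any value from the length on
    gives the same result when [w] is positive. *)
Fixpoint passf (f w : nat) l :=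
  if f is f'.+1 then
    if l is [::] then [::] else
    merge leT (take w l) (take w (drop w l)) ++ passf f' w (drop w (drop w l))
  else [::].
Definition merge_pass w l := passf (size l) w l.

Lemma passf_nil f w : passf f w [::] = [::].
Proof. by case: f. Qed.

Lemma passf_fuel f w l : (0 < w)%N -> (size l <= f)%N -> passf f w l = merge_pass w l.
Proof.
move=> w0; rewrite /merge_pass; move: {-2}f (leqnn f) l.
elim: f => [|f IH] g gf l lg.
  by have -> : l = [::] by [apply/nilP; rewrite /nilp; lia]; rewrite !passf_nil.
case: l lg => [|x l] lg; first by rewrite !passf_nil.
case: g gf lg => // g gf lg; rewrite [LHS]/= [RHS]/=; congr (_ ++ _).
set d := drop w _.
have sd : (size d <= size l)%N by rewrite !size_drop /=; lia.
by rewrite (IH g) ?(IH (size l)) //; move: lg gf => /=; lia.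
Qed.

Lemma merge_passE w l : (0 < w)%N -> l != [::] ->
  merge_pass w l = merge leT (take w l) (take w (drop w l)) ++
                   merge_pass w (drop w (drop w l)).
Proof.
move=> w0; case: l => // x l _; rewrite {1}/merge_pass /=; congr (_ ++ _).
by apply: passf_fuel => //; rewrite !size_drop /=; lia.
Qed.

Lemma perm_merge_pass w l : (0 < w)%N -> perm_eq (merge_pass w l) l.
Proof.
move=> w0; have [m] := ubnP (size l); elim: m l => // m IH l.
have [->//|l0 lm] := eqVneq l [::].
have e : l = (take w l ++ take w (drop w l)) ++ drop w (drop w l).
  by rewrite -catA !cat_take_drop.
rewrite merge_passE // [X in perm_eq _ X]e.
apply: perm_cat; first by rewrite perm_merge.
by apply: IH; case: l l0 lm {e} => //= x l; rewrite !size_drop /=; lia.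
Qed.

Definition chunked w l := forall c, sorted leT (take w (drop (c * w) l)).

(** A merged pair has exactly [w + w] elements unless it ends the list, so the chunks of the result
    start at multiples of [w + w]. *)
Lemma chunked_merge_pass w l : (0 < w)%N -> chunked w l ->
  chunked (w + w) (merge_pass w l).
Proof.
move=> w0; have [m] := ubnP (size l); elim: m l => // m IH l.
have [->//|l0 lm] := eqVneq l [::].
move=> ch; rewrite merge_passE //.
have h0 := ch 0%N; rewrite mul0n drop0 in h0.
have h1 := ch 1%N; rewrite mul1n in h1.
have hs : sorted leT (merge leT (take w l) (take w (drop w l))).
  exact: (merge_sorted (@leT_total)).
have sz : size (merge leT (take w l) (take w (drop w l))) = minn (w + w) (size l).
  by rewrite size_merge size_cat !size_take_min size_drop; lia.
have ch' : chunked (w + w) (merge_pass w (drop w (drop w l))).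
  apply: IH; first by case: l l0 lm {ch h0 h1 hs sz} => //= x l; rewrite !size_drop /=; lia.
  move=> c; rewrite !drop_drop; have := ch c.+2.
  by congr (sorted _ (take _ (drop _ _))); rewrite !mulSn; lia.
set M := merge _ _ _ in hs sz *.
have [small|big] := leqP (size l) (w + w).
  have -> : drop w (drop w l) = [::] by rewrite drop_drop drop_oversize.
  rewrite cats0 => -[|c]; first by rewrite mul0n drop0 take_oversize ?sz ?geq_minl.
  by rewrite drop_oversize // sz; lia.
have sM : size M = (w + w)%N by rewrite sz; lia.
move=> [|c]; first by rewrite mul0n drop0 take_size_cat.
by rewrite mulSn addnC -drop_drop drop_size_cat //; apply: ch'.
Qed.

Definition msort k l := foldl (fun l i => merge_pass (2 ^ i) l) l (iota 0 k).

Lemma msortS k l : msort k.+1 l = merge_pass (2 ^ k) (msort k l).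
Proof. by rewrite /msort -[in iota 0 k.+1]addn1 iotaD foldl_cat. Qed.

Lemma perm_msort k l : perm_eq (msort k l) l.
Proof.
elim: k => [|k IH] //; rewrite msortS.
by apply: perm_trans IH; apply: perm_merge_pass; rewrite expn_gt0.
Qed.

Lemma sorted_msort k l : (size l <= 2 ^ k)%N -> sorted leT (msort k l).
Proof.
move=> lk.
have ch : chunked (2 ^ k) (msort k l).
  elim: k {lk} => [|k IH].
    move=> c; rewrite expn0; set d := drop _ _.
    by case: d => //= x d; rewrite take0.
  by rewrite msortS expnS mul2n -addnn; apply: chunked_merge_pass; rewrite ?expn_gt0.
have := ch 0%N; rewrite mul0n drop0 take_oversize //.
by rewrite (perm_size (perm_msort k l)).
Qed.

End Sort.

Section SortSpec.
Variable R : realType.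
Variable B : nat.
Notation st := (st R).
Notation ex := (@exec R B).
Notation tm := (@time R B).
Notation rc := (R * (R * R))%type.
Implicit Types (s t : st) (l : seq rc).

Lemma merge_cons2 (x y : rc) l1 l2 :
  merge (@leT R) (x :: l1) (y :: l2) =
  if leT x y then x :: merge (@leT R) l1 (y :: l2)
  else y :: merge (@leT R) (x :: l1) l2.
Proof. by []. Qed.

Definition slice i j l := take (j - i) (drop i l).

Lemma slice_nil i l : slice i i l = [::].
Proof. by rewrite /slice subnn take0. Qed.

Lemma slice_cons z i j l : (i < j)%N -> (j <= size l)%N ->
  slice i j l = nth z l i :: slice i.+1 j l.
Proof.
move=> ij jl; rewrite /slice (drop_nth z) ?(leq_trans ij) //.
by rewrite -(subnSK ij).
Qed.

(* After [k] steps of a merging pass, variables 24 and 25 delimit what remains of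
   the left chunk, 26 and 27 what remains of the right one. *)
Definition minv (w k : nat) l t :=
  [/\ (N t 24 + N t 26 = k + N t 25)%N,
      [&& N t 24 <= N t 25, N t 25 <= N t 26, N t 26 <= N t 27 & N t 27 <= size l]%N &
      recs t 17 k ++ merge (@leT R) (slice (N t 24) (N t 25) l) (slice (N t 26) (N t 27) l)
        ++ merge_pass w (drop (N t 27) l) = merge_pass w l].

(** Opening a pair unfolds [merge_pass] once. Capping the ends at the length agrees with [take] and
    [drop], which also stop there. *)
Lemma new_pair_spec w k l t : (0 < w)%N -> (k < size l)%N ->
  N t 0 = size l -> N t 22 = k -> N t 23 = w -> minv w k l t ->
  minv w k l (ex new_pair t) /\ (k < N (ex new_pair t) 27)%N /\
  (tm new_pair t <= 20)%N.
Proof.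
move=> w0 kl n0 n22 n23 [h1 h2 h3]; rewrite /new_pair; run.
rewrite n22 n23 n0; case: eqP => [e|ne]; last first.
  by split=> //; split; lia.
have [e1 e2] : N t 24 = N t 25 /\ N t 26 = N t 27 by move: h1 h2; lia.
move: h3; rewrite e1 e2 !slice_nil -e /= => h3.
have dn : drop k l != [::] by case: (drop k l) (size_drop k l) => //=; lia.
rewrite merge_passE // !drop_drop in h3.
have key m h : m = minn (k + w) (size l) -> h = minn (m + w) (size l) ->
    recs t 17 k ++ merge (@leT R) (slice k m l) (slice m h l) ++ merge_pass w (drop h l)
    = merge_pass w l.
  move=> em eh; rewrite -h3; congr (_ ++ (merge _ _ _ ++ merge_pass _ _)).
  - rewrite /slice em; case: (leqP (k + w) (size l)) => lw; first by congr take; lia.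
    by rewrite !take_oversize // size_drop; lia.
  - rewrite /slice; case: (leqP (k + w) (size l)) => lw.
      have em' : m = (k + w)%N by lia.
      rewrite em' [in RHS]addnC; case: (leqP (m + w) (size l)) => lw'.
        by congr take; lia.
      by rewrite !take_oversize // size_drop; lia.
    by rewrite !drop_oversize //; lia.
  - case: (leqP (k + w + w) (size l)) => lw; first by congr drop; lia.
    by rewrite !drop_oversize //; lia.
case: ifP => a /=; case: ifP => b /=; rewrite b /= ?n0 ?n23 in a *;
  (split; last by split; lia); split=> /=; rewrite ?n0 ?n23; try lia;
  by apply: key; lia.
Qed.

Lemma choose_spec w k l t : l = recs t 14 (size l) -> (k < N t 27)%N ->
  minv w k l t ->
  [/\ (N (ex choose_head t) 24 + N (ex choose_head t) 26 = k.+1 + N t 25)%N,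
      (N (ex choose_head t) 24 <= N t 25)%N, (N t 25 <= N (ex choose_head t) 26 <= N t 27)%N,
      (N (ex choose_head t) 33 < size l)%N /\
      recs t 17 k ++ nth (0, (0, 0)) l (N (ex choose_head t) 33) ::
        merge (@leT R) (slice (N (ex choose_head t) 24) (N t 25) l)
                   (slice (N (ex choose_head t) 26) (N t 27) l)
        ++ merge_pass w (drop (N t 27) l) = merge_pass w l &
      (tm choose_head t <= 60)%N].
Proof.
move=> el k27 [h1 h2 h3]; pose z : rc := (0, (0, 0)).
have left : (N t 24 < N t 25)%N ->
  ((N t 26 < N t 27)%N -> leT (nth z l (N t 24)) (nth z l (N t 26))) ->
  recs t 17 k ++ nth z l (N t 24) ::
        merge (@leT R) (slice (N t 24).+1 (N t 25) l) (slice (N t 26) (N t 27) l)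
        ++ merge_pass w (drop (N t 27) l) = merge_pass w l.
  move=> lt le; rewrite -h3 (slice_cons z lt); last by lia.
  have [e|lt2] := leqP (N t 27) (N t 26).
    have -> : N t 26 = N t 27 by move: h2; lia.
    by rewrite slice_nil; case: (slice _ _ l).
  by rewrite (slice_cons z lt2) ?merge_cons2 ?le //; lia.
have right : (N t 26 < N t 27)%N ->
  ((N t 24 < N t 25)%N -> ~~ leT (nth z l (N t 24)) (nth z l (N t 26))) ->
  recs t 17 k ++ nth z l (N t 26) ::
        merge (@leT R) (slice (N t 24) (N t 25) l) (slice (N t 26).+1 (N t 27) l)
        ++ merge_pass w (drop (N t 27) l) = merge_pass w l.
  move=> lt le; rewrite -h3 (slice_cons z lt); last by lia.
  have [e|lt2] := leqP (N t 25) (N t 24).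
    have -> : N t 24 = N t 25 by move: h2; lia.
    by rewrite slice_nil.
  rewrite (slice_cons z lt2) ?merge_cons2; last by lia.
  by rewrite (negPf (le lt2)).
have nthE i : (i < size l)%N -> nth z l i = (A t 14 i, (A t 15 i, A t 16 i)).
  by move=> il; rewrite el nth_mkseq.
rewrite /choose_head; run.
case: ifP => a; last first.
  rewrite /take_right; run.
  split; try lia; split; first lia.
  by apply: right => //; rewrite ?a //; move: h1 h2; lia.
case: ifP => b; last first.
  rewrite /take_left; run.
  split; try lia; split; first lia.
  by apply: left => //; rewrite b.
have i1 : (N t 24 < size l)%N by lia.
have i2 : (N t 26 < size l)%N by lia.
have le : leT (nth z l (N t 24)) (nth z l (N t 26)) =
  (A t 14 (N t 24) < A t 14 (N t 26)) || ~~ (A t 14 (N t 26) < A t 14 (N t 24)) &&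
   ~~ (A t 15 (N t 26) < A t 15 (N t 24)).
  rewrite !nthE // /leT /= -!leNgt.
  by case: (ltgtP (A t 14 (N t 24)) (A t 14 (N t 26))).
run; case: ifP => c.
  rewrite /take_left; run; split; try lia; split; first lia.
  by apply: left => // _; rewrite le c.
case: ifP => d.
  rewrite /take_right; run; split; try lia; split; first lia.
  by apply: right => // _; rewrite le c d.
case: ifP => e.
  rewrite /take_right; run; split; try lia; split; first lia.
  by apply: right => // _; rewrite le c d e.
rewrite /take_left; run; split; try lia; split; first lia.
by apply: left => // _; rewrite le c d e.
Qed.

Lemma recs_push s t b k x y z : A t b =1 (fun i => if i == k then x else A s b i) ->
  A t b.+1 =1 (fun i => if i == k then y else A s b.+1 i) ->
  A t b.+2 =1 (fun i => if i == k then z else A s b.+2 i) ->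
  recs t b k.+1 = rcons (recs s b k) (x, (y, z)).
Proof.
move=> e1 e2 e3; rewrite /recs mkseqS e1 e2 e3 eqxx; congr rcons.
by apply/eq_in_map => i; rewrite mem_iota add0n => /andP[_ hi]; rewrite e1 e2 e3 ltn_eqF.
Qed.

Lemma eq_recs s t b n : A t b = A s b -> A t b.+1 = A s b.+1 -> A t b.+2 = A s b.+2 ->
  recs t b n = recs s b n.
Proof. by rewrite /recs => -> -> ->. Qed.

Lemma recs_agree c s t b n : agree c s t ->
  [&& b \notin modA c, b.+1 \notin modA c & b.+2 \notin modA c] ->
  recs t b n = recs s b n.
Proof. by move=> ag /and3P[a1 a2 a3]; apply: eq_recs; apply: (agree_A ag). Qed.

Lemma pass_body_spec w k l t : (0 < w)%N -> (k < size l)%N ->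
  l = recs t 14 (size l) ->
  N t 0 = size l -> N t 22 = k -> N t 23 = w -> minv w k l t ->
  minv w k.+1 l (ex pass_body t) /\ (tm pass_body t <= 120)%N.
Proof.
move=> w0 kl el n0 n22 n23 mi; rewrite /pass_body; run.
have [mi1 [k1 c1]] := new_pair_spec w0 kl n0 n22 n23 mi.
have a1 := den_agree B new_pair t; set t1 := ex new_pair t in mi1 k1 a1 *.
have el1 : l = recs t1 14 (size l) by rewrite (recs_agree _ a1).
have [h1 h2 h3 [h4 h5] c2] := choose_spec el1 k1 mi1.
have a2 := den_agree B choose_head t1.
have n25 : N (ex choose_head t1) 25 = N t1 25 by rewrite (agree_N a2).
have n27 : N (ex choose_head t1) 27 = N t1 27 by rewrite (agree_N a2).
have m22 : N (ex choose_head t1) 22 = k by rewrite (agree_N a2) // (agree_N a1).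
have r17 : recs (ex choose_head t1) 17 k = recs t1 17 k by rewrite (recs_agree _ a2).
have el2 : l = recs (ex choose_head t1) 14 (size l) by rewrite (recs_agree _ a2).
set t2 := ex choose_head t1 in h1 h2 h3 h4 h5 a2 n25 n27 m22 r17 el2 *.
rewrite /move_rec; run; split; last by lia.
case: mi1 => _ hle _.
split; [by rewrite /= n25; lia | by rewrite /= n25 n27; move: hle; lia |].
rewrite (@recs_push t2 _ 17%N k (A t2 14 (N t2 33)) (A t2 15 (N t2 33)) (A t2 16 (N t2 33)))
  => [|i|i|i]; rewrite /= ?m22 //.
have en : nth (0, (0, 0)) l (N t2 33) = (A t2 14 (N t2 33), (A t2 15 (N t2 33), A t2 16 (N t2 33))).
  by rewrite [X in nth _ X _]el2 nth_mkseq.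
by rewrite en in h5; rewrite -h5 cat_rcons r17 /= n25 n27.
Qed.

Lemma pass_spec s l n w : (0 < w)%N -> N s 0 = n -> N s 23 = w ->
  l = recs s 14 n ->
  recs (ex pass_cmd s) 14 n = merge_pass w l /\ (tm pass_cmd s <= 170 * n + 12)%N.
Proof.
move=> w0 n0 n23 el; have sl : size l = n by rewrite el size_mkseq.
rewrite /pass_cmd; run; set s0 := setN 27 0 _.
have [||t [h ag -> cc]] := @for_const R B (fun (k : nat) (t : st) => minv w k l t)
   120 22 0 pass_body s0.
- by split=> //=; rewrite !slice_nil drop0.
- move=> k t kn ag mi; apply: pass_body_spec => //.
  + by rewrite sl -n0.
  + by rewrite sl el; symmetry; apply: (recs_agree (s := s0) _ ag).
  + by rewrite /= (agree_N ag) //= sl.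
  + by rewrite /= (agree_N ag).
rewrite [N s0 0]/= n0 in h cc *.
set s1 := setN 22 n t.
have r1 : recs s1 17 n = merge_pass w l.
  case: h => h1 h2 <-; have -> : recs s1 17 n = recs t 17 n by apply: eq_recs.
  have [e1 e2] : N t 24 = N t 25 /\ N t 26 = N t 27 by move: h1 h2; rewrite sl; lia.
  have e3 : N t 27 = n by move: h1 h2; rewrite sl; lia.
  by rewrite e1 e2 !slice_nil e3 /= drop_oversize ?sl // cats0.
have [||t' [h' ag' -> cc']] := @for_const R B (fun (k : nat) (t' : st) =>
   recs t' 14 k = take k (recs s1 17 n)) 36 22 0 back_body s1.
- by rewrite take0.
- move=> k t' kn ag' IH; rewrite /back_body; run; split=> //.
  have kn' : (k < n)%N by move: kn; rewrite /= (agree_N ag) //= n0.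
  rewrite (take_nth (0,(0,0))) ?size_mkseq // -IH nth_mkseq //=.
  rewrite -!(agree_A (t := t') ag') //.
  by apply: recs_push.
have n1 : N s1 0 = n by rewrite /= (agree_N ag).
rewrite n1 in h' cc' *.
split; last by move: cc cc' => /=; lia.
rewrite -r1 -(take_oversize (n := n) (s := recs s1 17 n)) ?size_mkseq // -h'.
Qed.

Lemma sort_spec s n L : N s 0 = n -> N s 28 = L ->
  recs (ex sort_cmd s) 14 n = msort L (recs s 14 n) /\
  (tm sort_cmd s <= L * (170 * n + 20) + 4)%N.
Proof.
move=> n0 n28; rewrite /sort_cmd; run.
have [||t [h ag -> cc]] := @for_const R B (fun (k : nat) (t : st) =>
  N t 23 = (2 ^ k)%N /\ recs t 14 n = msort k (recs s 14 n))
   (170 * n + 14) 21 28 sort_body (setN 23 1 s).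
- by split.
- move=> k t kn ag [h1 h2]; rewrite /sort_body; run.
  set t0 := setN 21 k t.
  have [] := @pass_spec t0 (msort k (recs s 14 n)) n (2 ^ k).
  + by rewrite expn_gt0.
  + by rewrite /= (agree_N ag).
  + by [].
  + by rewrite -h2; apply: eq_recs.
  move=> h3 c3; have a3 := den_agree B pass_cmd t0.
  set t1 := ex pass_cmd t0 in h3 a3 *.
  have e23 : N t1 23 = (2 ^ k)%N by rewrite (agree_N a3).
  split; last by move: c3; lia.
  split; first by rewrite e23 expnS mul2n addnn.
  by rewrite msortS -h3; apply: eq_recs.
rewrite [N _ 28]/= n28 in h cc *; case: h => _ h; split; last by apply: (leq_trans (leq_add (leqnn 1) cc)); lia.
by rewrite -h; apply: eq_recs.
Qed.

End SortSpec.

(** * Shifted blocks *)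

(* The blocks have [side * side] unit cells.  The ratio 44/9 needs
   [4 + 400 / side <= 44 / 9], that is [450 <= side]; [locked] keeps
   the number from being computed. *)
Definition side : nat := locked 500%N.

(** Real variables 20 and 21 hold the key and the coordinate of the previous record, 22 the end of
    the current slab, 23 the offset, 25 the gap and 26 the width; natural-number variable 20 is the
    slab number. The offset is the shift plus 1, so that the first slab after a restart is not
    empty. *)
Definition walk_init (si : nat) : cmd := (
  VSet 20 (-1);; VSet 21 0;; VSet 22 0;; NSet 20 0;;
  VNat 23 si;; VSet 24 1;; VOp Add 23 23 24;; VSet 25 2%:R;; VSet 26 side%:R)%cmd.
Definition new_col : cmd := (NInc 20;; VOp Add 22 28 23)%cmd.
Definition step_col : cmd :=
  If (VEq 27 20) (
    If (VLt 30 28) new_col (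
      If (VLt 28 22) Skip (NInc 20;; VOp Add 22 22 26)%cmd))
    new_col.
Definition walk_body : cmd := (
  Ld 27 14 19;; Ld 28 15 19;; Ld 29 16 19;; VOp Add 30 21 25;; step_col;;
  VCopy 20 27;; VCopy 21 28;; VNat 31 20;;
  St 14 19 31;; St 15 19 29;; St 16 19 28)%cmd.
Definition walk_cmd (si : nat) : cmd := (walk_init si;; For 19 0 walk_body)%cmd.
Definition stage_cmd (si : nat) : cmd := (sort_cmd;; walk_cmd si)%cmd.

Definition flush : cmd := (solve_block;; NSet 3 0;; VCopy 32 33)%cmd.
Definition solve_body : cmd := (
  Ld 33 14 18;; If (VEq 33 32) Skip flush;;
  Ld 0 15 18;; Ld 1 16 18;; St 6 3 0;; St 7 3 1;; NInc 3)%cmd.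
Definition solve_all : cmd := (
  NSet 2 0;; NSet 3 0;; VSet 32 (-1);; For 18 0 solve_body;; solve_block)%cmd.

Section Walk.
Variable R : realType.
Variable B : nat.
Notation st := (st R).
Notation ex := (@exec R B).
Notation tm := (@time R B).
Notation pt := (R * R)%type.
Notation rc := (R * (R * R))%type.
Implicit Types (s t : st) (l : seq rc).

(** The gap 2 is the diameter of a unit disk: a restart never falls between two points of one disk
    that have the same key. *)
Definition fresh (pk px : R) (r : rc) := (r.1 != pk) || (px + 2%:R < r.2.1).

(* Cuts a sorted list of records into slabs of width [side] without a floor
   function: [b] is the end of the current slab, and the subdivision is restarted
   at each new key and after each gap of more than 2, so that at most
   one slab boundary is passed from a record to the next. *)
Fixpoint walk (o pk px b : R) (id : nat) l : seq nat :=
  if l is r :: l' then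
    let nw := fresh pk px r in
    let b' := if nw then r.2.1 + o else
              if r.2.1 < b then b else b + side%:R in
    let id' := if nw || ~~ (r.2.1 < b) then id.+1 else id in
    id' :: walk o r.1 r.2.1 b' id' l'
  else [::].

Lemma size_walk o pk px b id l : size (walk o pk px b id l) = size l.
Proof. by elim: l o pk px b id => //= r l IH *; rewrite IH. Qed.

(* Keys are nonnegative, so that the initial key -1 makes the first record a
   restart. *)
Definition ids (o : R) l := walk o (-1) 0 0 0 l.

(* The slab number becomes the new key and the two coordinates are exchanged, for
   the second stage to cut the slabs in the other direction. *)
Definition relabel (o : R) l : seq rc :=
  [seq (p.1%:R, (p.2.2.2, p.2.2.1)) | p <- zip (ids o l) l].

Lemma size_relabel o l : size (relabel o l) = size l.
Proof. by rewrite size_map size_zip size_walk minnn. Qed.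

Lemma nth_relabel o l z i : (i < size l)%N ->
  nth z (relabel o l) i =
  ((nth 0%N (ids o l) i)%:R, ((nth z l i).2.2, (nth z l i).2.1)).
Proof.
move=> il; rewrite (nth_map (0%N, z)) ?size_zip ?size_walk ?minnn //.
by rewrite nth_zip ?size_walk.
Qed.

Lemma walk_spec si s n : si \notin [:: 19; 20]%N -> N s 0 = n ->
  recs (ex (walk_cmd si) s) 14 n =
    relabel ((N s si)%:R + 1) (recs s 14 n) /\
  (tm (walk_cmd si) s <= 70 * n + 20)%N.
Proof.
move=> hsi n0; have si20 : si == 20%N = false.
  by apply/negbTE; move: hsi; rewrite !inE => /norP[].
set o := _ + 1; set l := recs s 14 n; pose z : rc := (0, (0, 0)).
rewrite /walk_cmd /walk_init; run.
set s0 := setV 26 _ _.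
have [||t [h ag -> cc]] := @for_const R B (fun (k : nat) (t : st) =>
  walk o (V t 20) (V t 21) (V t 22) (N t 20) (drop k l) = drop k (ids o l) /\
  forall i, (i < n)%N -> (A t 14 i, (A t 15 i, A t 16 i)) =
    if (i < k)%N then nth z (relabel o l) i else nth z l i)
   60 19 0 walk_body s0.
- split; first by rewrite !drop0 /= rmorphN rmorph1 !rmorph0.
  by move=> i il; rewrite nth_mkseq.
- move=> k t; rewrite [N _ 0]/= n0 => kn ag [IH hr]; rewrite /walk_body /step_col /new_col.
  have sl : size l = n by rewrite size_mkseq.
  have hk := hr k kn; rewrite ltnn in hk.
  have e23 : V t 23 = o.
    by rewrite (agree_V ag) //= si20 rmorph1.
  have e25 : V t 25 = 2%:R by rewrite (agree_V ag) //= rmorph_nat.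
  have e26 : V t 26 = side%:R by rewrite (agree_V ag) //= rmorph_nat.
  move: IH; rewrite (drop_nth z) ?sl // (drop_nth 0%N) ?size_walk ?sl // -hk /=.
  case=> [e1 e2].
  have nr : nth z (relabel o l) k = ((nth 0%N (ids o l) k)%:R, (A t 16 k, A t 15 k)).
    by rewrite nth_relabel ?sl // -hk.
  have fin (x : R) : x = (nth 0%N (ids o l) k)%:R ->
     forall i, (i < n)%N -> (if i == k then x else A t 14 i,
       (if i == k then A t 16 k else A t 15 i, if i == k then A t 15 k else A t 16 i)) =
    if (i < k.+1)%N then nth z (relabel o l) i else nth z l i.
    move=> ex1 i il; rewrite ltnS leq_eqVlt.
    by have [->|ik] /= := eqVneq i k; rewrite ?nr ?ex1 // hr.
  move: e1 e2; rewrite {1 2 3}/fresh /= => e1 e2; run.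
  rewrite e23 e25 e26.
  case: ifP => c1 /=; rewrite ?c1 /= in e1 e2 *.
    case: ifP => c2 /=; rewrite ?c2 /= in e1 e2 *.
      by split; [split; [|apply: fin; rewrite // e1] | lia].
    case: ifP => c3 /=; rewrite ?c3 /= in e1 e2 *.
      by split; [split; [|apply: fin; rewrite // e1] | lia].
    by split; [split; [|apply: fin; rewrite // e1] | lia].
  by split; [split; [|apply: fin; rewrite // e1] | lia].
rewrite [N _ 0]/= n0 in h cc *; case: h => _ h.
split; last by apply: (leq_trans (n := 9 + (n * 64 + 3))); [move: cc; lia | lia].
apply: (@eq_from_nth _ z); first by rewrite size_relabel !size_mkseq.
move=> i; rewrite size_mkseq => il; rewrite nth_mkseq //.
by have := h i il; rewrite il.
Qed.

Definition stage L (o : R) l := relabel o (msort L l).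

Lemma stage_spec si s n L : si \notin [:: 19; 20; 21; 22; 23; 24; 25; 26; 27; 33]%N ->
  N s 0 = n -> N s 28 = L ->
  recs (ex (stage_cmd si) s) 14 n = stage L ((N s si)%:R + 1) (recs s 14 n) /\
  (tm (stage_cmd si) s <= L * (170 * n + 20) + 70 * n + 24)%N.
Proof.
move=> hsi n0 hL; rewrite /stage_cmd; run.
have [h1 c1] := sort_spec B n0 hL; have a1 := den_agree B sort_cmd s.
set s1 := ex sort_cmd s in h1 a1 *.
have [] := @walk_spec si s1 n.
- by move: hsi; rewrite !inE; do 9!case/norP=> ? ; lia.
- by rewrite (agree_N a1).
move=> h2 c2; split; last by move: c1 c2; lia.
rewrite h2 h1 /stage (agree_N a1) //.
by move: hsi; rewrite /= !inE !negb_or; lia.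
Qed.

(** Started with the key -1, below every slab number, and with no points, it always yields an empty
    first block, which is solved like the others. *)
Fixpoint runs (pk : R) (Q : seq pt) l : seq (seq pt) :=
  if l is r :: l' then
    if r.1 == pk then runs pk (rcons Q r.2) l' else Q :: runs r.1 [:: r.2] l'
  else [:: Q].

(** The bounds that make a block solvable in linear time: [G] limits the net, hence the number of
    trials, and what a trial adds to its selection. *)
Definition good_block G (Q : seq pt) :=
  [/\ uniq Q, (size (net Q) <= G)%N &
   forall b, (size (grow Q (pick Q b)) <= size (pick Q b) + G)%N].

Definition solution (Bs : seq (seq pt)) (C : seq pt) :=
  exists zs : seq (seq pt * seq pt), [/\ unzip1 zs = Bs, C = flatten (unzip2 zs) &
    forall w, w \in zs -> best w.1 w.2].

Definition block_cost G :=
  (2 ^ (4 * G) * (4 * G * (40 * (4 * G).+1 + 30) +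
      (40 * (5 * G).+1 + 50) + 40) + 400 * G.+1 + 500)%N.

Lemma solve_all_spec G s n : N s 0 = n ->
  let Bs := runs (-1) [::] (recs s 14 n) in
  (forall Q, Q \in Bs -> good_block G Q) ->
  solution Bs (pts (ex solve_all s) 2) /\
  (tm solve_all s <= (4 * block_cost G + 200) * n.+1)%N.
Proof.
set K0 := block_cost G.
move=> n0 Bs hB; rewrite /solve_all; run.
have block t : good_block G (pts t 3) ->
    (exists2 sol, best (pts t 3) sol & pts (ex solve_block t) 2 = pts t 2 ++ sol) /\
    (tm solve_block t <= K0 * (N t 3).+1)%N.
  by case=> h1 h2 h3; have := @solve_block_spec R B t G h1 h2 h3; rewrite size_pts.
set s0 := setV 32 _ _; set l := recs s 14 n in Bs hB *.
have sl : size l = n by rewrite size_mkseq.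
have [||t [acc [h ag -> cc]]] := @for_rule R B (fun (k acc : nat) (t : st) =>
  (exists zs : seq (seq pt * seq pt),
    [/\ unzip1 zs ++ runs (V t 32) (pts t 3) (drop k l) = Bs,
        pts t 2 = flatten (unzip2 zs) &
        forall w, w \in zs -> best w.1 w.2]) /\
  (* Each point of the current block has [K0] in reserve for solving it; the other [K0] granted per
     record covers the successor in the cost of a block. *)
  (acc + K0 * N t 3 <= k * (2 * K0 + 60))%N) 18 0 solve_body s0.
- split; last by rewrite /= muln0.
  exists [::]; split=> //.
  by rewrite /= drop0 rmorphN rmorph1.
- move=> k acc t; rewrite [N s0 0]/= n0 => kn ag [[zs [z1 z2 z3]] hacc].
  rewrite /solve_body; run.
  have [a14 a15 a16] : [/\ A t 14 = A s 14, A t 15 = A s 15 & A t 16 = A s 16].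
    by split; rewrite (agree_A ag).
  have nl : nth (0,(0,0)) l k = (A t 14 k, (A t 15 k, A t 16 k)).
    by rewrite nth_mkseq // a14 a15 a16.
  move: z1; rewrite (drop_nth (0,(0,0))) ?sl // nl /=.
  case: ifP => e z1.
    split; last by rewrite /=; lia.
    exists zs; split=> //; rewrite -z1; congr (_ ++ runs _ _ _).
    exact: pts_push.
  rewrite /flush; run.
  set t1 := setV 33 _ _.
  have p3 : pts t1 3 = pts t 3 by apply: eq_pts.
  have [|[sol bsol psol] csol] := block t1.
    by rewrite p3; apply: hB; rewrite -z1 mem_cat inE eqxx orbT.
  rewrite p3 in bsol; have a1 := den_agree B solve_block t1.
  set t2 := ex solve_block t1 in psol a1 *.
  split; last first.
    rewrite (_ : N t1 3 = N t 3) // in csol.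
    by move: csol; rewrite mulnS; move: hacc; rewrite mulSn; lia.
  exists (rcons zs (pts t 3, sol)); split.
  - rewrite -z1 /unzip1 map_rcons cat_rcons; congr (_ ++ _ :: runs _ _ _).
      by rewrite /= (agree_V a1).
    by rewrite /pts /mkseq /= (agree_N a1) //= !(agree_A a1) //= a15 a16.
  - rewrite /unzip2 map_rcons flatten_rcons -z2; rewrite -psol.
    exact: eq_pts.
  - by move=> w; rewrite mem_rcons inE => /orP[/eqP -> //|]; apply: z3.
rewrite [N s0 0]/= n0 in h cc *.
case: h => [[zs [z1 z2 z3]] hacc].
rewrite drop_oversize ?sl //= in z1.
set t1 := setN 18 n t.
have p3 : pts t1 3 = pts t 3 by apply: eq_pts.
have [|[sol bsol psol] csol] := block t1.
  by rewrite p3; apply: hB; rewrite -z1 mem_cat inE eqxx orbT.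
split; last first.
  rewrite (_ : N t1 3 = N t 3) // in csol.
  by rewrite cc; move: csol hacc; rewrite !mulnS mulnDr; lia.
exists (rcons zs (pts t 3, sol)); split.
- by rewrite -z1 /unzip1 map_rcons cats1.
- by rewrite psol /unzip2 map_rcons flatten_rcons -z2.
- by move=> w; rewrite mem_rcons inE => /orP[/eqP ->|]; [rewrite -p3 | apply: z3].
Qed.

End Walk.

(** * The algorithm *)

Definition load_body : cmd := (
  NAdd 36 35 35;; RawLd 0 36;; NInc 36;; RawLd 1 36;; St 0 35 0;; St 1 35 1)%cmd.
Definition level_body : cmd := If (NLt 23 0) (NAdd 23 23 23;; NInc 28)%cmd Skip.
Definition levels : cmd := (NSet 28 0;; NSet 23 1;; For 29 0 level_body)%cmd.
Definition init_body : cmd := (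
  VSet 0 0;; Ld 1 0 19;; Ld 2 1 19;; St 14 19 0;; St 15 19 1;; St 16 19 2)%cmd.
Definition round : cmd := (
  For 19 0 init_body;; stage_cmd 30;; stage_cmd 31;; solve_all;;
  If (NLt 2 1) (copy 2 1) Skip)%cmd.
Definition rounds : cmd := For 31 32 round.
Definition out_body : cmd := (
  NAdd 36 35 35;; Ld 0 2 35;; Ld 1 3 35;; RawSt 36 0;; NInc 36;; RawSt 36 1)%cmd.
Definition main : cmd := (
  For 35 0 load_body;; levels;; copy 0 1;; NSet 32 side;; For 30 32 rounds;;
  For 35 1 out_body;; NCopy 0 1)%cmd.

Section Main.
Variable R : realType.
Variable B : nat.
Notation st := (st R).
Notation ex := (@exec R B).
Notation tm := (@time R B).
Notation pt := (R * R)%type.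
Notation rc := (R * (R * R))%type.
Implicit Types (s t : st) (l : seq rc) (P C : seq pt).

Definition keyed P : seq rc := [seq (0, p) | p <- P].
Definition blocks L (s1 s2 : nat) P : seq (seq pt) :=
  runs (-1) [::] (stage L (s2%:R + 1) (stage L (s1%:R + 1) (keyed P))).

Lemma exec_RawLd x i s : ex (RawLd x i) s =
  if (N s i < B)%N then setV x (I s (N s i)) s else s.
Proof. by rewrite execE. Qed.
Lemma exec_RawSt x i s : ex (RawSt i x) s =
  if (N s i < B)%N then setI (N s i) (V s x) s else s.
Proof. by rewrite execE. Qed.

Lemma load_spec s n : N s 0 = n -> B = (n + n)%N ->
  pts (ex (For 35 0 load_body) s) 0 = mkseq (fun i => (I s (i + i)%N, I s (i + i).+1)) n /\
  (tm (For 35 0 load_body) s <= 30 * n + 3)%N.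
Proof.
move=> n0 eB.
have [||t [h ag -> cc]] := @for_const R B (fun (k : nat) (t : st) =>
  forall i, (i < k)%N -> (A t 0 i, A t 1 i) = (I s (i + i)%N, I s (i + i).+1)) 20
  35 0 load_body s.
- by [].
- move=> k t kn ag IH; rewrite /load_body; run.
  have kn' : (k < n)%N by rewrite -n0.
  have eI : I t = I s by case: ag => _ _ _ /(_ isT).
  rewrite (exec_RawLd 0 36) ifT /=; last by rewrite /=; lia.
  run; rewrite (exec_RawLd 1 36) ifT /=; last by rewrite /=; lia.
  run; rewrite eI; split=> // i; rewrite ltnS leq_eqVlt.
  by have [->|ik] /= := eqVneq i k; last exact: IH.
split; last by rewrite n0 in cc; move: cc; lia.
rewrite /pts /= (agree_N (j := 0) ag) // n0; apply/eq_in_map => i.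
by rewrite mem_iota add0n => /andP[_ il]; apply: h; rewrite n0.
Qed.

(** Doubling stops once [n] is reached, so the previous power is below [n]; this bounds the number
    of sorting passes by the logarithm. The loop still runs [n] rounds, which linear time allows. *)
Lemma levels_spec s n : N s 0 = n ->
  [/\ (n <= 2 ^ N (ex levels s) 28)%N,
      (N (ex levels s) 28 <= (trunc_log 2 n).+1)%N &
      (tm levels s <= 10 * n + 10)%N].
Proof.
move=> n0; rewrite /levels; run.
have [||t [h ag -> cc]] := @for_const R B (fun (k : nat) (t : st) =>
  [/\ N t 23 = (2 ^ N t 28)%N, (n <= 2 ^ N t 28)%N \/ N t 28 = k &
      N t 28 = 0%N \/ (2 ^ (N t 28).-1 < n)%N]) 5 29 0 level_body (setN 23 1 (setN 28 0 s)).
- by split; [|right|left].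
- move=> k t; rewrite [N _ 0]/= n0 => kn ag [h1 h2 h3]; rewrite /level_body; run.
  rewrite (agree_N (j := 0) ag) //= n0; case: ifP => lt; split=> //=.
    split.
    + by rewrite expnS mul2n -addnn -h1.
    + by right; move: h2 lt; rewrite h1; lia.
    + by right; rewrite -h1.
  split=> //; left; rewrite -h1; lia.
rewrite [N _ 0]/= n0 in h cc *; case: h => h1 h2 h3.
split=> /=; last by apply: (leq_trans (leq_add (leqnn 1) (leq_add (leqnn 1) cc))); lia.
  case: h2 => // ->; apply: ltnW; exact: ltn_expl.
case: h3 => [-> //|lt].
have : ((N t 28).-1 <= trunc_log 2 n)%N by apply: trunc_log_max => //; apply: ltnW.
lia.
Qed.

Lemma init_spec s n : N s 0 = n ->
  recs (ex (For 19 0 init_body) s) 14 n = keyed (pts s 0) /\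
  (tm (For 19 0 init_body) s <= 40 * n + 3)%N.
Proof.
move=> n0.
have [||t [h ag -> cc]] := @for_const R B (fun (k : nat) (t : st) =>
  recs t 14 k = take k (keyed (pts s 0))) 32 19 0 init_body s.
- by rewrite take0.
- move=> k t kn ag IH; rewrite /init_body; run; split=> //.
  have kl : (k < size (pts s 0))%N by rewrite size_pts.
  rewrite (take_nth (0,(0,0))); last by rewrite size_map.
  rewrite -IH (nth_map (0,0)) // nth_pts //=.
  rewrite -!(agree_A (t := t) ag) // -(rmorph0 (@ratr R)).
  exact: recs_push.
rewrite n0 in h cc *; split; last by move: cc; lia.
rewrite -(take_oversize (n := n) (s := keyed (pts s 0))).
  by rewrite -h; exact: eq_recs.
by rewrite size_map size_pts n0.
Qed.

Definition round_cost G := (4 * block_cost G + 200 + 1000)%N.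

Lemma round_spec G s n L : N s 0 = n -> N s 28 = L ->
  let Bs := blocks L (N s 30) (N s 31) (pts s 0) in
  (forall Q, Q \in Bs -> good_block G Q) -> (size (pts s 1) <= n)%N ->
  (exists2 C, solution Bs C &
    pts (ex round s) 1 = if (size C < size (pts s 1))%N then C else pts s 1) /\
  (tm round s <= round_cost G * (n.+1 * L.+1))%N.
Proof.
move=> n0 n28 Bs hB s1n; rewrite /round_cost; set K0 := (4 * _ + 200)%N; rewrite /round; run.
have [h1 c1] := init_spec n0; have a1 := den_agree B (For 19 0 init_body) s.
set s1 := ex (For 19 0 init_body) s in h1 a1 *.
have [|||h2 c2] := @stage_spec R B 30%N s1 n L; rewrite ?(agree_N a1) //.
have a2 := den_agree B (stage_cmd 30) s1.
set s2 := ex (stage_cmd 30) s1 in h2 a2 *.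
have [|||h3 c3] := @stage_spec R B 31%N s2 n L; rewrite ?(agree_N a2) ?(agree_N a1) //.
have a3 := den_agree B (stage_cmd 31) s2.
set s3 := ex (stage_cmd 31) s2 in h3 a3 *.
rewrite h1 (agree_N a1) // in h2.
rewrite h2 (agree_N a2) // (agree_N a1) // in h3.
have [||hC c4] := @solve_all_spec R B G s3 n; rewrite ?h3 //.
  by rewrite (agree_N a3) // (agree_N a2) // (agree_N a1).
rewrite h3 in hC; set s4 := ex solve_all s3 in hC *; have a4 := den_agree B solve_all s3.
have p1 : pts s4 1 = pts s 1.
  by rewrite (pts_agree a4) // (pts_agree a3) // (pts_agree a2) // (pts_agree a1).
have sum : (K0 * n.+1 + (40 * n + 3) + 2 * (L * (170 * n + 20) + 70 * n + 24)
   + 30 * n + 10 <= (K0 + 1000) * (n.+1 * L.+1))%N.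
  have : (K0 * n.+1 * 1 <= K0 * n.+1 * L.+1)%N by rewrite leq_mul.
  by rewrite mulnDl mulnA muln1; lia.
rewrite -/s4 in a4; rewrite -!size_pts p1; case: ifP => lt.
  have [pc cc] := @copy_spec R B 2%N 1%N s4 isT isT isT.
  split; first by exists (pts s4 2); [exact: hC | rewrite lt pc].
  by move: lt s1n c1 c2 c3 c4 cc sum; lia.
split; first by exists (pts s4 2); [exact: hC | rewrite lt p1].
by move: c1 c2 c3 c4 sum; lia.
Qed.

Definition in_range (s1 s2 : nat) := (s1 < side)%N && (s2 < side)%N.

Definition main_cost G := (side * (side * (round_cost G + 4) + 7) + 1000)%N.

(** [L] is produced before the hypothesis on the blocks, since they depend on it. The best solution
    starts as the input itself, hence the alternative [C = P]. *)
Lemma main_spec G s n : N s 0 = n -> B = (n + n)%N ->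
  let P := mkseq (fun i => (I s (i + i)%N, I s (i + i).+1)) n in
  exists2 L, (n <= 2 ^ L)%N &
  ((forall x y, in_range x y ->
      forall Q, Q \in blocks L x y P -> good_block G Q) ->
  exists C : seq pt,
    [/\ C = P \/ (exists x y, in_range x y /\ solution (blocks L x y P) C),
        forall x y, in_range x y -> exists2 C', solution (blocks L x y P) C' &
          (size C <= size C')%N,
        N (ex main s) 0 = size C,
        forall i, (i < size C)%N ->
          (I (ex main s) (i + i)%N, I (ex main s) (i + i).+1) = nth (0, 0) C i &
        (tm main s <= main_cost G * (n.+1 * (trunc_log 2 n).+2))%N]).
Proof.
move=> n0 eB P; rewrite /main_cost; set K0 := round_cost G.
have [h1 c1] := load_spec n0 eB; have a1 := den_agree B (For 35 0 load_body) s.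
set s1 := ex (For 35 0 load_body) s in h1 a1 *.
have n1 : N s1 0 = n by rewrite (agree_N a1).
have [h2 l2 c2] := levels_spec n1; have a2 := den_agree B levels s1.
set s2 := ex levels s1 in h2 l2 a2 *; set L := N s2 28 in h2 l2.
exists L => // hB; rewrite /main; run; rewrite -/s1 -/s2.
have p2 : pts s2 0 = P by rewrite (pts_agree a2).
have [h3 c3] := @copy_spec R B 0%N 1%N s2 isT isT isT.
rewrite p2 in h3 c3; have a3 := den_agree B (copy 0 1) s2.
set s3 := ex (copy 0 1) s2 in h3 a3 *.
set s4 := setN 32 side s3.
have p4 : pts s4 0 = P.
  by rewrite (_ : pts s4 0 = pts s3 0) // (pts_agree a3).
have q4 : pts s4 1 = P by rewrite -h3; apply: eq_pts.
have sP : size P = n by rewrite size_mkseq.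
have l4 : N s4 28 = L by rewrite /= (agree_N a3).
have n4 : N s4 0 = n by rewrite -size_pts p4.
pose ok (C : seq pt) := C = P \/
  (exists x y, in_range x y /\ solution (blocks L x y P) C).
pose below (C : seq pt) k1 k2 := forall x y, in_range x y ->
   (x < k1)%N || (x == k1) && (y < k2)%N ->
   exists2 C', solution (blocks L x y P) C' & (size C <= size C')%N.
have [||t5 [h5 a5 e5 c5]] := @for_const R B (fun (k : nat) (t : st) =>
  [/\ ok (pts t 1), below (pts t 1) k 0%N & (size (pts t 1) <= n)%N])
  (side * (K0 * (n.+1 * L.+1) + 4) + 3) 30 32 rounds s4.
- split; rewrite ?q4 ?sP //; first by left.
  by move=> ? ?; rewrite ltn0 andbF.
- move=> k t; rewrite [N s4 32]/= => kn ag [i1 i2 i3]; rewrite /rounds.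
  set t0 := setN 30 k t.
  have r0 : pts t0 1 = pts t 1 by apply: eq_pts.
  have [||t6 [h6 a6 -> c6]] := @for_const R B (fun (k2 : nat) (t : st) =>
    [/\ ok (pts t 1), below (pts t 1) k k2 & (size (pts t 1) <= n)%N])
    (K0 * (n.+1 * L.+1)) 31 32 round t0.
  + by rewrite r0.
  + have n32 : N t0 32 = side by rewrite /= (agree_N ag).
    move=> k2 t'; rewrite n32 => k2n ag' [j1 j2 j3].
    set t1 := setN 31 k2 t'.
    have w1 : pts t1 1 = pts t' 1 by apply: eq_pts.
    have w0 : pts t1 0 = P.
      rewrite (_ : pts t1 0 = pts t' 0); last exact: eq_pts.
      rewrite (pts_agree ag') //; rewrite (_ : pts t0 0 = pts t 0); last exact: eq_pts.
      by rewrite (pts_agree ag).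
    have w30 : N t1 30 = k by rewrite /= (agree_N ag').
    have w31 : N t1 31 = k2 by [].
    have m0 : N t1 0 = n by rewrite -size_pts w0.
    have m28 : N t1 28 = L by rewrite /= (agree_N ag') //= (agree_N ag).
    have rk : in_range k k2 by rewrite /in_range kn k2n.
    have [||[C hC hp] c] := @round_spec G t1 n L m0 m28; rewrite ?w0 ?w1 ?w30 ?w31 //.
      exact: hB.
    rewrite w0 w30 w31 in hC; rewrite w1 in hp; split=> //; rewrite hp.
    have step D : (size D <= size C)%N -> (size D <= size (pts t' 1))%N ->
        below D k k2.+1.
      move=> d1 d2 x y xy; rewrite ltnS; case: (ltngtP x k) => [xk _|//|e] /=.
        have [|C' ? ?] := j2 x y xy; first by rewrite xk.
        by exists C' => //; apply: leq_trans d2 _.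
      rewrite leq_eqVlt => /orP[/eqP ->|yk]; first by rewrite e; exists C.
      have [|C' ? ?] := j2 x y xy; first by rewrite e eqxx yk orbT.
      by exists C' => //; apply: leq_trans d2 _.
    case: ifP => lt; split=> //.
    * by right; exists k, k2.
    * by apply: step => //; apply: ltnW.
    * by apply: leq_trans j3; apply: ltnW.
    * by apply: step => //; rewrite leqNgt lt.
  have n32 : N t0 32 = side by rewrite /= (agree_N ag).
  rewrite n32 in h6 c6 *; split=> //; case: h6 => j1 j2 j3.
  rewrite (_ : pts (setN 31 side t6) 1 = pts t6 1); last exact: eq_pts.
  split=> // x y xy; rewrite ltn0 andbF orbF ltnS => xk; apply: j2 => //.
  by case/andP: xy => _ ->; rewrite andbT orbC -leq_eqVlt.
rewrite e5 [N s4 32]/=; rewrite [N s4 32]/= in h5 c5.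
case: h5 => i1 i2 i3; set C := pts t5 1 in i1 i2 i3.
set s5 := setN 30 side t5.
have p5 : pts s5 1 = C by apply: eq_pts.
have N5 : N s5 1 = size C by rewrite -p5 size_pts.
have [||t7 [h7 a7 -> c7]] := @for_const R B (fun (k : nat) (t : st) =>
  forall i, (i < k)%N -> (I t (i + i)%N, I t (i + i).+1) = nth (0, 0) C i)
  19 35 1 out_body s5.
- by [].
- move=> k t; rewrite N5 => kn ag IH; rewrite /out_body; run.
  rewrite (exec_RawSt 0 36) ifT /=; last by rewrite /=; lia.
  run; rewrite (exec_RawSt 1 36) ifT /=; last by rewrite /=; lia.
  run; split=> // i; rewrite ltnS leq_eqVlt.
  have [->|ik] /= := eqVneq i k.
    move=> _; rewrite eqxx /= ltn_eqF // eqxx -p5 nth_pts ?N5 //.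
    by rewrite !(agree_A (t := t) ag).
  by move=> ik'; rewrite !ifF ?IH //; lia.
exists C; split=> //.
- move=> x y xy; apply: i2 => //; by case/andP: xy => ->.
- by rewrite /= (agree_N a7).
- by rewrite N5 in h7.
have cB : (K0 * (n.+1 * L.+1) <= K0 * (n.+1 * (trunc_log 2 n).+2))%N.
  by rewrite !leq_mul.
set M := (n.+1 * (trunc_log 2 n).+2)%N in cB *.
have M1 : (n.+1 <= M)%N by rewrite -[n.+1]muln1 leq_mul.
have cS : (side * (K0 * (n.+1 * L.+1) + 4) + 3 + 4 <= (side * (K0 + 4) + 7) * M)%N.
  have : (K0 * (n.+1 * L.+1) + 4 <= (K0 + 4) * M)%N by rewrite mulnDl; lia.
  move/(leq_mul (leqnn side)); rewrite mulnA mulnDl; lia.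
have := leq_mul (leqnn side) cS; rewrite mulnA.
rewrite N5 in c7; rewrite sP in c3.
rewrite mulnDl.
move: c1 c2 c3 c5 c7 i3 M1; lia.
Qed.

End Main.

(** * Points far from two opposed points *)

Section Cone.
Variable R : realType.
Implicit Types x y a b p q : R.

Lemma box_near x1 y1 x2 y2 lx ux ly uy :
  lx <= x1 <= ux -> lx <= x2 <= ux -> ly <= y1 <= uy -> ly <= y2 <= uy ->
  (ux - lx) ^+ 2 + (uy - ly) ^+ 2 <= 1 ->
  ~ 1 < (x1 - x2) ^+ 2 + (y1 - y2) ^+ 2.
Proof.
move=> hx1 hx2 hy1 hy2 le; apply/negP; rewrite -leNgt; apply: le_trans le.
have sq (u l h v : R) : l <= u <= h -> l <= v <= h -> (u - v) ^+ 2 <= (h - l) ^+ 2.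
  move=> hu hv; rewrite -subr_ge0 subr_sqr.
  by apply: mulr_ge0; lra.
by apply: lerD; apply: sq.
Qed.

(* Coordinates of a point [e] of the unit disk around [v] that is at distance more
   than 1 from two points [r] and [r'] at distance at most 1/20 from [v], in the
   frame where [v] is the origin, [r] is in direction [(1, 0)] and [r'] in
   direction [(p, q)]. *)
Definition low p q x y := [/\ x < 1 / 40, p * x + q * y < 1 / 40,
   x ^+ 2 + y ^+ 2 <= 1 & 3589 / 4000 < x ^+ 2 + y ^+ 2].

Lemma low_bounds p q x y : low p q x y -> [/\ -1 <= x, -1 <= y & y <= 1].
Proof. by case=> _ _ h _; split; nra. Qed.

(** The part of the annulus left of [1 / 40] and below [1 / 4] falls into two boxes, on the left and
    at the bottom, both of diagonal less than 1. *)
Lemma low_split p q x y : p <= 0 -> 0 <= q -> p ^+ 2 + q ^+ 2 = 1 ->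
  low p q x y -> y < 1 / 4 ->
  (-1 <= x <= -7 / 10) && (-6 / 10 <= y <= 1 / 4) ||
  (-8 / 10 <= x <= 1 / 40) && (-1 <= y <= -6 / 10).
Proof.
move=> p0 q0 pq h hy; have [b1 b2 b3] := low_bounds h; case: h => h1 h2 h3 h4.
have [c|c] := lerP (-6 / 10) y; apply/orP; [left|right].
  apply/andP; split; last by lra.
  apply/andP; split=> //; rewrite leNgt; apply/negP => c'; nra.
apply/andP; split; last by lra.
apply/andP; split; last by lra.
by rewrite leNgt; apply/negP => c'; nra.
Qed.

(** A point this high satisfies both half-plane conditions only if the two directions are almost
    opposite: [p * x >= - 1 / 40] leaves [q / 4 < 1 / 20]. *)
Lemma frame_bounds p q x y : p <= 0 -> 0 <= q -> p ^+ 2 + q ^+ 2 = 1 ->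
  low p q x y -> 1 / 4 <= y -> q < 1 / 5 /\ p < - 97 / 100.
Proof.
move=> p0 q0 pq [h1 h2 _ _] hy.
have p1 : -1 <= p.
  have q2 := sqr_ge0 q; rewrite leNgt; apply/negP => c.
  have h : 0 < (-1 - p) * (1 - p) by clear -p0 c; apply: mulr_gt0; lra.
  by move: pq q2 h; clear; rewrite !expr2; lra.
have m1 : 0 <= q * (y - 1 / 4) by clear -q0 hy; apply: mulr_ge0; lra.
have m2 : 0 <= p * (x - 1 / 40) by clear -p0 h1; apply: mulr_le0; lra.
have q5 : q < 1 / 5 by clear -p1 m1 m2 h2; lra.
have q25 : q ^+ 2 <= 1 / 25 by clear -q5 q0; nra.
split=> //; rewrite ltNge; apply/negP => c.
by clear -c q25 p0 pq; nra.
Qed.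

(** With almost opposite directions the half-planes leave a strip of width less than [3 / 10], which
    meets the annulus near the top and near the bottom only. *)
Lemma low_narrow p q x0 y0 x y : p <= 0 -> 0 <= q -> p ^+ 2 + q ^+ 2 = 1 ->
  low p q x0 y0 -> 1 / 4 <= y0 -> low p q x y ->
  (-1 / 4 <= x <= 1 / 40) && ((9 / 10 <= y <= 1) || (-1 <= y <= -9 / 10)).
Proof.
move=> p0 q0 pq l0 hy h; have [q5 p9] := frame_bounds p0 q0 pq l0 hy; have [b1 b2 b3] := low_bounds h.
case: h => g1 g2 g3 g4.
have xb : -1 / 4 <= x.
  rewrite leNgt; apply/negP => c.
  have m3 : 0 <= q * (y + 1) by clear -b2 q0; apply: mulr_ge0; lra.
  have m4 : 0 <= (- 97 / 100 - p) * (- 1 / 4 - x).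
    by clear -p9 c; apply: mulr_ge0; lra.
  by clear -m3 m4 g2 q5 c p9 b1; nra.
have x2 : x ^+ 2 <= 1 / 16 by clear -xb g1; nra.
apply/andP; split; first by rewrite xb ltW.
by clear -x2 b2 b3 g4; have [c|c] := lerP 0 y; apply/orP; [left|right]; nra.
Qed.

(** Whether or not one of the points is high, two boxes of diagonal at most 1 cover all three, and
    two of the points share a box. *)
Lemma low3 p q x1 y1 x2 y2 x3 y3 : p <= 0 -> 0 <= q -> p ^+ 2 + q ^+ 2 = 1 ->
  low p q x1 y1 -> low p q x2 y2 -> low p q x3 y3 ->
  1 < (x1 - x2) ^+ 2 + (y1 - y2) ^+ 2 ->
  1 < (x1 - x3) ^+ 2 + (y1 - y3) ^+ 2 ->
  1 < (x2 - x3) ^+ 2 + (y2 - y3) ^+ 2 -> False.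
Proof.
move=> p0 q0 pq l1 l2 l3 d12 d13 d23.
have narrow (x0 y0 : R) : low p q x0 y0 -> 1 / 4 <= y0 -> False.
  move=> l0 y0g.
  have near (u v u' v' : R) : -1 / 4 <= u <= 1 / 40 -> -1 / 4 <= u' <= 1 / 40 ->
      (9 / 10 <= v <= 1) && (9 / 10 <= v' <= 1) ||
      (-1 <= v <= -9 / 10) && (-1 <= v' <= -9 / 10) ->
      1 < (u - u') ^+ 2 + (v - v') ^+ 2 -> False.
    move=> hu hu' /orP[/andP[hv hv']|/andP[hv hv']] hd;
    by apply: (box_near hu hu' hv hv' _ hd); lra.
  have /andP[a1 b1] := low_narrow p0 q0 pq l0 y0g l1.
  have /andP[a2 b2] := low_narrow p0 q0 pq l0 y0g l2.
  have /andP[a3 b3] := low_narrow p0 q0 pq l0 y0g l3.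
  have := near _ _ _ _ a1 a2 ^~ d12; have := near _ _ _ _ a1 a3 ^~ d13.
  have := near _ _ _ _ a2 a3 ^~ d23.
  by move: b1 b2 b3; case/orP=> ->; case/orP=> ->; case/orP=> ->;
    rewrite ?orbT => n1 n2 n3; first [exact: n1 | exact: n2 | exact: n3].
have [g1|g1] := lerP (1 / 4) y1; first exact: narrow l1 g1.
have [g2|g2] := lerP (1 / 4) y2; first exact: narrow l2 g2.
have [g3|g3] := lerP (1 / 4) y3; first exact: narrow l3 g3.
have near (u v u' v' : R) :
    (-1 <= u <= -7 / 10) && (-6 / 10 <= v <= 1 / 4) &&
    ((-1 <= u' <= -7 / 10) && (-6 / 10 <= v' <= 1 / 4)) ||
    (-8 / 10 <= u <= 1 / 40) && (-1 <= v <= -6 / 10) &&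
    ((-8 / 10 <= u' <= 1 / 40) && (-1 <= v' <= -6 / 10)) ->
    1 < (u - u') ^+ 2 + (v - v') ^+ 2 -> False.
  by move=> /orP[/andP[/andP[a b] /andP[a' b']]|/andP[/andP[a b] /andP[a' b']]] hd;
    apply: (box_near a a' b b' _ hd); lra.
have b1 := low_split p0 q0 pq l1 g1; have b2 := low_split p0 q0 pq l2 g2; have b3 := low_split p0 q0 pq l3 g3.
have := near _ _ _ _ ^~ d12; have := near _ _ _ _ ^~ d13; have := near _ _ _ _ ^~ d23.
by move: b1 b2 b3; case/orP=> ->; case/orP=> ->; case/orP=> ->;
  rewrite ?orbT => n1 n2 n3; first [exact: n1 | exact: n2 | exact: n3].
Qed.

End Cone.

Section Reps.
Variable R : realType.
Notation pt := (R * R)%type.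
Implicit Types (v r e p q z : pt) (Q l : seq pt).

(** The rotation taking [(c, s)], the direction of [r], to the first axis preserves norms. Expanding
    the squares turns each distance condition into a bound on the component along [r] or [r']. *)
Lemma low_rotate (c s n p q n' a b a' b' x y : R) :
  c ^+ 2 + s ^+ 2 = 1 -> 0 < n -> n <= 1 / 20 -> 0 < n' -> n' <= 1 / 20 ->
  a = n * c -> b = n * s ->
  a' = n' * (p * c - q * s) -> b' = n' * (p * s + q * c) ->
  p ^+ 2 + q ^+ 2 = 1 ->
  x * x + y * y <= 1 -> 1 < (a - x) * (a - x) + (b - y) * (b - y) ->
  1 < (a' - x) * (a' - x) + (b' - y) * (b' - y) ->
  low p q (x * c + y * s) (y * c - x * s).
Proof.
move=> cs n0 n1 n0' n1' -> -> -> -> pq xy h1 h2.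
set X := x * c + y * s; set Y := y * c - x * s.
have e0 : X ^+ 2 + Y ^+ 2 = x * x + y * y.
  transitivity ((x * x + y * y) * (c ^+ 2 + s ^+ 2)); first by rewrite /X /Y; ring.
  by rewrite cs mulr1.
have e1 : (n * c - x) * (n * c - x) + (n * s - y) * (n * s - y) =
          n ^+ 2 - 2%:R * n * X + (x * x + y * y).
  transitivity (n ^+ 2 * (c ^+ 2 + s ^+ 2) - 2%:R * n * X + (x * x + y * y)).
    by rewrite /X; ring.
  by rewrite cs mulr1.
have e2 : (n' * (p * c - q * s) - x) * (n' * (p * c - q * s) - x) +
          (n' * (p * s + q * c) - y) * (n' * (p * s + q * c) - y) =
          n' ^+ 2 - 2%:R * n' * (p * X + q * Y) + (x * x + y * y).
  transitivity (n' ^+ 2 * ((p ^+ 2 + q ^+ 2) * (c ^+ 2 + s ^+ 2))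
     - 2%:R * n' * (p * X + q * Y) + (x * x + y * y)).
    by rewrite /X /Y; ring.
  by rewrite cs pq !mulr1.
rewrite e1 in h1; rewrite e2 in h2.
(* A point of norm at most 1 that is farther than 1 from a point at distance [m] has component below
   [m / 2] in its direction; this is where [1 / 40] comes from. *)
have half (m Z : R) : 0 < m -> m <= 1 / 20 ->
    1 < m ^+ 2 - 2%:R * m * Z + (x * x + y * y) -> Z < 1 / 40.
  move=> m0 m1 h; rewrite ltNge; apply/negP => c'.
  have : 0 <= m * (Z - m / 2%:R) by apply: mulr_ge0; lra.
  by move: h; rewrite expr2; lra.
split.
- exact: half h1.
- exact: half h2.
- by rewrite e0.
have X1 : -1 <= X.
  have := sqr_ge0 Y => Y2; rewrite leNgt; apply/negP => c'.
  have : 0 < (-1 - X) * (1 - X) by apply: mulr_gt0; lra.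
  by move: e0; rewrite !expr2 in Y2 *; lra.
(* Squared inner radius: it exceeds [1 - n ^ 2 + 2 n X], which is at least
   [1 - 1 / 400 - 1 / 10 = 3590 / 4000]. *)
have m1 : 0 <= n * (X + 1) by apply: mulr_ge0; lra.
have m2 : 0 <= n * (1 / 20 - n) by apply: mulr_ge0; lra.
by rewrite e0; move: h1; rewrite expr2; lra.
Qed.

Lemma unit_sqrt (a b : R) : 0 < a * a + b * b -> a * a + b * b <= 1 / 400 ->
  exists n, [/\ 0 < n, n <= 1 / 20 & n ^+ 2 = a * a + b * b].
Proof.
move=> h0 h1; exists (Num.sqrt (a * a + b * b)).
have s0 : 0 < Num.sqrt (a * a + b * b) by rewrite sqrtr_gt0.
have s2 : Num.sqrt (a * a + b * b) ^+ 2 = a * a + b * b by rewrite sqr_sqrtr // ltW.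
split=> //; rewrite leNgt; apply/negP => c.
have : 0 < (Num.sqrt (a * a + b * b) - 1 / 20) * (Num.sqrt (a * a + b * b) + 1 / 20).
  by apply: mulr_gt0; lra.
by move: s2; rewrite expr2; lra.
Qed.

(** In the frame along [r], the condition on the scalar product becomes [p <= 0], and a reflection
    achieves [q >= 0], which is the situation of [low3]. *)
Lemma opposed_pair v r r' e1 e2 e3 :
  d2 r v <= 1 / 400 -> d2 r' v <= 1 / 400 ->
  (r.1 - v.1) * (r'.1 - v.1) + (r.2 - v.2) * (r'.2 - v.2) <= 0 ->
  d2 e1 v <= 1 -> d2 e2 v <= 1 -> d2 e3 v <= 1 ->
  1 < d2 r e1 -> 1 < d2 r e2 -> 1 < d2 r e3 ->
  1 < d2 r' e1 -> 1 < d2 r' e2 -> 1 < d2 r' e3 ->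
  1 < d2 e1 e2 -> 1 < d2 e1 e3 -> 1 < d2 e2 e3 -> False.
Proof.
have tr (t e : pt) : d2 t e = ((t.1 - v.1) - (e.1 - v.1)) * ((t.1 - v.1) - (e.1 - v.1)) +
    ((t.2 - v.2) - (e.2 - v.2)) * ((t.2 - v.2) - (e.2 - v.2)) by rewrite /d2; ring.
rewrite (tr r e1) (tr r e2) (tr r e3) (tr r' e1) (tr r' e2) (tr r' e3).
rewrite (tr e1 e2) (tr e1 e3) (tr e2 e3) /d2.
move: (r.1 - v.1) (r.2 - v.2) (r'.1 - v.1) (r'.2 - v.2) => a b a' b'.
move: (e1.1 - v.1) (e1.2 - v.2) (e2.1 - v.1) (e2.2 - v.2) (e3.1 - v.1) (e3.2 - v.2).
move=> x1 y1 x2 y2 x3 y3 ha hb hab u1 u2 u3 p1 p2 p3 q1 q2 q3 d12 d13 d23.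
(* Neither [r] nor [r'] is [v], which is within distance 1 of [e1]; so their directions exist. *)
have pos (s t : R) : 1 < (s - x1) * (s - x1) + (t - y1) * (t - y1) -> 0 < s * s + t * t.
  move=> h; have s2 := sqr_ge0 s; have t2 := sqr_ge0 t; rewrite !expr2 in s2 t2.
  rewrite lt_neqAle addr_ge0 // andbT; apply/negP => /eqP e.
  have /eqP : s ^+ 2 = 0 by rewrite expr2; lra.
  have /eqP : t ^+ 2 = 0 by rewrite expr2; lra.
  rewrite !sqrf_eq0 => /eqP t0 /eqP s0; move: h; rewrite s0 t0 !sub0r !mulrNN; lra.
have [n [n0 n1 nn]] := unit_sqrt (pos _ _ p1) ha.
have [n' [n0' n1' nn']] := unit_sqrt (pos _ _ q1) hb.
pose c := a / n; pose s := b / n.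
pose p := (a' * c + b' * s) / n'; pose q := (b' * c - a' * s) / n'.
have nz : n != 0 by rewrite gt_eqF.
have nz' : n' != 0 by rewrite gt_eqF.
have ea : a = n * c by rewrite /c mulrC divfK.
have eb : b = n * s by rewrite /s mulrC divfK.
have cs : c ^+ 2 + s ^+ 2 = 1.
  by rewrite /c /s !expr_div_n -mulrDl !expr2 -nn expr2 mulfV // mulf_neq0.
have np : n' * p = a' * c + b' * s by rewrite /p mulrC divfK.
have nq : n' * q = b' * c - a' * s by rewrite /q mulrC divfK.
have ea' : a' = n' * (p * c - q * s).
  transitivity (a' * (c ^+ 2 + s ^+ 2)); first by rewrite cs mulr1.
  transitivity (n' * p * c - n' * q * s); last by ring.
  by rewrite np nq; ring.
have eb' : b' = n' * (p * s + q * c).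
  transitivity (b' * (c ^+ 2 + s ^+ 2)); first by rewrite cs mulr1.
  transitivity (n' * p * s + n' * q * c); last by ring.
  by rewrite np nq; ring.
have pq : p ^+ 2 + q ^+ 2 = 1.
  apply: (mulfI (x := n' ^+ 2)); first by rewrite expf_neq0.
  transitivity ((n' * p) ^+ 2 + (n' * q) ^+ 2); first by ring.
  rewrite np nq mulr1 nn'; transitivity ((a' * a' + b' * b') * (c ^+ 2 + s ^+ 2)); first by ring.
  by rewrite cs mulr1.
have p0 : p <= 0.
  rewrite /p pmulr_lle0 ?invr_gt0 // /c /s.
  rewrite (_ : _ + _ = (a * a' + b * b') / n); last by ring.
  by rewrite pmulr_lle0 ?invr_gt0.
have L x y : x * x + y * y <= 1 -> 1 < (a - x) * (a - x) + (b - y) * (b - y) ->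
    1 < (a' - x) * (a' - x) + (b' - y) * (b' - y) ->
    low p q (x * c + y * s) (y * c - x * s).
  exact: low_rotate cs n0 n1 n0' n1' ea eb ea' eb' pq.
have D x y x' y' : 1 < (x - x') * (x - x') + (y - y') * (y - y') ->
   1 < (x * c + y * s - (x' * c + y' * s)) ^+ 2 +
       (y * c - x * s - (y' * c - x' * s)) ^+ 2.
  move=> h; rewrite (_ : _ + _ = ((x - x') * (x - x') + (y - y') * (y - y')) * (c ^+ 2 + s ^+ 2));
    last by ring.
  by rewrite cs mulr1.
have [q0|q0] := lerP 0 q.
  exact: (low3 p0 q0 pq (L _ _ u1 p1 q1) (L _ _ u2 p2 q2) (L _ _ u3 p3 q3)
    (D _ _ _ _ d12) (D _ _ _ _ d13) (D _ _ _ _ d23)).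
have q0' : 0 <= - q by lra.
have pq' : p ^+ 2 + (- q) ^+ 2 = 1 by rewrite sqrrN.
have fl x y : low p q x y -> low p (- q) x (- y) by case=> *; split; rewrite ?mulrNN ?sqrrN.
have fd (x y x' y' : R) : 1 < (x - x') ^+ 2 + (y - y') ^+ 2 ->
    1 < (x - x') ^+ 2 + (- y - - y') ^+ 2.
  by rewrite -opprD sqrrN.
exact: (low3 p0 q0' pq' (fl _ _ (L _ _ u1 p1 q1)) (fl _ _ (L _ _ u2 p2 q2)) (fl _ _ (L _ _ u3 p3 q3))
    (fd _ _ _ _ (D _ _ _ _ d12)) (fd _ _ _ _ (D _ _ _ _ d13)) (fd _ _ _ _ (D _ _ _ _ d23))).
Qed.

End Reps.

(** * Representatives and packing *)

Section Pack.
Variable R : realType.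
Notation pt := (R * R)%type.
Implicit Types (v r e p q z c : pt) (Q l X : seq pt).

Lemma ext_extremal (th : R) u z Q : 0 <= th ->
  d2 (ext th u z Q) z <= th /\
  forall p, p \in Q -> d2 p z <= th -> dot u p <= dot u (ext th u z Q).
Proof.
move=> th0; rewrite /ext.
suff gen e0 : d2 e0 z <= th -> let e := foldl (ext_step th u z) e0 Q in
    [/\ d2 e z <= th, dot u e0 <= dot u e &
        forall p, p \in Q -> d2 p z <= th -> dot u p <= dot u e].
  by have [|h1 h2 h3] := gen z; rewrite ?d2xx.
elim: Q e0 => [|p Q IH] e0 h0 /=; first by split.
have h1 : d2 (ext_step th u z e0 p) z <= th.
  by rewrite /ext_step; case: ltP => // h; case: ifP.
have h2 : dot u e0 <= dot u (ext_step th u z e0 p).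
  by rewrite /ext_step; case: ltP => // _; case: ltP => // /ltW.
have h3 : d2 p z <= th -> dot u p <= dot u (ext_step th u z e0 p).
  by move=> h; rewrite /ext_step ltNge h /=; case: ltP.
have [g1 g2 g3] := IH _ h1; split=> //; first exact: le_trans g2.
move=> r; rewrite inE => /orP[/eqP ->|] h; last exact: g3.
exact: le_trans (h3 h) g2.
Qed.

(** A triangle inequality without square roots: the difference of the two sides is the squared norm
    of [p + q - 2 z]. *)
Lemma d2_double p q z : d2 p q <= 2 * d2 p z + 2 * d2 z q.
Proof.
have h1 := sqr_ge0 (p.1 - z.1 - (z.1 - q.1)); have h2 := sqr_ge0 (p.2 - z.2 - (z.2 - q.2)).
rewrite -subr_ge0 (_ : _ - _ = (p.1 - z.1 - (z.1 - q.1)) ^+ 2 + (p.2 - z.2 - (z.2 - q.2)) ^+ 2);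
  first by rewrite addr_ge0.
by rewrite /d2; ring.
Qed.

(* The westernmost and the easternmost points of the net ball of [v] are opposed
   with respect to [v], unless both are strictly to the same side of the horizontal
   line through [v]; then the extreme point on the other side is opposed to one of
   them. *)
Lemma rep_pair Q v : v \in Q -> exists r r', [/\ r \in reps Q, r' \in reps Q,
  d2 r v <= 1 / 400, d2 r' v <= 1 / 400 &
  (r.1 - v.1) * (r'.1 - v.1) + (r.2 - v.2) * (r'.2 - v.2) <= 0].
Proof.
move=> vQ; have th0 := eta2_ge0 R.
have /hasP[z zn zv] := foldl_add_has [::] th0 vQ; rewrite -/(net Q) in zn.
have vz : d2 v z <= eta2 R by rewrite d2C.
have key (u : pt) : u \in [:: (1, 0); (-1, 0); (0, 1); (0, -1)] ->
    [/\ ext (eta2 R) u z Q \in reps Q, d2 (ext (eta2 R) u z Q) v <= 1 / 400 &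
      dot u v <= dot u (ext (eta2 R) u z Q)].
  move=> hu; have [h1 h2] := ext_extremal u z Q th0; split; last exact: h2.
    apply/flattenP; exists (ext4 Q z); first exact: map_f.
    by apply/mapP; exists u.
  (* The net point [z] is within [1 / 40] of both [v] and the representative, and
     [2 / 1600 + 2 / 1600 = 1 / 400]. *)
  apply: le_trans (d2_double _ _ z) _; move: h1 zv; rewrite eta2E; lra.
have [|E1 E2 E3] := key (1, 0); first by rewrite !inE eqxx.
have [|W1 W2 W3] := key (-1, 0); first by rewrite !inE eqxx orbT.
have [|N1 N2 N3] := key (0, 1); first by rewrite !inE eqxx !orbT.
have [|S1 S2 S3] := key (0, -1); first by rewrite !inE eqxx !orbT.
move: E1 E2 E3 W1 W2 W3 N1 N2 N3 S1 S2 S3; rewrite /dot /=.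
move: (ext _ (1, 0) z Q) (ext _ (-1, 0) z Q) (ext _ (0, 1) z Q) (ext _ (0, -1) z Q).
move=> E W T S; rewrite !mul1r !mul0r !mulN1r !addr0 !add0r !lerN2.
move=> E1 E2 E3 W1 W2 W3 N1 N2 N3 S1 S2 S3.
have op (a b a' b' : R) : a <= 0 -> 0 <= a' -> (b <= 0) && (0 <= b') || (0 <= b) && (b' <= 0) ->
    a * a' + b * b' <= 0.
  move=> h1 h2 h3; have m1 : a * a' <= 0 by apply: mulr_le0_ge0.
  have m2 : b * b' <= 0.
    by case/orP: h3 => /andP[h3 h4]; [apply: mulr_le0_ge0 | apply: mulr_ge0_le0].
  by rewrite -[0]addr0 lerD.
have Ww : W.1 - v.1 <= 0 by rewrite subr_le0.
have Ee : 0 <= E.1 - v.1 by rewrite subr_ge0.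
have Tt : 0 <= T.2 - v.2 by rewrite subr_ge0.
have Ss : S.2 - v.2 <= 0 by rewrite subr_le0.
case: (lerP 0 (W.2 - v.2)) => [w|/ltW w]; case: (lerP 0 (E.2 - v.2)) => [e|/ltW e].
- case: (lerP 0 (S.1 - v.1)) => [s|/ltW s].
    by exists W, S; split=> //; apply: op; rewrite ?Ww ?s ?w ?Ss ?orbT.
  by exists S, E; split=> //; apply: op; rewrite ?Ee ?s ?e ?Ss.
- by exists W, E; split=> //; apply: op; rewrite ?Ww ?Ee ?w ?e ?orbT.
- by exists W, E; split=> //; apply: op; rewrite ?Ww ?Ee ?w ?e ?orbT.
- case: (lerP 0 (T.1 - v.1)) => [s|/ltW s].
    by exists W, T; split=> //; apply: op; rewrite ?Ww ?s ?w ?Tt.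
  by exists T, E; split=> //; apply: op; rewrite ?Ee ?s ?e ?Tt ?orbT.
Qed.

(* Pigeonhole on square cells of side [h]. *)
Lemma packing (T : finType) (f : pt -> T) (w h th : R) (M : nat) c l :
  0 < h -> 2 * h ^+ 2 <= th -> 2 * w / h < M%:R -> uniq l ->
  {in l, forall p, `|p.1 - c.1| <= w /\ `|p.2 - c.2| <= w} ->
  {in l &, forall p q, p != q -> f p = f q -> th < d2 p q} ->
  (size l <= #|T| * (M * M))%N.
Proof.
move=> h0 hth hM ul hw far.
have [->//|[p0 p0l]] : l = [::] \/ exists p, p \in l.
  by case: l {ul hw far} => [|p l]; [left | right; exists p; rewrite inE eqxx].
have w0 : 0 <= w by have [h1 _] := hw p0 p0l; apply: le_trans h1.
pose cell (a b : R) := Num.truncn ((a - b + w) / h).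
have pos (a b : R) : `|a - b| <= w -> 0 <= (a - b + w) / h.
  by move=> ab; apply: divr_ge0; last exact: ltW; move: ab; rewrite ler_norml; lra.
have cellM (a b : R) : `|a - b| <= w -> (cell a b < M)%N.
  move=> ab; rewrite truncn_lt_nat ?pos //; apply: le_lt_trans hM.
  rewrite ler_pM2r ?invr_gt0 //; move: ab; rewrite ler_norml; lra.
have close (a a' b : R) : `|a - b| <= w -> `|a' - b| <= w -> cell a b = cell a' b ->
    (a - a') ^+ 2 <= h ^+ 2.
  move=> ab ab' e.
  have /andP[i1 i2] := truncn_itv (pos _ _ ab); have /andP[j1 j2] := truncn_itv (pos _ _ ab').
  rewrite -/(cell a b) -/(cell a' b) -?e in i1 i2 j1 j2.
  have d : (a - b + w) / h - (a' - b + w) / h = (a - a') / h by rewrite -mulrBl; congr (_ / _); ring.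
  rewrite -natr1 in i2 j2.
  have lo : -1 <= (a - a') / h by rewrite -d; lra.
  have hi : (a - a') / h <= 1 by rewrite -d; lra.
  rewrite ler_pdivrMr // mul1r in hi; rewrite ler_pdivlMr // mulN1r in lo.
  by rewrite -subr_ge0 subr_sqr; apply: mulr_ge0; lra.
case: M hM cellM => [|M] hM cellM; first by have [h1 _] := hw p0 p0l; have := cellM _ _ h1.
pose g p : T * ('I_M.+1 * 'I_M.+1) :=
  (f p, (inord (cell p.1 c.1), inord (cell p.2 c.2))).
have inj : {in l &, injective g}.
  move=> p q pl ql [e1 /(congr1 val)/= e2 /(congr1 val)/= e3].
  have [p1 p2] := hw p pl; have [q1 q2] := hw q ql.
  rewrite !inordK ?cellM // in e2 e3.
  apply/eqP/negPn/negP => pq; have := far p q pl ql pq e1.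
  have := close _ _ _ p1 q1 e2; have := close _ _ _ p2 q2 e3.
  by rewrite /d2 -!expr2; lra.
have : (size (map g l) <= #|{: T * ('I_M.+1 * 'I_M.+1)}|)%N.
  by rewrite -(card_uniqP _) ?max_card ?map_inj_in_uniq.
by rewrite size_map !card_prod !card_ord.
Qed.

(** Separation holds among the added points and from the initial list, but not inside the initial
    list, which may be a selection of close representatives. *)
Lemma foldl_add_split (th : R) X Q : 0 <= th -> exists m,
  [/\ foldl (add th) X Q = X ++ m, uniq m, {subset m <= Q},
      {in m &, forall p q, p != q -> th < d2 p q} &
      {in X & m, forall p q, th < d2 p q}].
Proof.
move=> th0; elim/last_ind: Q => [|Q p [m [e um sm fm xm]]].
  by exists [::]; rewrite cats0.
rewrite foldl_rcons e /add; case: ifPn => [hs|/hasPn hs].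
  by exists m; split=> // q /sm; rewrite mem_rcons inE => ->; rewrite orbT.
exists (rcons m p); rewrite rcons_cat; split=> //.
- rewrite rcons_uniq um andbT; apply/negP => pm.
  by have := hs p; rewrite mem_cat pm orbT d2xx th0 => /(_ isT).
- by move=> q; rewrite !mem_rcons !inE => /orP[-> //|/sm ->]; rewrite orbT.
- move=> q r; rewrite !mem_rcons !inE => /orP[/eqP ->|qm] /orP[/eqP ->|rm] //.
  + by rewrite eqxx.
  + by move=> _; rewrite d2C ltNge; apply: hs; rewrite mem_cat rm orbT.
  + by move=> _; rewrite ltNge; apply: hs; rewrite mem_cat qm orbT.
  + exact: fm.
- move=> q r qX; rewrite mem_rcons inE => /orP[/eqP ->|]; last exact: xm.
  by rewrite ltNge; apply: hs; rewrite mem_cat qX.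
Qed.

Definition spread (w : R) Q := {in Q &, forall p q, `|p.1 - q.1| <= w /\ `|p.2 - q.2| <= w}.

Lemma good_block_spread (w : R) : exists G, forall Q, uniq Q -> spread w Q -> good_block G Q.
Proof.
(* The cell side [1 / 60] serves both bounds: [2 / 3600 = 1 / 1800] is below the squared net radius
   [1 / 1600] and below 1. *)
have [M hM] : exists M : nat, 2 * w / (1 / 60) < M%:R.
  by exists (Num.truncn (2 * w / (1 / 60))).+1; exact: truncnS_gt.
exists (M * M)%N => Q uQ sQ.
have far (th : R) m : 1 / 1800 <= th -> uniq m -> {subset m <= Q} ->
    {in m &, forall p q, p != q -> th < d2 p q} -> (size m <= M * M)%N.
  move=> hth um sm fm; case: Q sQ {uQ} sm => [|c Q] sQ sm.
    by case: m sm {um fm} => // p m /(_ p); rewrite !inE eqxx => /(_ isT).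
  rewrite -[(M * M)%N]mul1n -card_unit.
  apply: (@packing _ (fun=> tt) w (1 / 60) th M c m) => //.
  - lra.
  - by move=> p /sm pQ; apply: sQ => //; rewrite inE eqxx.
  - by move=> p q pm qm pq _; apply: fm.
split=> //.
  have [m [e um sm fm _]] := foldl_add_split [::] Q (eta2_ge0 R).
  rewrite /net e; apply: (far (eta2 R)) => //; rewrite eta2E; lra.
move=> b; have [m [e um sm fm _]] := foldl_add_split (pick Q b) Q ler01.
by rewrite /grow e size_cat leq_add2l; apply: (far 1 m _ um sm fm); lra.
Qed.

End Pack.

(** * Cuts of a sorted list *)

Section WalkTheory.
Variable R : realType.
Notation pt := (R * R)%type.
Notation rc := (R * (R * R))%type.
Implicit Types (l : seq rc) (r q : rc).

Lemma side_ge2 : 2 <= side%:R :> R.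
Proof. by rewrite ler_nat /side -lock. Qed.

(* The position of the last restart of [walk] before each record: it does not
   depend on the offset [o], so that the records separated by a cut can be counted
   over all offsets. *)
Fixpoint anchors (pk px a : R) l : seq R :=
  if l is r :: l' then
    let a' := if fresh pk px r then r.2.1 else a in
    a' :: anchors r.1 r.2.1 a' l'
  else [::].

(** Invariant of the walk between restarts: the end [b] of the slab is ahead by at most one width
    and lies on the lattice of offset [o] counted from the anchor [a]. *)
Definition settled_at (o px b a : R) :=
  [/\ px < b, b <= px + side%:R, a <= px & exists j : nat, b = a + o + side%:R * j%:R].

Lemma walk_step o pk px b a r : 1 <= o <= side%:R ->
  fresh pk px r \/ (settled_at o px b a /\ px <= r.2.1) ->
  settled_at o r.2.1 (if fresh pk px r then r.2.1 + o else
              if r.2.1 < b then b else b + side%:R)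
    (if fresh pk px r then r.2.1 else a).
Proof.
move=> /andP[ho1 ho2] h; have s2 := side_ge2.
case: ifP h => [f _|nf]; last case=> // [[[h1 h2 h3 [j h4]] h5]].
  by split; try lra; exists 0%N; rewrite mulr0 addr0.
move: nf; rewrite /fresh => /norP[_]; rewrite -leNgt => gap.
case: ltP => c; split; try lra; first by exists j.
by exists j.+1; rewrite -natr1 h4; ring.
Qed.

Lemma leT_key pk px y r : leT (pk, (px, y)) r -> r.1 = pk -> px <= r.2.1.
Proof. by rewrite /leT /= => h e; move: h; rewrite e ltxx eqxx. Qed.

(** For equal keys and a distance of at most 2 no restart intervenes; [k] is then the number of slab
    ends passed, each adding 1 to the slab number and [side] to the end. *)
Lemma walk_later o pk px y b id a z l i : 1 <= o <= side%:R ->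
  path (@leT R) (pk, (px, y)) l -> settled_at o px b a -> (i < size l)%N ->
  let r := nth z l i in let id' := nth 0%N (walk o pk px b id l) i in
  [/\ (id <= id')%N, id' = id -> r.1 = pk /\ r.2.1 < b &
      r.1 = pk -> r.2.1 <= px + 2%:R -> nth 0 (anchors pk px a l) i = a /\
      exists k : nat, [/\ id' = (id + k)%N, r.2.1 < b + side%:R * k%:R &
        b + side%:R * k%:R <= r.2.1 + side%:R]].
Proof.
move=> ho; elim: l pk px y b id a i => // q l IH pk px y b id a i /=.
move=> /andP[pq ql] st il.
have st' : settled_at o q.2.1 (if fresh pk px q then q.2.1 + o else
    if q.2.1 < b then b else b + side%:R) (if fresh pk px q then q.2.1 else a).
  apply: walk_step => //; case: (boolP (fresh pk px q)) => f; first (by left); right.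
  split=> //; apply: (leT_key pq); move: f; rewrite /fresh => /norP[/negPn/eqP //].
have head : let id' := if fresh pk px q || ~~ (q.2.1 < b) then id.+1 else id in
  [/\ (id <= id')%N, id' = id -> q.1 = pk /\ q.2.1 < b &
      q.1 = pk -> q.2.1 <= px + 2%:R -> (if fresh pk px q then q.2.1 else a) = a /\
      exists k : nat, [/\ id' = (id + k)%N, q.2.1 < b + side%:R * k%:R &
        b + side%:R * k%:R <= q.2.1 + side%:R]].
  have nfE : q.1 = pk -> q.2.1 <= px + 2%:R -> fresh pk px q = false.
    by rewrite /fresh => -> h; rewrite eqxx ltNge h.
  split.
  - by case: ifP.
  - case: ifP => [_ /eqP|/norP[f /negPn lt] _]; first by rewrite gtn_eqF.
    by split=> //; move: f; rewrite /fresh => /norP[/negPn/eqP].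
  - move=> e1 e2; rewrite (nfE e1 e2) /= in st' *.
    split=> //; move: st'; case: ifP => c [h1 h2 h3 _].
      by exists 0%N; rewrite addn0 mulr0 addr0.
    by exists 1%N; rewrite addn1 mulr1.
have -> : q = (q.1, (q.2.1, q.2.2)) by case: (q) => ? [].
case: i il => [|i] il; first by move: head; case: (q) => ? [].
rewrite [nth z _ _]/= [nth 0%N _ _]/= [nth 0 _ _]/=.
have [h1 h2 h3] := head.
set id1 := (if _ || _ then _ else _) in h1 h2 h3 *.
set b1 := (if _ then _ else _) in st' *.
set a1 := (if _ then _ else _) in st' h3 *.
have ql' : path (@leT R) (q.1, (q.2.1, q.2.2)) l by move: ql; case: (q) => ? [].
have [g1 g2 g3] := IH q.1 q.2.1 q.2.2 b1 id1 a1 i ql' st' il.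
have qr : leT (q.1, (q.2.1, q.2.2)) (nth z l i).
  have := order_path_min (@leT_trans R) ql'; move/all_nthP => /(_ z i il) //.
split.
- exact: leq_trans g1.
- move=> e.
  have e1 : id1 = id by apply/eqP; rewrite eqn_leq h1 -e g1.
  have [k1 k2] := h2 e1.
  have [m1 m2] : (nth z l i).1 = q.1 /\ (nth z l i).2.1 < b1 by apply: g2; rewrite e e1.
  split; first by rewrite m1.
  move: m2; rewrite /b1 k2; case: ifP => // f.
  by move: e1; rewrite /id1 f /= => /eqP; rewrite gtn_eqF.
- move=> e1 e2.
  have k1 : q.1 = pk.
    move: pq qr; rewrite /leT /= e1 => p1 p2.
    by case: (ltgtP q.1 pk) p1 p2.
  have k2 : q.2.1 <= (nth z l i).2.1 by apply: (leT_key qr); rewrite e1.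
  have k3 : px <= q.2.1 by apply: (leT_key pq).
  have k4 : q.2.1 <= px + 2%:R by apply: le_trans e2.
  have [n1 [k [n2 n3 n4]]] := h3 k1 k4.
  have [||m1 [k' [m2 m3 m4]]] := g3.
  + by rewrite e1.
  + by apply: le_trans e2 _; rewrite lerD2r.
  split; first exact: etrans m1 n1.
  have nf : fresh pk px q = false by rewrite /fresh k1 eqxx ltNge k4.
  have b1E : b1 = b + side%:R * k%:R.
    move: n2; rewrite /b1 /id1 nf /=; case: (q.2.1 < b) => /= e.
      by have -> : k = 0%N by [apply/eqP; rewrite -(eqn_add2l id) -e addn0]; rewrite mulr0 addr0.
    by have -> : k = 1%N by [apply/eqP; rewrite -(eqn_add2l id) -e addn1]; rewrite mulr1.
  exists (k + k')%N; split.
  + by rewrite m2 n2 addnA.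
  + by move: m3; rewrite b1E natrD mulrDr addrA.
  + by move: m4; rewrite b1E natrD mulrDr addrA.
Qed.

(** Splits the walk behind record [i], so that [walk_later] applies to any pair of records. The
    start of the walk is not settled; there the second alternative applies, as the key -1 does not
    occur. *)
Lemma walk_state o pk px y b id a z l i : 1 <= o <= side%:R ->
  path (@leT R) (pk, (px, y)) l -> settled_at o px b a \/ all (fun r => r.1 != pk) l ->
  (i < size l)%N ->
  let r := nth z l i in
  exists b', [/\ settled_at o r.2.1 b' (nth 0 (anchors pk px a l) i),
    drop i.+1 (walk o pk px b id l) =
      walk o r.1 r.2.1 b' (nth 0%N (walk o pk px b id l) i) (drop i.+1 l) &
    drop i.+1 (anchors pk px a l) =
      anchors r.1 r.2.1 (nth 0 (anchors pk px a l) i) (drop i.+1 l)].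
Proof.
move=> ho; elim: l pk px y b id a i => // q l IH pk px y b id a i.
move=> /= /andP[pq ql] st il.
have st' : settled_at o q.2.1 (if fresh pk px q then q.2.1 + o else
    if q.2.1 < b then b else b + side%:R) (if fresh pk px q then q.2.1 else a).
  apply: walk_step => //; case: (boolP (fresh pk px q)) => f; first (by left); right.
  have e : q.1 = pk by move: f; rewrite /fresh => /norP[/negPn/eqP //].
  case: st => [st|/andP[]]; last by rewrite e eqxx.
  by split=> //; apply: (leT_key pq).
case: i il => [|i] il; first by rewrite !drop0; eexists; split; first exact: st'.
have ql' : path (@leT R) (q.1, (q.2.1, q.2.2)) l by move: ql; case: (q) => ? [].
exact: (IH _ _ _ _ _ _ i ql' (or_introl st') il).
Qed.

End WalkTheory.

Section StageTheory.
Variable R : realType.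
Notation pt := (R * R)%type.
Notation rc := (R * (R * R))%type.
Implicit Types (l : seq rc) (r q : rc).

Let z : rc := (0, (0, 0)).
Definition anchor l := nth 0 (anchors (-1) 0 0 l).

(** The cut between two neighbours is at distance [s + 1 + side * m] from their common anchor. As
    the anchor is independent of [s], this becomes a congruence on the shift. *)
Lemma ids_pair (s : nat) l i j : (s < side)%N ->
  sorted (@leT R) l -> (forall r, r \in l -> 0 <= r.1) ->
  (i < j)%N -> (j < size l)%N ->
  let o : R := s%:R + 1 in
  let ri := nth z l i in let rj := nth z l j in
  let di := nth 0%N (ids o l) i in let dj := nth 0%N (ids o l) j in
  [/\ (di <= dj)%N,
      di = dj -> ri.1 = rj.1 /\ 0 <= rj.2.1 - ri.2.1 <= side%:R,
      anchor l i <= ri.2.1 &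
      ri.1 = rj.1 -> rj.2.1 <= ri.2.1 + 2%:R ->
      [/\ anchor l i = anchor l j, (dj <= di.+1)%N &
        rj.2.1 <= ri.2.1 + 1 -> di != dj ->
        exists m : nat, ri.2.1 - anchor l i < (s.+1 + side * m)%:R /\
                        (s.+1 + side * m)%:R <= rj.2.1 - anchor l i]].
Proof.
move=> hs sl kl ij jl o ri rj di dj.
have ho : 1 <= o <= side%:R.
  by rewrite /o lerDr ler0n natr1 ler_nat.
have pl : path (@leT R) (-1, (0, 0)) l.
  case: l sl kl {jl ri rj di dj} => //= r l -> kl; rewrite andbT /leT /=.
  by have := kl r; rewrite inE eqxx => /(_ isT) h; apply/orP; left; lra.
have fr : all (fun r => r.1 != -1) l.
  by apply/allP => r /kl h; rewrite gt_eqF //; lra.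
have il : (i < size l)%N by apply: leq_trans (ltnW jl).
have [b [st dw da]] := walk_state 0%N (a := 0) (b := 0) z ho pl (or_intror fr) il.
rewrite -/ri -/(ids o l) -/di -/(anchor l i) in st dw da.
have iE : (i.+1 + (j - i.+1))%N = j by rewrite subnKC.
have jE : (j - i.+1 < size (drop i.+1 l))%N by rewrite size_drop; lia.
have pd : path (@leT R) (ri.1, (ri.2.1, ri.2.2)) (drop i.+1 l).
  have -> : (ri.1, (ri.2.1, ri.2.2)) = ri by case: (ri) => ? [].
  have := pl; rewrite -[l in path _ _ l](cat_take_drop i l) cat_path => /andP[_].
  by rewrite (drop_nth z il) /= => /andP[].
have := walk_later di z ho pd st jE; rewrite -dw -da !nth_drop iE.
rewrite -/(anchor l j) -/rj -/dj => -[h1 h2 h3].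
have lij : leT ri rj.
  have := order_path_min (@leT_trans R) pd; move/all_nthP => /(_ z _ jE).
  by rewrite nth_drop iE -/rj; case: (ri) => ? [].
have [st1 st2 st3 [k stk]] := st.
split=> //.
- move=> e; have [|e1 e2] := h2; first by rewrite e.
  split=> //; move: lij; rewrite /leT e1 ltxx eqxx /= => lij; apply/andP; split; lra.
- move=> e1 e2; have [|//|m1 [k' [m2 m3 m4]]] := h3; first by rewrite e1.
  split; first by rewrite m1.
    rewrite m2 -addn1 leq_add2l -ltnS -(ltr_nat R).
    (* Two slab ends passed would mean a distance above [side], hence above 2. *)
    have s2 := side_ge2 R.
    rewrite ltNge; apply/negP => k2.
    have := ler_wpM2l (ler0n R side) k2; lra.
  move=> e3 ne.
  have k1 : (1 <= k')%N by rewrite lt0n; apply: contra ne => /eqP k0; rewrite m2 k0 addn0.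
  have m4' : b + side%:R * k'%:R <= rj.2.1 + side%:R by [].
  have k1' : side%:R * 1 <= side%:R * k'%:R :> R by rewrite ler_wpM2l ?ler0n ?ler1n.
  exists k; rewrite natrD natrM -natr1 -/o.
  split; lra.
Qed.

Definition stage_id L (o : R) l r := nth 0%N (ids o (msort L l)) (index r (msort L l)).

Lemma stageE L (o : R) l : uniq l ->
  stage L o l = [seq ((stage_id L o l r)%:R, (r.2.2, r.2.1)) | r <- msort L l].
Proof.
move=> ul; apply: (@eq_from_nth _ z); first by rewrite size_relabel size_map.
move=> i; rewrite size_relabel => il; rewrite nth_relabel // (nth_map z) //.
by rewrite /stage_id index_uniq // (perm_uniq (perm_msort L l)).
Qed.

(** Rounding occurs in the analysis only; the program does not compute this number. *)
Definition stage_mark L l r : nat :=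
  Num.truncn (r.2.1 - anchor (msort L l) (index r (msort L l))).

(* [marked s c]: with offset [s], a cut may fall within distance 1 of a point at
   distance between [c] and [c + 1] from its anchor. *)
Definition marked (s c : nat) := (s.+1 == c %[mod side])%N || (s == c %[mod side])%N.

Lemma stage_props L l (s : nat) : (s < side)%N -> (size l <= 2 ^ L)%N -> uniq l ->
  (forall r, r \in l -> 0 <= r.1) ->
  let id := stage_id L (s%:R + 1) l in
  sorted leq [seq id r | r <- msort L l] /\
  {in l &, forall r q,
   [/\ id r = id q -> r.1 = q.1 /\ `|r.2.1 - q.2.1| <= side%:R,
       r.1 = q.1 -> `|r.2.1 - q.2.1| <= 2%:R -> (id r <= (id q).+1)%N &
       r.1 = q.1 -> `|r.2.1 - q.2.1| <= 1 -> id r != id q ->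
         marked s (stage_mark L l r)]}.
Proof.
move=> hs sl ul kl id; set l' := msort L l.
have pl : perm_eq l' l := perm_msort L l.
have ul' : uniq l' by rewrite (perm_uniq pl).
have sl' : sorted (@leT R) l' by apply: sorted_msort.
have kl' r : r \in l' -> 0 <= r.1 by rewrite (perm_mem pl) => /kl.
have pair i j ij jl := @ids_pair s l' i j hs sl' kl' ij jl.
split.
  apply: (@path_sorted _ _ 0%N); apply/(pathP 0%N) => i; rewrite size_map => il.
  case: i il => [|i] il //=.
  rewrite !(nth_map z) ?(ltnW il) // /id /stage_id !index_uniq ?(ltnW il) //.
  by have [] := pair i i.+1 (ltnSn i) il.
have main r q : r \in l' -> q \in l' -> (index r l' < index q l')%N ->
   [/\ id r = id q -> r.1 = q.1 /\ `|r.2.1 - q.2.1| <= side%:R,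
       r.1 = q.1 -> `|r.2.1 - q.2.1| <= 2%:R ->
         (id r <= (id q).+1)%N /\ (id q <= (id r).+1)%N &
       r.1 = q.1 -> `|r.2.1 - q.2.1| <= 1 -> id r != id q ->
         marked s (stage_mark L l r) /\ marked s (stage_mark L l q)].
  move=> rl ql rq; have := pair _ _ rq; rewrite index_mem ql => /(_ isT).
  rewrite !nth_index // -/(stage_id L (s%:R + 1) l r) -/(stage_id L (s%:R + 1) l q).
  rewrite -!/(id _) => -[h1 h2 h3 h4]; split.
  - move=> /h2[e1 e2]; split=> //; move: e2; rewrite ler_norml; lra.
  - move=> e1 e2; have [|g1 g2 _] := h4 e1.
      by move: e2; rewrite ler_norml; lra.
    by split=> //; apply: leq_trans h1 _.
  - move=> e1; rewrite ler_norml => e2 ne.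
    have [|g1 g2 g3] := h4 e1; first by lra.
    have [||m [m1 m2]] := g3 => //; first by lra.
    have u1 : 0 <= r.2.1 - anchor l' (index r l') by lra.
    have u2 : 0 <= q.2.1 - anchor l' (index q l') by rewrite -g1; apply: le_trans m2.
    (* The cut at [s + 1 + side * m] lies between two coordinates at most 1 apart, which fixes both
       integer parts: the lower one is one less. *)
    have t1 : stage_mark L l r = (s + side * m)%N.
      move: (m1) (m2); rewrite addSn -natr1 => m1' m2'.
      apply/eqP; rewrite /stage_mark truncn_eq // -/l' -natr1.
      by apply/andP; split; lra.
    have t2 : stage_mark L l q = (s.+1 + side * m)%N.
      apply/eqP; rewrite /stage_mark truncn_eq // -/l' -g1 -(natr1 (s.+1 + _)).
      by apply/andP; split; lra.
    have mE x : (x == x + side * m %[mod side])%N by rewrite addnC mulnC modnMDl.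
    by rewrite /marked t1 t2 !mE orbT.
move=> r q; rewrite -!(perm_mem pl) => rl ql.
case: (ltngtP (index r l') (index q l')) => h.
- have [h1 h2 h3] := main r q rl ql h; split=> //.
    by move=> e1 e2; have [] := h2 e1 e2.
  by move=> e1 e2 e3; have [] := h3 e1 e2 e3.
- have [h1 h2 h3] := main q r ql rl h; rewrite distrC eq_sym; split.
  + by move=> /esym/h1[-> ->].
  + by move=> /esym e1 e2; have [] := h2 e1 e2.
  + by move=> /esym e1 e2 e3; have [] := h3 e1 e2 e3.
- have -> : r = q by rewrite -(nth_index z rl) h nth_index.
  by rewrite subrr normr0 eqxx ler0n; split.
Qed.

(** Keys are sorted, so a key does not return after its run is closed; hence a block contains all
    points with its key. *)
Lemma runs_props (k : pt -> R) pk (Q ps : seq pt) :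
  (forall p, p \in Q -> k p = pk) ->
  path <=%R pk [seq k p | p <- ps] ->
  let Bs := runs pk Q [seq (k p, p) | p <- ps] in
  [/\ flatten Bs = Q ++ ps,
      forall B (u v : pt), B \in Bs -> u \in B -> v \in B -> k u = k v &
      forall B (u v : pt), B \in Bs -> u \in B -> v \in Q ++ ps -> k u = k v -> v \in B].
Proof.
elim: ps pk Q => [|p ps IH] pk Q hQ /=.
  move=> _; split; first by rewrite cats0.
  - by move=> B p q; rewrite inE => /eqP -> /hQ -> /hQ ->.
  - by move=> B p q; rewrite inE => /eqP -> _; rewrite cats0.
move=> /andP[le pp].
case: eqP => [e|ne].
  have [||h1 h2 h3] := IH pk (rcons Q p).
  - by move=> q; rewrite mem_rcons inE => /orP[/eqP ->|/hQ].
  - by rewrite -e.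
  by split=> //; [rewrite h1 cat_rcons | rewrite -cat_rcons].
have lt : pk < k p by rewrite lt_neqAle le andbT eq_sym; apply/eqP.
have [|h1 h2 h3] := IH (k p) [:: p] _ pp.
  by move=> q; rewrite inE => /eqP ->.
have big (q : pt) : q \in p :: ps -> pk < k q.
  rewrite inE => /orP[/eqP -> //|qp]; apply: lt_le_trans lt _.
  by have := order_path_min le_trans pp; move/allP; apply; apply: map_f.
split=> /=; first by rewrite h1.
- move=> B u v; rewrite inE => /orP[/eqP ->|]; last exact: h2.
  by move=> /hQ -> /hQ ->.
- move=> B u v; rewrite inE => /orP[/eqP ->|BI] uB.
    rewrite mem_cat => /orP[//|/big vb] e.
    by move: vb; rewrite -e (hQ u uB) ltxx.
  rewrite mem_cat => /orP[/hQ vQ|vp] e; last exact: h3 vp e.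
  have /big : u \in p :: ps by rewrite -[p :: ps]/([:: p] ++ ps) -h1; apply/flattenP; exists B.
  by rewrite e vQ ltxx.
Qed.

End StageTheory.

(** * Properties of the blocks *)

Section Grid.
Variable R : realType.
Notation pt := (R * R)%type.
Notation rc := (R * (R * R))%type.
Implicit Types (p q v : pt) (P : seq pt).

Definition within (w : R) p q := `|p.1 - q.1| <= w /\ `|p.2 - q.2| <= w.

Definition first_id L (s1 : nat) P p := stage_id L (s1%:R + 1) (keyed P) (0, p).
Definition first_rec L s1 P p : rc := ((first_id L s1 P p)%:R, (p.2, p.1)).
Definition first_stage L (s1 : nat) P := stage L (s1%:R + 1) (keyed P).
Definition block_id L (s1 s2 : nat) P p :=
  stage_id L (s2%:R + 1) (first_stage L s1 P) (first_rec L s1 P p).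
(** A colouring of the blocks by four colours. Numbers of nearby points differ by at most 1, in the
    second stage within one slab of the first, so two points of one disk with the same colour lie in
    the same block. *)
Definition parity L s1 s2 P p := (odd (first_id L s1 P p), odd (block_id L s1 s2 P p)).
Definition mark1 L P p := stage_mark L (keyed P) (0, p).
Definition mark2 L s1 P p := stage_mark L (first_stage L s1 P) (first_rec L s1 P p).

Lemma eq_of_parity (a b : nat) :
  (a <= b.+1)%N -> (b <= a.+1)%N -> odd a = odd b -> a = b.
Proof. lia. Qed.

(** [block_id] alone identifies a block: slab numbers are not reset, and the second stage opens a
    new slab at each new key, so equal numbers there force equal slabs of the first stage. *)
Lemma grid L P s1 s2 : uniq P -> (size P <= 2 ^ L)%N -> in_range s1 s2 ->
  let Bs := blocks L s1 s2 P in let blk := block_id L s1 s2 P in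
  [/\ perm_eq (flatten Bs) P,
      forall B, B \in Bs -> spread side%:R B,
      forall B p q, B \in Bs -> p \in B -> q \in P -> (q \in B) = (blk p == blk q),
      {in P &, forall p q, within 2%:R p q ->
        parity L s1 s2 P p = parity L s1 s2 P q -> blk p = blk q} &
      {in P &, forall p q, within 1 p q -> blk p != blk q ->
        marked s1 (mark1 L P p) || marked s2 (mark2 L s1 P p)}].
Proof.
move=> uP sP /andP[r1 r2] Bs blk.
have ul0 : uniq (keyed P) by rewrite map_inj_uniq // => p q [].
have sl0 : (size (keyed P) <= 2 ^ L)%N by rewrite size_map.
have kl0 r : r \in keyed P -> 0 <= r.1 by move=> /mapP[p _ ->].
have [_ h1] := stage_props r1 sl0 ul0 kl0.
have inP p : p \in P -> (0, p) \in keyed P by move=> pP; apply/mapP; exists p.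
set l0 := msort L (keyed P).
have pl0 : perm_eq l0 (keyed P) := perm_msort L (keyed P).
pose ps0 := [seq r.2 | r <- l0].
have pps0 : perm_eq ps0 P.
  apply: perm_trans (perm_map _ pl0) _.
  by rewrite /keyed -map_comp map_id_in.
set l1 := first_stage L s1 P.
have l1E : l1 = [seq first_rec L s1 P p | p <- ps0].
  rewrite /l1 /first_stage stageE // -/l0 /ps0 -map_comp.
  apply/eq_in_map => r; rewrite (perm_mem pl0) => /mapP[p _ ->] //.
have ginj : injective (first_rec L s1 P).
  by move=> [a b] [c d] [_ -> ->].
have ul1 : uniq l1 by rewrite l1E map_inj_uniq // (perm_uniq pps0).
have sl1 : (size l1 <= 2 ^ L)%N by rewrite l1E size_map (perm_size pps0).
have kl1 r : r \in l1 -> 0 <= r.1 by rewrite l1E => /mapP[p _ ->] /=; rewrite ler0n.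
have [so2 h2] := stage_props r2 sl1 ul1 kl1.
have inP1 p : p \in P -> first_rec L s1 P p \in l1.
  by rewrite -(perm_mem pps0) l1E => pp; apply: map_f.
set l1' := msort L l1 in so2.
have pl1 : perm_eq l1' l1 := perm_msort L l1.
pose ps2 := [seq (r.2.2, r.2.1) | r <- l1'].
have l1'E : l1' = [seq first_rec L s1 P p | p <- ps2].
  rewrite /ps2 -map_comp -[LHS]map_id; apply/eq_in_map => r.
  by rewrite (perm_mem pl1) l1E => /mapP[[a b] _ ->].
have pps2 : perm_eq ps2 P.
  apply: perm_trans (perm_map _ pl1) _; rewrite l1E -map_comp.
  by rewrite map_id_in // => -[].
have l2E : stage L (s2%:R + 1) l1 = [seq ((blk p)%:R, p) | p <- ps2].
  rewrite stageE // -/l1' l1'E -map_comp; apply/eq_in_map => -[a b] _ //.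
have BsE : Bs = runs (-1) [::] [seq ((blk p)%:R, p) | p <- ps2].
  by rewrite /Bs /blocks -/(first_stage L s1 P) -/l1 l2E.
have srt : path <=%R (-1 : R) [seq (blk p)%:R | p <- ps2].
  have -> : [seq (blk p)%:R | p <- ps2] = [seq (n%:R : R) | n <- [seq blk p | p <- ps2]].
    by rewrite -map_comp.
  have spo2 : sorted leq [seq blk p | p <- ps2].
    by move: so2; rewrite l1'E -map_comp.
  case: [seq blk p | p <- ps2] spo2 => //= n ns pn; apply/andP; split.
    by apply: le_trans (ler0n R n); lra.
  by rewrite path_map; apply: sub_path pn => a b; rewrite /= ler_nat.
have [|f1 f2 f3] := @runs_props R (fun p => (blk p)%:R) (-1) [::] ps2 _ srt; first by [].
rewrite -BsE cat0s in f1 f2 f3.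
have memB B p : B \in Bs -> p \in B -> p \in P.
  by move=> hB hp; rewrite -(perm_mem pps2) -f1; apply/flattenP; exists B.
have blkE B p q : B \in Bs -> p \in B -> q \in B -> blk p = blk q.
  by move=> hB hp hq; apply/eqP; rewrite -(eqr_nat R); apply/eqP; apply: (f2 B).
have col p q : p \in P -> q \in P -> blk p = blk q ->
    first_id L s1 P p = first_id L s1 P q /\ `|p.2 - q.2| <= side%:R.
  move=> pP qP e; have [g1 _ _] := h2 _ _ (inP1 p pP) (inP1 q qP).
  have [e1 e2] := g1 e; split; last exact: e2.
  by apply/eqP; rewrite -(eqr_nat R); apply/eqP.
split.
- by rewrite f1.
- move=> B hB p q hp hq; have pP := memB B p hB hp; have qP := memB B q hB hq.
  have [e1 e2] := col p q pP qP (blkE B p q hB hp hq).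
  have [g1 _ _] := h1 _ _ (inP p pP) (inP q qP).
  by have [_ g] := g1 e1.
- move=> B p q hB hp qP; apply/idP/eqP => [hq|e]; first exact: (blkE B).
  apply: (f3 B p q hB hp); last by rewrite e.
  by rewrite (perm_mem pps2).
- move=> p q pP qP [n1 n2] [po1 po2].
  have [_ g1 _] := h1 _ _ (inP p pP) (inP q qP).
  have [_ g1' _] := h1 _ _ (inP q qP) (inP p pP).
  have [_ g2 _] := h2 _ _ (inP1 p pP) (inP1 q qP).
  have [_ g2' _] := h2 _ _ (inP1 q qP) (inP1 p pP).
  have n1' : `|q.1 - p.1| <= 2%:R by rewrite distrC; exact: n1.
  have n2' : `|q.2 - p.2| <= 2%:R by rewrite distrC; exact: n2.
  have ec : first_id L s1 P p = first_id L s1 P q.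
    exact: (eq_of_parity (g1 erefl n1) (g1' erefl n1') po1).
  have ec' := congr1 (fun n : nat => (n%:R : R)) ec.
  exact: (eq_of_parity (g2 ec' n2) (g2' (esym ec') n2') po2).
- move=> p q pP qP [n1 n2] ne.
  have [_ _ g1] := h1 _ _ (inP p pP) (inP q qP).
  have [ec|nc] := eqVneq (first_id L s1 P p) (first_id L s1 P q); last first.
    by rewrite (g1 erefl n1 nc).
  have [_ _ g2] := h2 _ _ (inP1 p pP) (inP1 q qP).
  by rewrite (g2 (congr1 (fun n : nat => (n%:R : R)) ec) n2 ne) orbT.
Qed.

End Grid.

(** * Size of a solution *)

Section Flatten.
Variable T : eqType.
Implicit Types (Bs : seq (seq T)).

Lemma uniq_flatten_map Bs (f : seq T -> seq T) : uniq (flatten Bs) ->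
  (forall B, B \in Bs -> uniq (f B) /\ {subset f B <= B}) ->
  uniq (flatten [seq f B | B <- Bs]).
Proof.
elim: Bs => //= B Bs IH; rewrite !cat_uniq => /and3P[_ dis uB] hf.
have [u1 s1] := hf B (mem_head _ _).
rewrite u1 IH // ?andbT; last by move=> C hC; apply: hf; rewrite inE hC orbT.
apply/hasPn => x /flattenP[l /mapP[C hC ->] xC].
have hC' : C \in B :: Bs by rewrite inE hC orbT.
have [_ s2] := hf C hC'; move/hasPn: dis => dis.
apply/negP => /s1 xB.
have hx : x \in flatten Bs by apply/flattenP; exists C => //; apply: s2.
by have := dis x hx; rewrite /= xB.
Qed.

Lemma flatten_disjoint Bs B C x : uniq (flatten Bs) -> B \in Bs -> C \in Bs ->
  x \in B -> x \in C -> B = C.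
Proof.
elim: Bs => //= D Bs IH; rewrite cat_uniq => /and3P[_ /hasPn dis uB].
have no E : E \in Bs -> x \in E -> x \in D -> False.
  move=> hE xE xD; have hx : x \in flatten Bs by apply/flattenP; exists E.
  by have := dis x hx; rewrite /= xD.
rewrite !inE => /orP[/eqP ->|hB] /orP[/eqP ->|hC] // xB xC.
- by case: (no C).
- by case: (no B).
- exact: IH.
Qed.

Lemma sum_mem_flatten Bs x : uniq (flatten Bs) ->
  (\sum_(B <- Bs) (x \in B) <= 1)%N.
Proof.
move=> u; apply: (leq_trans (n := count_mem x (flatten Bs))); last first.
  by rewrite count_uniq_mem // leq_b1.
rewrite count_flatten sumnE big_map; apply: leq_sum => B _.
by case: (boolP (x \in B)) => //; rewrite -has_pred1 has_count.
Qed.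

End Flatten.

Section Counting.
Variable R : realType.
Notation pt := (R * R)%type.
Implicit Types (p q v x : pt) (P B C S : seq pt).

Lemma pick_filter B (T : seq pt) : exists2 b, size b = size (reps B) &
  pick B b = foldl (add 0) [::] [seq r <- reps B | r \in T].
Proof.
exists [seq r \in T | r <- reps B]; first by rewrite size_map.
by rewrite /pick -filter_mask.
Qed.

Lemma sqr_sum_le1 (a b : R) : a * a + b * b <= 1 -> `|a| <= 1.
Proof.
have := sqr_ge0 b; rewrite expr2 => h1 h2; rewrite ler_norml; apply/andP; split.
  rewrite leNgt; apply/negP => c.
  have : 0 < (-1 - a) * (1 - a) by apply: mulr_gt0; lra.
  by lra.
rewrite leNgt; apply/negP => c.
have : 0 < (a - 1) * (a + 1) by apply: mulr_gt0; lra.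
by lra.
Qed.

Lemma d2_within v x : d2 v x <= 1 -> within 1 x v.
Proof.
rewrite d2C /d2 => h; split; first exact: sqr_sum_le1 h.
by rewrite addrC in h; exact: sqr_sum_le1 h.
Qed.

Lemma within_trans v x y : within 1 x v -> within 1 y v -> within 2%:R x y.
Proof. by move=> [] + + []; rewrite !ler_norml => *; split; rewrite ler_norml; lra. Qed.

Section Blocks.
Variables (L s1 s2 : nat) (P S C : seq pt).
Hypotheses (uP : uniq P) (sP : (size P <= 2 ^ L)%N) (rg : in_range s1 s2).
Hypotheses (SP : {subset S <= P}).
Hypothesis Sdom : forall p, p \in P -> has (fun v => d2 v p <= 1) S.
Hypothesis solC : solution (blocks L s1 s2 P) C.

(* The points whose neighbourhood may meet several blocks. *)
Definition cut v := marked s1 (mark1 L P v) || marked s2 (mark2 L s1 P v).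

(** [X B] is the selection made of the pairs of the uncut points of [S] in [B], and [m B] is what
    the greedy extension adds to it. As [S] dominates, every added point can be charged to a point
    of [S], possibly of another block. *)
Lemma solution_size : (size C <= 4 * size S + 100 * count cut S)%N.
Proof.
have [uBs sprd inB par good] := grid uP sP rg; have sol := solC.
set Bs := blocks L s1 s2 P in sol uBs sprd inB *.
set blk := block_id L s1 s2 P in inB par good *.
have uF : uniq (flatten Bs) by rewrite (perm_uniq uBs).
have BP B p : B \in Bs -> p \in B -> p \in P.
  by move=> hB hp; rewrite -(perm_mem uBs); apply/flattenP; exists B.
have uB B : B \in Bs -> uniq B.
  move=> hB; have := uF; rewrite (perm_uniq (perm_flatten (perm_to_rem hB))) /= cat_uniq.
  by case/andP.
pose Rel (w : seq pt * pt) (y : pt * pt) := w.2 \in w.1 ->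
    [/\ y.1 \in reps w.1, y.2 \in reps w.1, d2 y.1 w.2 <= 1 / 400, d2 y.2 w.2 <= 1 / 400 &
      (y.1.1 - w.2.1) * (y.2.1 - w.2.1) + (y.1.2 - w.2.2) * (y.2.2 - w.2.2) <= 0].
have [rep hrep] : {rep & forall w, Rel w (rep w)}.
  apply: choice => -[B v]; rewrite /Rel /=.
  case: (boolP (v \in B)) => vB; last by exists (0, 0).
  by have [r [r' h]] := rep_pair vB; exists (r, r').
pose sel B v := (v \in B) && ~~ cut v.
pose T B := flatten [seq [:: (rep (B, v)).1; (rep (B, v)).2] | v <- S & sel B v].
pose X B := foldl (add 0) [::] [seq r <- reps B | r \in T B].
have sX B : (size (X B) <= 2 * count (sel B) S)%N.
  have -> : (2 * count (sel B) S)%N = size (T B).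
    rewrite size_flatten /shape -map_comp sumnE big_map (eq_bigr (fun=> 2%N)) //.
    by rewrite big_const_seq count_predT iter_addn_0 size_filter mulnC.
  apply: uniq_leq_size; first by apply: foldl_add_uniq.
  by move=> x /foldl_add_mem; rewrite in_nil mem_filter => /andP[].
have memX B r : r \in reps B -> r \in T B -> r \in X B.
  move=> h1 h2; have /hasP[q qX] : has (fun p => d2 p r <= 0) (X B).
    by apply: foldl_add_has => //; rewrite mem_filter h2.
  by rewrite d2_eq0 => /eqP <-.
pose m B := drop (size (X B)) (grow B (X B)).
have mP B : [/\ grow B (X B) = X B ++ m B, uniq (m B), {subset m B <= B},
      {in m B &, forall p q, p != q -> 1 < d2 p q} &
      {in X B & m B, forall p q, 1 < d2 p q}].
  have [m' [e h1 h2 h3 h4]] := foldl_add_split (X B) B (ler01 : 0 <= 1 :> R).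
  have -> : m B = m' by rewrite /m /grow e drop_size_cat.
  by split.
have [zs [zB zC zbest]] := sol.
pose near v x := d2 v x <= 1.
have sC : (size C <= \sum_(B <- Bs) (2 * count (sel B) S + \sum_(v <- S) count (near v) (m B)))%N.
  rewrite zC -zB size_flatten /shape sumnE !big_map.
  rewrite big_seq [X in (_ <= X)%N]big_seq; apply: leq_sum => w wz.
  have [_ hb] := zbest w wz; have [b sb pb] := pick_filter w.1 (T w.1).
  apply: leq_trans (hb b sb) _; rewrite pb -/(X w.1).
  have [-> _ sm _ _] := mP w.1; rewrite size_cat leq_add //.
  have wB : w.1 \in Bs by rewrite -zB map_f.
  have -> : size (m w.1) = \sum_(x <- m w.1) 1 by rewrite sum1_size.
  under [X in (_ <= X)%N]eq_bigr do rewrite -sum1_count big_mkcond.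
  rewrite exchange_big /= big_seq [X in (_ <= X)%N]big_seq; apply: leq_sum => x xm.
  have /hasP[v vS nv] := Sdom (BP _ _ wB (sm x xm)).
  by rewrite (big_rem v vS) /= /near nv leq_addr.
apply: leq_trans sC _; rewrite big_split /=.
have part1 : (\sum_(B <- Bs) 2 * count (sel B) S <= 2 * count (predC cut) S)%N.
  rewrite -big_distrr /= leq_mul2l /=.
  under eq_bigr do rewrite -sum1_count big_mkcond.
  rewrite exchange_big -sum1_count [X in (_ <= X)%N]big_mkcond /=; apply: leq_sum => v _.
  rewrite /sel /=; case: (cut v) => /=; last first.
    apply: leq_trans (sum_mem_flatten v uF); apply: leq_sum => B _.
    by rewrite andbT; case: (v \in B).
  by rewrite big1 // => B _; rewrite andbF.
have part2 v : v \in S -> (\sum_(B <- Bs) count (near v) (m B) <= if cut v then 100 else 2)%N.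
  move=> vS; case: (boolP (cut v)) => cv; last first.
    apply: (leq_trans (n := \sum_(B <- Bs) 2 * (v \in B))%N); last first.
      by rewrite -big_distrr /= -[X in (_ <= X)%N]muln1 leq_mul2l sum_mem_flatten.
    rewrite big_seq [X in (_ <= X)%N]big_seq; apply: leq_sum => B hB.
    have [_ um sm fm Xm] := mP B.
    (* Only the block of an uncut [v] contributes: a point near [v] in another block would make [v]
       cut. *)
    case: (boolP (v \in B)) => vB; last first.
      rewrite leqn0 -leqn0 leqNgt -has_count; apply/hasPn => x xm; apply/negP => nx.
      move/negP: vB; apply.
      have xB := sm x xm; have xP := BP _ _ hB xB; rewrite (inB B x v hB xB (SP vS)).
      apply: contraNT cv => ne; apply: good (SP vS) xP _ _; last by rewrite eq_sym.
      by have [n1 n2] := d2_within nx; split; rewrite distrC.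
    rewrite muln1 leqNgt; apply/negP; rewrite -size_filter => c3.
    have uf : uniq [seq x <- m B | near v x] by rewrite filter_uniq.
    have mf x : x \in [seq x <- m B | near v x] -> x \in m B /\ d2 x v <= 1.
      by rewrite mem_filter /near d2C => /andP[].
    case: [seq x <- m B | near v x] c3 uf mf => [|e1 [|e2 [|e3 l]]] //= _.
    rewrite !inE !negb_or => /and4P[/and3P[n12 n13 _] /andP[n23 _] _ _] mf.
    have [m1 d1] := mf e1 (mem_head _ _).
    have [m2 d2'] : e2 \in m B /\ d2 e2 v <= 1 by apply: mf; rewrite !inE eqxx orbT.
    have [m3 d3] : e3 \in m B /\ d2 e3 v <= 1 by apply: mf; rewrite !inE eqxx !orbT.
    have [g1 g2 g3 g4 g5] := hrep (B, v) vB.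
    have inT r : r \in [:: (rep (B, v)).1; (rep (B, v)).2] -> r \in T B.
      move=> hr; apply/flattenP; exists [:: (rep (B, v)).1; (rep (B, v)).2] => //.
      by apply/mapP; exists v; rewrite // mem_filter /sel vB cv.
    have r1 : (rep (B, v)).1 \in X B by apply: memX => //; apply: inT; rewrite inE eqxx.
    have r2 : (rep (B, v)).2 \in X B by apply: memX => //; apply: inT; rewrite !inE eqxx orbT.
    exact: (opposed_pair g3 g4 g5 d1 d2' d3 (Xm _ _ r1 m1) (Xm _ _ r1 m2) (Xm _ _ r1 m3)
      (Xm _ _ r2 m1) (Xm _ _ r2 m2) (Xm _ _ r2 m3) (fm _ _ m1 m2 n12) (fm _ _ m1 m3 n13)
      (fm _ _ m2 m3 n23)).
  pose F := flatten [seq [seq x <- m B | near v x] | B <- Bs].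
  have -> : (\sum_(B <- Bs) count (near v) (m B))%N = size F.
    by rewrite size_flatten /shape -map_comp sumnE big_map; apply: eq_bigr => B _; rewrite /= size_filter.
  have uFF : uniq F.
    apply: uniq_flatten_map => // B hB; have [_ um sm _ _] := mP B.
    by rewrite filter_uniq //; split=> // x; rewrite mem_filter => /andP[_ /sm].
  have memF x : x \in F -> exists2 B, B \in Bs & x \in m B /\ near v x.
    by move=> /flattenP[l /mapP[B hB ->]]; rewrite mem_filter => /andP[nx xm]; exists B.
  (* Four parity classes and five cells of side [1 / 2] per axis: [4 * 5 * 5 = 100]. Five, because
     the closed square of side 2 can reach a fifth cell with its boundary. *)
  have := @packing R (bool * bool)%type (parity L s1 s2 P) 1 (1 / 2) 1 5 v F.
  rewrite card_prod card_bool; apply; [lra | rewrite expr2; lra | lra | exact: uFF | |].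
  - by move=> x /memF[B _ [_ nx]]; apply: d2_within.
  - move=> x y /memF[B hB [xm nx]] /memF[D hD [ym ny]] xy pxy.
    have [_ _ smB fm _] := mP B; have [_ _ smD _ _] := mP D.
    have xB := smB x xm; have yD := smD y ym.
    (* The blocks are extended separately, so added points of different blocks may be close to each
       other; equal parity puts both in one block, where they are far apart. *)
    have e : blk x = blk y.
      apply: (par x y (BP _ _ hB xB) (BP _ _ hD yD) _ pxy).
      exact: within_trans (d2_within nx) (d2_within ny).
    have yB : y \in B by rewrite (inB B x y hB xB (BP _ _ hD yD)) e.
    have eD := flatten_disjoint uF hB hD yB yD.
    have ymB : y \in m B by rewrite eD.
    exact: fm xm ymB xy.
rewrite exchange_big /=.
have : (\sum_(v <- S) \sum_(B <- Bs) count (near v) (m B) <= \sum_(v <- S) (2 + 98 * cut v))%N.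
  rewrite big_seq [X in (_ <= X)%N]big_seq; apply: leq_sum => v /part2.
  by case: (cut v).
move/(leq_add part1) => h; apply: leq_trans h _.
rewrite big_split /= -big_distrr /= big_const_seq count_predT iter_addn_0.
have -> : (\sum_(v <- S) cut v)%N = count cut S.
  by rewrite -sum1_count [RHS]big_mkcond /=; apply: eq_bigr => v _; case: (cut v).
by have := count_predC cut S; lia.
Qed.

End Blocks.

End Counting.

(** * Averaging over the shifts *)

Local Open Scope classical_set_scope.
Local Open Scope ring_scope.

Section Averaging.

Lemma sum_pred_le1 n (a : pred nat) :
  (forall s t, (s < n)%N -> (t < n)%N -> a s -> a t -> s = t) ->
  (\sum_(s < n) a s <= 1)%N.
Proof.
move=> inj.
have [/existsP[s as_]|/existsPn h] := boolP [exists s : 'I_n, a s].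
  rewrite (bigD1 s) //= as_ big1 // => t ts; case: (boolP (a t)) => // at_.
  by case/eqP: ts; apply/val_inj; apply: (inj t s (ltn_ord t) (ltn_ord s)).
by rewrite big1 // => s _; rewrite (negPf (h s)).
Qed.

Lemma sum_eqmod k c : (\sum_(s < k) (s == c %[mod k])%N <= 1)%N.
Proof.
apply: (@sum_pred_le1 k (fun s => s == c %[mod k])%N) => s t hs ht /eqP e1 /eqP e2.
by move: e1; rewrite -e2 !modn_small.
Qed.

Lemma sum_eqmodS k c : (\sum_(s < k) (s.+1 == c %[mod k])%N <= 1)%N.
Proof.
apply: (@sum_pred_le1 k (fun s => s.+1 == c %[mod k])%N) => s t hs ht /eqP e1 /eqP e2.
have : (s + 1 == t + 1 %[mod k])%N by rewrite !addn1 e1 e2.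
by rewrite eqn_modDr !modn_small // => /eqP.
Qed.

(** Each of the two congruences has at most one solution below [side]. *)
Lemma sum_marked c : (\sum_(s < side) marked s c <= 2)%N.
Proof.
apply: leq_trans (leq_add (sum_eqmodS side c) (sum_eqmod side c)).
rewrite -big_split /=; apply: leq_sum => s _; rewrite /marked.
by case: (s.+1 == c %[mod side])%N; case: (nat_of_ord s == c %[mod side])%N.
Qed.

Lemma sum_ord_le n (F : nat -> nat) m :
  (forall i, (i < n)%N -> (F i <= m)%N) -> (\sum_(i < n) F i <= n * m)%N.
Proof.
move=> h; rewrite -[n in (n * m)%N]card_ord -sum_nat_const.
by apply: leq_sum => i _; apply: h.
Qed.

Lemma sum_ord_ge n (F : nat -> nat) m :
  (forall i, (i < n)%N -> (m <= F i)%N) -> (n * m <= \sum_(i < n) F i)%N.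
Proof.
move=> h; rewrite -[n in (n * m)%N]card_ord -sum_nat_const.
by apply: leq_sum => i _; apply: h.
Qed.

(** Otherwise summing over all [side * side] pairs of shifts gives a contradiction. [mark1] depends
    on no shift and [mark2] on [s1] only, so each axis contributes at most [2 * side * size S] to
    the sum. *)
Lemma few_cuts (R : realType) L (P S : seq (R * R)) :
  exists s1 s2, in_range s1 s2 /\
    (side * count (cut L s1 s2 P) S <= 4 * size S)%N.
Proof.
have s0 : (0 < side)%N by rewrite /side -lock.
apply: contrapT => h.
have big s1 s2 : (s1 < side)%N -> (s2 < side)%N ->
    (4 * size S + 1 <= side * count (cut L s1 s2 P) S)%N.
  move=> h1 h2; rewrite addn1 ltnNge; apply/negP => h3; apply: h.
  by exists s1, s2; rewrite /in_range h1 h2.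
have le1 : (\sum_(s1 < side) \sum_(s2 < side) count (cut L s1 s2 P) S <=
   4 * size S * side)%N.
  have split_cut s1 s2 : (count (cut L s1 s2 P) S <=
      \sum_(v <- S) marked s1 (mark1 L P v) + \sum_(v <- S) marked s2 (mark2 L s1 P v))%N.
    rewrite -big_split /= -sum1_count big_mkcond; apply: leq_sum => v _.
    by rewrite /cut; do 2!case: marked.
  apply: (leq_trans (n := \sum_(s1 < side) \sum_(s2 < side)
      (\sum_(v <- S) marked s1 (mark1 L P v) + \sum_(v <- S) marked s2 (mark2 L s1 P v))))%N.
    by apply: leq_sum => s1 _; apply: leq_sum => s2 _; apply: split_cut.
  under eq_bigr do rewrite big_split /=.
  rewrite big_split /=.
  have two (f : nat -> nat -> R * R -> nat) s1 :
      (\sum_(s2 < side) \sum_(v <- S) marked s2 (f s1 L v) <= 2 * size S)%N.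
    rewrite exchange_big /=; apply: (leq_trans (n := \sum_(v <- S) 2)).
      by apply: leq_sum => v _; apply: sum_marked.
    by rewrite big_const_seq count_predT iter_addn_0.
  have -> : (4 * size S * side = side * (2 * size S) + side * (2 * size S))%N.
    by rewrite -mulnDr mulnC -mulnDl.
  apply: leq_add.
    rewrite exchange_big /=.
    apply: (sum_ord_le (F := fun s2 => \sum_(s1 < side) \sum_(v <- S) marked s1 (mark1 L P v))%N).
    by move=> s2 _; apply: (two (fun _ L v => mark1 L P v) 0%N).
  apply: (sum_ord_le (F := fun s1 => \sum_(s2 < side) \sum_(v <- S) marked s2 (mark2 L s1 P v))%N).
  by move=> s1 _; apply: (two (fun s1 L v => mark2 L s1 P v) s1).
have le2 : (side * (side * (4 * size S + 1)) <=
   side * \sum_(s1 < side) \sum_(s2 < side) count (cut L s1 s2 P) S)%N.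
  rewrite big_distrr /=.
  apply: (sum_ord_ge (F := fun s1 => side * \sum_(s2 < side) count (cut L s1 s2 P) S)%N).
  move=> s1 h1; rewrite big_distrr /=.
  apply: (sum_ord_ge (F := fun s2 => side * count (cut L s1 s2 P) S)%N).
  by move=> s2 h2; apply: big.
move: le2; rewrite leq_mul2l gtn_eqF //= => le2.
have := leq_trans le2 le1; rewrite [X in (_ <= X)%N]mulnC leq_mul2l gtn_eqF //= addn1.
by rewrite ltnn.
Qed.

End Averaging.

(** * Input and output format, running time and conclusion *)

Section Output.
Variable R : realType.
Notation pt := (R * R)%type.
Implicit Types (P C S : seq pt).

Lemma solution_valid Bs P C : perm_eq (flatten Bs) P -> uniq P ->
  solution Bs C -> valid P C.
Proof.
move=> pP uP [zs [eB -> hz]].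
have vz w : w \in zs -> valid w.1 w.2 by move=> /hz[].
have sub : {subset flatten (unzip2 zs) <= flatten Bs}.
  move=> x /flattenP[l /mapP[w wz ->] xw]; apply/flattenP.
  by exists w.1; [rewrite -eB; apply: map_f | have [_ s _] := vz w wz; apply: s].
split.
- have : uniq (flatten (unzip1 zs)) by rewrite eB (perm_uniq pP).
  clear -vz; elim: zs vz => //= w zs IH vz; rewrite !cat_uniq => /and3P[_ /hasPn dis u].
  have [u1 sw _] := vz w (mem_head _ _).
  rewrite u1 IH // ?andbT; last by move=> w' hw'; apply: vz; rewrite inE hw' orbT.
  apply/hasPn => x /flattenP[l /mapP[w' wz ->] xw]; apply/negP => /sw xw1.
  have hx : x \in flatten (unzip1 zs).
    apply/flattenP; exists w'.1; first exact: map_f.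
    by have [|_ s _] := vz w'; [rewrite inE wz orbT | apply: s].
  by have := dis x hx; rewrite /= xw1.
- by move=> x /sub; rewrite (perm_mem pP).
- move=> q; rewrite -(perm_mem pP) -eB => /flattenP[l /mapP[w wz ->] qw].
  have [_ _ d] := vz w wz; have /hasP[p pw h] := d q qw.
  by apply/hasP; exists p => //; apply/flattenP; exists w.2 => //; apply: map_f.
Qed.

Lemma edist_le1 (p q : pt) : (Defs.edist p q <= 1) = (d2 p q <= 1).
Proof. by rewrite /Defs.edist -[X in _ <= X]sqrtr1 ler_sqrt ?ler01 // /d2 !expr2. Qed.

Lemma size_coords C : size (coords C) = (size C + size C)%N.
Proof. by elim: C => //= p C; rewrite /coords /= => ->; rewrite addSn addnS. Qed.

Lemma nth_coords C i : (i < size C)%N ->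
  (nth 0 (coords C) (i + i)%N, nth 0 (coords C) (i + i).+1) = nth (0, 0) C i.
Proof.
elim: C i => // -[a b] C IH [|i] // ic.
by rewrite (_ : (i.+1 + i.+1)%N = (i + i).+2) ?addSn ?addnS //= -IH.
Qed.

Lemma coords_mkseq C :
  mkseq (fun i => (nth 0 (coords C) (i + i)%N, nth 0 (coords C) (i + i).+1)) (size C) = C.
Proof.
apply: (@eq_from_nth _ (0, 0)); rewrite size_mkseq // => i ic.
by rewrite nth_mkseq // nth_coords.
Qed.

(** The first instruction stores [2 n], the number of input cells, in register 2, where the compiled
    code expects it. *)
Definition algorithm : program := Plus 2 0 0 :: compile 1 main ++ [:: Halt].

Definition start C : st R :=
  State (fun i => if i == 0%N then size C else 0%N) (fun=> 0) (fun _ _ => 0)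
    (nth 0 (coords C)).

Lemma algorithm_run C : let B := (size C + size C)%N in
  exists t g, [/\ halts_in algorithm (input C) t g,
    (t <= (time B main (start C)).+1)%N & repr B (exec B main (start C)) g].
Proof.
move=> B; rewrite execE timeE.
pose f := set_reg (input C) 2 ((size C)%:R + (size C)%:R : R).
have rep : repr B (start C) f.
  split=> //=.
  - move=> i; rewrite /upd /= nr2 -[0%N]/(nr 0) nr_nr.
    by case: eqP => // _; rewrite mulr0n.
  - by move=> x; rewrite /upd /= vr2 -[0%N]/(nr 0) vr_nr.
  - by rewrite /upd /= natrD.
  (* Cells past the coordinates read the default 0, which is the initial content of the arrays. *)
  - by move=> a i ha; rewrite nth_default // size_coords /B; lia.
have wfm : wf main by [].
(* [main] is generalized, so that its code is not unfolded below. *)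
rewrite /algorithm; move: main wfm => q wfq; set Q := compile 1 q.
have code : code_at (Plus 2 0 0 :: Q ++ [:: Halt]) 1 Q.
  move=> i x hx; rewrite add1n -[onth _ _]/(onth (Q ++ [:: Halt]) i) onth_cat.
  by case: ltnP => // hi; move: hx; rewrite onth_default.
have [g [r1 rg pg]] := compile_correct (f := f) wfq code rep.
have s1 : step (Plus 2 0 0 :: Q ++ [:: Halt]) (input C) = Some f by [].
have [t ht et] := reach_step s1 r1.
exists t, g; split=> //; split=> //.
by rewrite pg add1n -[onth _ _]/(onth (Q ++ [:: Halt]) (size Q)) onth_cat ltnn subnn.
Qed.

(** For [n >= 2] with integer logarithm [t], [n + 1 <= 2 n] and [t + 2 <= 3 t] give the factor 6,
    and [t * ln 2 <= ln n]. *)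
Lemma nlogn (K : nat) :
  (fun n : nat => (K * (n.+1 * (trunc_log 2 n).+2) + 1)%:R : R^o) =O_\oo
  (fun n : nat => n%:R * ln (n%:R : R) : R^o).
Proof.
apply/eqO_exP.
have l2 : 0 < ln (2%:R : R) by rewrite ln_gt0 // ltr1n.
exists ((6 * K + 1)%:R / ln 2%:R); first by rewrite divr_gt0 // ltr0n addn1.
near=> n.
have n2 : (2 <= n)%N by near: n; exact: nbhs_infty_ge.
set t := trunc_log 2 n.
have t1 : (1 <= t)%N by rewrite /t trunc_log_max.
have ln_n : t%:R * ln (2%:R : R) <= ln (n%:R : R).
  rewrite mulrC mulr_natr -lnXn ?ltr0n // ler_ln ?posrE ?exprn_gt0 ?ltr0n //; last by lia.
  by rewrite -natrX ler_nat trunc_logP //; lia.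
rewrite !ger0_norm ?ler0n //; last first.
  by rewrite mulr_ge0 ?ler0n // ln_ge0 // ler1n; lia.
apply: (le_trans (y := ((6 * K + 1) * (n * t))%:R)).
  rewrite ler_nat; have h : (n.+1 * t.+2 <= 6 * (n * t))%N.
    by apply: (leq_trans (n := (2 * n) * (3 * t))); [rewrite leq_mul; lia | lia].
  have := leq_mul (leqnn K) h; have : (1 <= n * t)%N by rewrite muln_gt0 t1 andbT; lia.
  by rewrite mulnDl mul1n; lia.
rewrite natrM natrM -mulrA ler_wpM2l ?ler0n // mulrCA ler_wpM2l ?ler0n //.
by rewrite mulrC ler_pdivlMr.
Unshelve. all: by end_near. Qed.


Lemma grid_good G : (forall Q, uniq Q -> spread (side%:R : R) Q -> good_block G Q) ->
  forall L s1 s2 P Q, uniq P -> (size P <= 2 ^ L)%N -> in_range s1 s2 ->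
  Q \in blocks L s1 s2 P -> good_block G Q.
Proof.
move=> hG L s1 s2 P Q uP sP r hQ; have [pP sB _ _ _] := grid uP sP r.
apply: hG; last exact: sB.
have : uniq (flatten (blocks L s1 s2 P)) by rewrite (perm_uniq pP).
elim: (blocks L s1 s2 P) hQ => //= B Bs IH; rewrite inE cat_uniq.
by case: eqP => [-> _ /andP[]|_ /= h /and3P[_ _]] //; apply: IH.
Qed.

Lemma dominatingP (P D : {fset pt}) : dominating (udg P) D <->
  {subset D <= P} /\ forall p, p \in P -> exists2 v, v \in D & d2 v p <= 1.
Proof.
split=> -[sD dom]; split=> // p pP.
  have [pD|pD] := boolP (p \in D); first by exists p; rewrite // d2xx.
  have [u uD /and4P[_ _ _ h]] := dom p pP pD.
  by exists u; rewrite // d2C -edist_le1.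
move=> pD; have [v vD h] := dom p pP; exists v => //=.
rewrite /udg_adj pP (sD v vD) edist_le1 d2C h andbT /=.
by apply: contraNneq pD => ->.
Qed.

End Output.

Theorem theorem2 (R : realType) :
  exists (prog : program) (T : nat -> nat),
    ((fun n : nat => (T n)%:R : R^o) =O_\oo
       (fun n : nat => n%:R * ln (n%:R : R) : R^o)) /\
    forall (P : {fset R * R}) (s : seq (R * R)), enumerates s P ->
      exists (t : nat) (c : config R) (ds : seq (R * R)) (D : {fset R * R}),
        [/\ halts_in prog (input s) t c,
            (t <= T #|` P|)%N,
            output c ds /\ enumerates ds D,
            dominating (udg P) D &
            forall Dstar : {fset R * R}, minimum_dominating (udg P) Dstar ->
              (#|` D|%:R : R) <= 44%:R / 9%:R * #|` Dstar|%:R].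
Proof.
(* [G] depends on the side of the blocks only, so the time bound is fixed before [P]. *)
have [G hG] := @good_block_spread R side%:R.
pose T n := (main_cost G * (n.+1 * (trunc_log 2 n).+2) + 1)%N.
exists algorithm, T; split; first exact: nlogn.
move=> P s [us sP]; set n := size s.
have cP : #|` P| = n by rewrite /n -(perm_size (uniq_perm (fset_uniq P) us _)) // => x; rewrite sP.
have [t [g [hg tg [gn _ _ gI _]]]] := algorithm_run s.
have [|L nL] := @main_spec R (n + n) G (start s) n _ erefl; first by [].
rewrite coords_mkseq -/n => /(_ _)[|C [C1 C2 C3 C4 C5]].
  by move=> x y r Q; apply: (grid_good hG).
have vC : valid s C.
  case: C1 => [->|[x [y [r sol]]]]; first exact: valid_self.
  have [pP _ _ _ _] := grid us nL r; exact: solution_valid sol.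
have [uC sC dC] := vC.
have Cn : (size C <= n)%N by apply: uniq_leq_size.
pose D : {fset R * R} := [fset x in C]%fset.
have DC : D =i C by move=> x; rewrite inE.
have cD : #|` D| = size C.
  by rewrite -(perm_size (uniq_perm (fset_uniq D) uC _)) // => x; rewrite DC.
exists t, g, C, D; split=> //.
- by rewrite cP; apply: leq_trans tg _; rewrite /T addn1 ltnS.
- split; last by split=> // x; rewrite DC.
  split=> [|i]; first by rewrite -[0%N]/(nr 0) gn C3.
  rewrite -addnn => ic; rewrite gI; last by rewrite -/n; lia.
  have [hi|hi] := ltnP i./2 (size C); last by move: hi ic; lia.
  have := C4 _ hi; rewrite -(nth_coords hi) => -[e1 e2].
  rewrite -[i]odd_double_half -addnn; case: (odd i); first exact: e2.
  exact: e1.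
- apply/dominatingP; split=> [x|p]; first by rewrite DC -sP; apply: sC.
  by rewrite -sP => /dC/hasP[v vC' h]; exists v; rewrite ?DC.
move=> Ds [/dominatingP[sDs dDs] _]; rewrite cD.
pose S : seq (R * R) := Ds.
have [s1 [s2 [r few]]] := few_cuts L s S.
have [C' sol' CC'] := C2 s1 s2 r.
have hS : {subset S <= s} by move=> x /sDs; rewrite sP.
have dS p : p \in s -> has (fun v => d2 v p <= 1) S.
  by rewrite sP => /dDs[v vD h]; apply/hasP; exists v.
have bound := solution_size us nL r hS dS sol'.
(* With [k] cut points, [500 * k <= 4 * size S] and [size C <= 4 * size S + 100 * k], hence
   [5 * size C <= 24 * size S]. *)
have main_ineq : (9 * size C <= 44 * size S)%N.
  move: few bound CC'; rewrite /side -lock; lia.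
rewrite -/S mulrAC ler_pdivlMr // -!natrM ler_nat mulnC; exact: main_ineq.
Qed.
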